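(* Let $s,t\ge 6$ be integers with $t$ even and $(s,t)\neq(6,6)$, put $S=s-4$, $T=t-4$, and let $$P=\frac{T+\sqrt{T^2+8ST}}{4}.$$ Let $X$ be an $(s,t)$-uniform simplicial complex. For spheres $S_n^{s,t}$ centered at an interior vertex of the disc of a minimal filling diagram associated to a loop of $X$, $$\lim_{n\to\infty}\frac{A_n^{s,t}}{|S_n^{s,t}|}=\sqrt{\frac{T+8+\sqrt{T^2+8ST}}{T-8+\sqrt{T^2+8ST}}}=\sqrt{\frac{P+2}{P-2}}.$$ Explicitly, denoting by $L$ the common value of the two expressions on the right: for every $\varepsilon>0$ there is $N\geq 1$ such that for every loop $\gamma$ of $X$, every minimal filling diagram $(D,f)$ for $\gamma$, every interior vertex $v$ of $D$, and every $n\ge N$ for which the sphere of radius $n$ centered at $v$ is complete in $D$, one has $\Big|\frac{A_n^{s,t}}{|S_n^{s,t}|}-L\Big|<\varepsilon$, where $A_n^{s,t}$ and $|S_n^{s,t}|$ are the area and the length of the sphere of radius $n$ in $D$ centered at $v$.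
   Context: Simplicial complexes. A simplicial complex is flag if any finite set of pairwise adjacent vertices spans a simplex. A loop (cycle) $\gamma$ in $X$ is a subcomplex isomorphic to a triangulation of $S^1$; it is a full cycle if every simplex of $X$ spanned by vertices of $\gamma$ is a simplex of $\gamma$. A simplicial map sends vertices to vertices, and sends each simplex onto the simplex spanned by the images of its vertices. Filling diagrams. A filling diagram for a loop $\gamma$ in $X$ is a simplicial map $f:D\to X$, where $D$ is a triangulated $2$-disc and $f|_{\partial D}$ maps $\partial D$ isomorphically onto $\gamma$. It is denoted $(D,f)$, and it is minimal if $D$ has the least possible number of triangles among all filling diagrams for $\gamma$. Interior vertices of $D$ are those not on $\partial D$; boundary vertices are those on $\partial D$. $(s,t)$-uniformness. A $k$-vertex of $D$ is an interior vertex with exactly $k$ neighbours. A flag, simply connected simplicial complex $X$ is $(s,t)$-uniform if the following holds. (1) If $s\ne t$: for every loop $\gamma$ in $X$ and every minimal filling diagram $(D,f)$ for $\gamma$, every interior vertex $u$ of $D$ is an $s$-vertex or a $t$-vertex; moreover (a) if $u$ is an $s$-vertex, each of its neighbours is a $t$-vertex or a boundary vertex; (b) if $u$ is a $t$-vertex, its neighbours form a full cycle $(u_1,\dots,u_t)$ whose vertices at odd indices are $t$-vertices or boundary vertices and whose vertices at even indices are $s$-vertices or boundary vertices. (2) If $s=t$: $X$ is $t$-uniform, i.e. in every minimal filling diagram for every loop every interior vertex has exactly $t$ neighbours. Spheres. Distances between vertices of $D$ are measured by the number of edges in a shortest path in the $1$-skeleton of $D$. For an interior vertex $v$ of $D$,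 the sphere $S_n^{s,t}$ of radius $n\ge 0$ centered at $v$ is the set of edges of $D$ both of whose endpoints are at distance $n$ from $v$; its length $|S_n^{s,t}|$ is the number of its edges. Its area $A_n^{s,t}$ is the number of triangles inside the sphere, i.e. the number of triangles of $D$ all of whose vertices are at distance at most $n$ from $v$. The sphere of radius $n$ centered at $v$ is complete in $D$ if all vertices of $D$ at distance at most $n$ from $v$ are interior vertices of $D$. *)

(* Defs.v *)
From HB Require Import structures.
From mathcomp Require Import all_boot all_order all_algebra finmap.
From mathcomp Require Import all_classical all_reals topology normedtype.

Set Implicit Arguments.
Unset Strict Implicit.
Unset Printing Implicit Defensive.

Import Order.TTheory GRing.Theory Num.Theory.
Import numFieldNormedType.Exports.

Local Open Scope classical_set_scope.
Local Open Scope ring_scope.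

(** * Abstract simplicial complexes *)

(* [v : V] is a vertex of [K] only if [[fset v]] is a simplex of [K], so that
   subcomplexes live on the same carrier. *)
Record complex (V : choiceType) := Complex {
  simplex :> {fset V} -> Prop;
  simplex_neq0 : forall A, simplex A -> A != fset0;
  simplex_face : forall A B, simplex A -> B != fset0 -> (B `<=` A)%fset ->
    simplex B }.

Section Combinatorics.
Variable V : choiceType.
Implicit Types (K C X : complex V) (u v w : V) (n : nat).

Definition vertex K v : Prop := K [fset v]%fset.

Definition adjacent K : rel V :=
  fun u v => (u != v) && `[< K [fset u; v]%fset >].

Definition subcomplex C K : Prop := forall A, C A -> K A.

Definition flag K : Prop := forall A : {fset V}, A != fset0 ->
  (forall v, v \in A -> vertex K v) ->
  (forall u v, u \in A -> v \in A -> u != v -> adjacent K u v) -> K A.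

Definition walk K v w n : Prop := exists p : seq V,
  [/\ path (adjacent K) v p, last v p = w & size p = n].

Definition at_distance K v w n : Prop :=
  walk K v w n /\ forall m, walk K v w m -> (n <= m)%N.

Definition cycle_simplex (c : seq V) : {fset V} -> Prop :=
  fun A => A != fset0 /\ exists2 x, x \in c & (A `<=` [fset x; next c x])%fset.

Lemma cycle_simplex_neq0 (c : seq V) A : cycle_simplex c A -> A != fset0.
Proof. by case. Qed.

Lemma cycle_simplex_face (c : seq V) A B :
  cycle_simplex c A -> B != fset0 -> (B `<=` A)%fset -> cycle_simplex c B.
Proof.
by move=> [_ [x xc sA]] B0 sB; split=> //; exists x => //; apply: fsubset_trans sA.
Qed.

(* The polygon with cyclically ordered vertices [c]. *)
Definition cycle_complex (c : seq V) : complex V :=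
  Complex (@cycle_simplex_neq0 c) (@cycle_simplex_face c).

End Combinatorics.

Definition simplicial_map (V W : choiceType) (K : complex V) (X : complex W)
    (f : V -> W) : Prop :=
  forall A : {fset V}, K A -> X [fset f v | v in A]%fset.

(** * Geometric realization *)

Section Realization.
Variables (R : realType) (V : choiceType).
Implicit Type K : complex V.

(* Barycentric coordinates of the points of the closed simplex spanned by A. *)
Definition closed_simplex (A : {fset V}) : set (V -> R) :=
  [set x | [/\ forall v, 0 <= x v, forall v, v \notin A -> x v = 0
             & \sum_(v <- A) x v = 1]].

Record realization K := Point {
  coord :> V -> R;
  coordP : exists2 A, K A & closed_simplex A coord }.

HB.instance Definition _ K := gen_eqMixin (realization K).
HB.instance Definition _ K := gen_choiceMixin (realization K).

(* Coherent (weak) topology: a set is open iff its trace on every closed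
   simplex is relatively open for the Euclidean topology of that simplex. *)
Definition realization_open K : set_system (realization K) :=
  [set U | forall A, K A -> exists W : set {ptws V -> R}, open W /\
     forall x : realization K, closed_simplex A x -> (U x <-> W (x : V -> R))].

Lemma realization_openT K : @realization_open K setT.
Proof. by move=> A _; exists setT; split; [exact: openT|]. Qed.

Lemma realization_openI K : setI_closed (@realization_open K).
Proof.
move=> U1 U2 o1 o2 A KA; have [W1 [oW1 h1]] := o1 A KA.
have [W2 [oW2 h2]] := o2 A KA; exists (W1 `&` W2); split; first exact: openI.
by move=> x xA; split=> -[/(h1 x xA) ? /(h2 x xA) ?].
Qed.

Lemma realization_open_bigU K (I : Type) (U : I -> set (realization K)) :
  (forall i, realization_open (U i)) -> realization_open (\bigcup_i U i).
Proof.
move=> oU A KA; have /choice[W hW] := fun i => oU i A KA.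
exists (\bigcup_i W i); split; first by apply: bigcup_open => i _; case: (hW i).
by move=> x xA; split=> -[i _ ?]; exists i => //; apply/((hW i).2 x xA).
Qed.

HB.instance Definition _ K := isOpenTopological.Build (realization K)
  (@realization_openT K) (@realization_openI K) (@realization_open_bigU K).

End Realization.

Section Triangulations.
Variable R : realType.

Definition unit_disc : set (R * R) := [set p | p.1 ^+ 2 + p.2 ^+ 2 <= 1].
Definition unit_circle : set (R * R) := [set p | p.1 ^+ 2 + p.2 ^+ 2 = 1].

Definition homeomorphism_onto (T U : topologicalType) (B : set U)
    (h : T -> U) : Prop :=
  [/\ continuous h, range h = B &
      exists g : U -> T, {within B, continuous g} /\ cancel h g].

Definition triangulates (V : choiceType) (K : complex V) (B : set (R * R)) :
    Prop :=
  exists h : realization R K -> R * R, homeomorphism_onto B h.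

Definition path_connected (T : topologicalType) : Prop :=
  forall x y : T, exists p : R -> T,
    [/\ {within `[0, 1], continuous p}, p 0 = x & p 1 = y].

(* Every loop is homotopic, relative to its base point, to a constant loop. *)
Definition simply_connected (T : topologicalType) : Prop :=
  path_connected T /\
  forall p : R -> T, {within `[0, 1], continuous p} -> p 0 = p 1 ->
  exists H : R * R -> T,
    [/\ {within `[0, 1]%classic `*` `[0, 1]%classic, continuous H},
        forall a, 0 <= a <= 1 -> H (0, a) = p a,
        forall a, 0 <= a <= 1 -> H (1, a) = p 0 &
        forall b, 0 <= b <= 1 -> H (b, 0) = p 0 /\ H (b, 1) = p 0].

Definition loop (V : choiceType) (X C : complex V) : Prop :=
  subcomplex C X /\ triangulates C unit_circle.

Definition full_cycle (V : choiceType) (X C : complex V) : Prop :=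
  loop X C /\
  forall A, X A -> (forall v, v \in A -> vertex C v) -> C A.

(* A disc being compact, the finiteness of the vertex set is no restriction. *)
Definition triangulated_disc (V : finType) (D : complex V) : Prop :=
  triangulates D unit_disc.

(* The simplices whose points correspond to points of the unit circle, i.e. to
   points of the boundary of the unit disc. *)
Definition boundary (V : finType) (D : complex V) : set {fset V} :=
  [set A | D A /\ exists h : realization R D -> R * R,
     homeomorphism_onto unit_disc h /\
     forall x : realization R D, closed_simplex A x -> unit_circle (h x)].

Definition boundary_vertex (V : finType) (D : complex V) (v : V) : Prop :=
  boundary D [fset v]%fset.

Definition interior_vertex (V : finType) (D : complex V) (v : V) : Prop :=
  vertex D v /\ ~ boundary_vertex D v.

Definition k_vertex (k : nat) (V : finType) (D : complex V) (v : V) : Prop :=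
  interior_vertex D v /\ #|[pred w | adjacent D v w]| = k.

(** * Filling diagrams *)

Definition triangle_number (V : finType) (D : complex V) : nat :=
  #|[pred A : {fset V} | `[< D A /\ #|` A| = 3%N >]]|.

Definition filling (W : choiceType) (X C : complex W)
    (V : finType) (D : complex V) (f : V -> W) : Prop :=
  [/\ triangulated_disc D,
      simplicial_map D X f,
      (forall u v, boundary_vertex D u -> boundary_vertex D v ->
         f u = f v -> u = v) &
      forall B : {fset W}, C B <->
        exists2 A, boundary D A & B = [fset f v | v in A]%fset].

Definition minimal_filling (W : choiceType) (X C : complex W)
    (V : finType) (D : complex V) (f : V -> W) : Prop :=
  filling X C D f /\
  forall (V' : finType) (D' : complex V') (f' : V' -> W),
    filling X C D' f' -> (triangle_number D <= triangle_number D')%N.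

(* Position [i] of the sequence [c], counted from 0, is the vertex of index
   [i.+1] of the cycle: odd indices are the even positions. *)
Definition uniform_at (s t : nat) (V : finType) (D : complex V) (u : V) :
    Prop :=
  [/\ k_vertex s D u \/ k_vertex t D u,
      k_vertex s D u ->
        forall w, adjacent D u w -> k_vertex t D w \/ boundary_vertex D w &
      k_vertex t D u ->
        exists c : seq V,
          [/\ uniq c, size c = t, forall w, (w \in c) = adjacent D u w,
              full_cycle D (cycle_complex c) &
              forall i, (i < t)%N ->
                if odd i.+1
                then k_vertex t D (nth u c i) \/ boundary_vertex D (nth u c i)
                else k_vertex s D (nth u c i) \/ boundary_vertex D (nth u c i)]].

Definition st_uniform (s t : nat) (W : choiceType) (X : complex W) : Prop :=
  [/\ flag X, simply_connected (realization R X) &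
      forall C : complex W, loop X C ->
      forall (V : finType) (D : complex V) (f : V -> W),
        minimal_filling X C D f ->
      forall u : V, interior_vertex D u ->
        if s == t then k_vertex t D u else uniform_at s t D u].

(** * Spheres *)

Definition sphere_edge (V : finType) (D : complex V) (v : V) (n : nat) :
    set {fset V} :=
  [set A | [/\ D A, #|` A| = 2%N & forall w, w \in A -> at_distance D v w n]].

Definition sphere_length (V : finType) (D : complex V) (v : V) (n : nat) : nat :=
  #|[pred A : {fset V} | `[< sphere_edge D v n A >]]|.

Definition sphere_area (V : finType) (D : complex V) (v : V) (n : nat) : nat :=
  #|[pred A : {fset V} | `[< [/\ D A, #|` A| = 3%N &
      forall w, w \in A -> exists2 m, (m <= n)%N & at_distance D v w m] >]]|.

Definition sphere_complete (V : finType) (D : complex V) (v : V) (n : nat) :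
    Prop :=
  forall w m, (m <= n)%N -> at_distance D v w m -> interior_vertex D w.

End Triangulations.

(* Main.v *)
(* Winding numbers mod 2 in the plane show that a triangulated disc has no simplex with more than
   three vertices, that each edge lies in at most two triangles (exactly two at an interior vertex),
   that every even set of edges bounds mod 2, and that a mod 2 chain of triangles whose boundary
   avoids a vertex [w] of it contains the whole star of [w], [w] being interior.

   These facts give a combinatorial Gauss-Bonnet inequality. As interior degrees are at least 6, a
   region between two geodesics issued from [v] cannot have enough positive curvature, so inside a
   complete sphere every vertex has one or two parents, two parents are adjacent, two adjacent
   vertices of the same level have a unique common parent, and each vertex has exactly two siblings
   on its sphere. Hence a sphere has as many edges as vertices, and
   A_n = |S_n| + 2 sum_(k < n) |S_k|.

   In a uniform disc with s <> t every triangle has exactly one s-vertex: two s-vertices are not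
   adjacent, and the two other corners are consecutive on the even full cycle around a t-vertex.
   Counting the triangles that meet the k-th sphere, with and without marking the s-vertices, gives
   for the numbers x_k, y_k of s- and t-vertices on the k-th sphere
     x_(k+1) + x_(k-1) = (T/2) y_k,   y_(k+1) + y_(k-1) = S x_k + (T/2) y_k;
   for s = t, x = |S_k|/3 and y = 2|S_k|/3 satisfy the same system. Its matrix has the eigenvalues P
   and mu = (T - sqrt(T^2 + 8ST))/4 with |mu| < P, and with lam + 1/lam = P the ratio tends to
   (lam + 1)/(lam - 1) = sqrt((P + 2)/(P - 2)). *)

Require Import Defs.
From mathcomp Require Import all_boot all_order all_algebra finmap.
From mathcomp Require Import all_classical all_reals topology normedtype.
From mathcomp Require Import ring lra zify.
Set Implicit Arguments.
Unset Strict Implicit.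
Unset Printing Implicit Defensive.
Import Order.TTheory GRing.Theory Num.Theory.
Local Open Scope ring_scope.

(** * Charts of a triangulated disc *)

Section Charts.
Import numFieldNormedType.Exports.
Local Open Scope classical_set_scope.
Local Open Scope ring_scope.

(** A disc is given by a bare homeomorphism, so even the number of triangles on an edge is a
    topological question. The answers have one source: around a point sent inside the open disc, the
    mod 2 crossing cochain of a half-line issuing from its image is not a coboundary on the frontier
    of the open star, because radial projection would make it one on a square around the image. The
    converse ingredient is a Poincare lemma on the disc: every mod 2 cocycle is a coboundary, so by
    linear duality every even edge set bounds. The record [disc_like] collects the outcome, and what
    follows it is finite combinatorics. Gauss-Bonnet only needs V - E + F >= 1, obtained by counting
    edge sets. It is applied to regions whose sides may have convex vertices; pushing a side across
    such a vertex keeps the levels and removes triangles, so the descent ends at a region with too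
    little turning. The radius N may not depend on the disc, although x_1 and y_1 do. Up to a common
    factor, which cancels in the ratio, the initial data enter through one coefficient, bounded in
    terms of S and T alone. *)

Definition polyhedron (R : realType) (V : choiceType) (D : complex V) : set (V -> R) :=
  [set x | exists2 A, D A & closed_simplex A x].

Definition near_coord (R : realType) (V : Type) (e : R) (x y : V -> R) : Prop :=
  forall v, `|x v - y v| < e.

Definition near_plane (R : realType) (e : R) (p q : R * R) : bool :=
  (`|p.1 - q.1| < e) && (`|p.2 - q.2| < e).

Lemma near_plane_sym (R : realType) (e : R) p q : near_plane e p q = near_plane e q p.
Proof. by rewrite /near_plane distrC (distrC p.2). Qed.

Lemma near_planeD (R : realType) (a b : R) p q r :
  near_plane a p q -> near_plane b q r -> near_plane (a + b) p r.
Proof.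
move=> /andP[h1 h2] /andP[h3 h4]; apply/andP; split.
  exact: le_lt_trans (ler_distD q.1 _ _) (ltrD h1 h3).
exact: le_lt_trans (ler_distD q.2 _ _) (ltrD h2 h4).
Qed.

Section Chart.
Variables (R : realType) (V : finType).

(** [H] and [G] are total functions constrained only on [P] and on the disc, and continuity takes
    the form of uniform estimates, so that later arguments are inequalities between coordinates. *)
Record disc_chart (P : set (V -> R)) (H : (V -> R) -> R * R) (G : R * R -> V -> R) : Prop := DiscChart {
  chart_disc : forall x, P x -> unit_disc (H x);
  chartK : forall x, P x -> G (H x) = x;
  chart_inv : forall p, unit_disc p -> P (G p);
  chart_invK : forall p, unit_disc p -> H (G p) = p;
  chart_unif : forall e, 0 < e -> exists2 d, 0 < d & forall x y,
    P x -> P y -> near_coord d x y -> near_plane e (H x) (H y);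
  chart_inv_unif : forall e, 0 < e -> exists2 d, 0 < d & forall p q,
    unit_disc p -> unit_disc q -> near_plane d p q -> near_coord e (G p) (G q) }.

Variable D : complex V.

Lemma realization_eq (x y : realization R D) : (forall v, x v = y v) -> x = y.
Proof.
case: x y => [x px] [y py] /= xy.
have {xy} E : x = y by apply: funext.
by rewrite {}E in px *; congr Point; apply: Prop_irrelevance.
Qed.

Lemma coord_continuous v : continuous (fun x : realization R D => x v : R).
Proof.
apply/continuousP => O oO.
suff h : realization_open ((fun x : realization R D => x v : R) @^-1` O) by exact: h.
move=> A DA.
exists [set y : {ptws V -> R} | O (y v)]; split => //.
apply: open_comp => // y _.
exact: (@proj_continuous V (fun=> R) v y).
Qed.

Lemma unit_disc_compact : compact (@unit_disc R).
Proof.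
apply: (@subclosed_compact _ _ ((`[-1, 1]%classic : set R) `*` (`[-1, 1]%classic : set R))).
- have -> : @unit_disc R = (fun p : R * R => p.1 * p.1 + p.2 * p.2) @^-1` [set x | x <= 1].
    by apply/seteqP; split => p; rewrite /unit_disc /= !expr2.
  apply: preimage_closed; last exact: closed_le.
  by move=> p _; apply: cvgD; apply: cvgM; (exact: cvg_fst || exact: cvg_snd).
- by apply: compact_setX; apply: segment_compact.
- move=> [a b]; rewrite /unit_disc /= !in_itv /= => h.
  by split; apply/andP; split; nra.
Qed.

Lemma compact_at_right (X : topologicalType) (K : set X) (P : R -> X -> Prop) :
  compact K ->
  (forall x, K x -> \forall x' \near x & d \near 0^'+, K x' -> P d x') ->
  exists2 d, 0 < d & forall x, K x -> P d x.
Proof.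
move=> /compact_near_coveringP/near_covering_withinP cK hP.
have Pd := cK _ (0^'+) P (at_right_proper_filter 0) hP.
have [d [Kd d0]] := filter_ex (filterI Pd (nbhs_right_gt 0)).
by exists d.
Qed.

Lemma near_plane_nbhs (p : R * R) (e : R) : 0 < e -> \forall q \near p, near_plane e p q.
Proof.
move=> e0; near=> q; rewrite /near_plane; apply/andP; split.
  near: q; have : \forall x \near p.1, `|p.1 - x| < e.
    by have /cvgrPdist_lt := @cvg_id _ (nbhs p.1); apply.
  exact: cvg_fst.
near: q; have : \forall x \near p.2, `|p.2 - x| < e.
  by have /cvgrPdist_lt := @cvg_id _ (nbhs p.2); apply.
exact: cvg_snd.
Unshelve. all: by end_near. Qed.

Lemma near_fst (X Y : topologicalType) (x : X) (y : Y) (A : set X) :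
  nbhs x A -> \forall z \near (x, y), A z.1.
Proof. by move=> xA; apply: (@cvg_fst _ _ (nbhs x) (nbhs y)). Qed.

Lemma near_snd (X Y : topologicalType) (x : X) (y : Y) (A : set Y) :
  nbhs y A -> \forall z \near (x, y), A z.2.
Proof. by move=> yA; apply: (@cvg_snd _ _ (nbhs x) (nbhs y)). Qed.

(** Both moduli come from compactness of the set of pairs of points of the disc. For [H]: near a
    diagonal pair the two points are close anyway, and near any other pair some coordinate of [G]
    separates them. *)
Lemma homeomorphism_chart (h : realization R D -> R * R) :
  homeomorphism_onto (@unit_disc R) h ->
  exists H G, disc_chart (polyhedron D) H G /\ forall x : realization R D, H x = h x.
Proof.
case=> _ hr [g [gc hK]].
pose H x := if pselect (polyhedron D x) is left px then h (Point px) else 0.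
pose G p : V -> R := g p.
have HE (x : realization R D) : H x = h x.
  rewrite /H; case: pselect => [px|]; last by case; exact: coordP.
  by congr h; apply: realization_eq.
have Hd x : polyhedron D x -> unit_disc (H x).
  by move=> px; rewrite (HE (Point px)) -hr; exists (Point px).
have HK x : polyhedron D x -> G (H x) = x.
  by move=> px; rewrite (HE (Point px)) /G hK.
have Gd p : polyhedron D (G p) by exact: coordP.
have GK p : unit_disc p -> H (G p) = p.
  by rewrite -hr => -[x _ <-]; rewrite /G hK HE.
have Gc v p : unit_disc p -> forall e, 0 < e ->
    \forall q \near p, unit_disc q -> `|G p v - G q v| < e.
  move=> dp e e0.
  have /= cg : {within @unit_disc R, continuous (fun q => G q v)}.
    move=> q; exact: (cvg_comp _ _ (gc q) (@coord_continuous v (g q))).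
  have /cvgrPdist_lt/(_ _ e0) : G q v @[q --> within (@unit_disc R) (nbhs p)] --> G p v.
    by have := cg p; rewrite nbhs_subspace_in.
  by [].
exists H, G; split=> //; split=> //.
- move=> e e0.
  have [d d0 Pd] : exists2 d, 0 < d & forall pq, (@unit_disc R `*` @unit_disc R) pq ->
      near_coord d (G pq.1) (G pq.2) -> near_plane e pq.1 pq.2.
    apply: (@compact_at_right _ _ (fun d (pq : (R * R) * (R * R)) => near_coord d (G pq.1) (G pq.2) -> near_plane e pq.1 pq.2)).
      by apply: compact_setX; exact: unit_disc_compact.
    move=> [p q] [/= dp dq].
    have [<-|pq] := eqVneq p q.
      have e2 : 0 < e / 2 by rewrite divr_gt0.
      have N1 := near_fst p (near_plane_nbhs p e2).
      have N2 := near_snd p (near_plane_nbhs p e2).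
      near=> pq d => -[/= dp' dq'] _.
      have a : near_plane (e / 2) p pq.1 by near: pq; exact: N1.
      have b : near_plane (e / 2) p pq.2 by near: pq; exact: N2.
      by rewrite [e]splitr; apply: near_planeD b; rewrite near_plane_sym.
    have [v vn] : exists v, G p v != G q v.
      apply: contrapT => /forallNP Gpq; case/eqP: pq.
      rewrite -(GK p) // -(GK q) //; congr H; apply: funext => v.
      by have /negP := Gpq v; rewrite negbK => /eqP.
    (* Three quarters of the gap can be lost, one to each moving point and one to [d], and the gap
       is still positive. *)
    have c0 : 0 < `|G p v - G q v| / 4 by rewrite divr_gt0 // normr_gt0 subr_eq0.
    have N1 := near_fst q (Gc v p dp _ c0).
    have N2 := near_snd p (Gc v q dq _ c0).
    near=> pq' d => -[/= dp' dq'] /(_ v).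
    have : unit_disc pq'.1 -> `|G p v - G pq'.1 v| < `|G p v - G q v| / 4.
      by near: pq'; exact: N1.
    have : unit_disc pq'.2 -> `|G q v - G pq'.2 v| < `|G p v - G q v| / 4.
      by near: pq'; exact: N2.
    have : d <= `|G p v - G q v| / 4 by near: d; exact: nbhs_right_le.
    move=> h1 /(_ dq') h2 /(_ dp') h3 h4; exfalso.
    have := ler_distD (G pq'.1 v) (G p v) (G q v).
    have := ler_distD (G pq'.2 v) (G pq'.1 v) (G q v).
    by rewrite (distrC (G pq'.2 v) (G q v)); move: h1 h2 h3 h4; lra.
  exists d => // x y px py xy.
  by apply: (Pd (H x, H y)) => /=; [split=> /=; exact: Hd | rewrite !HK].
- move=> e e0.
  have [d d0 Pd] : exists2 d, 0 < d & forall pq, (@unit_disc R `*` @unit_disc R) pq ->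
      near_plane d pq.1 pq.2 -> near_coord e (G pq.1) (G pq.2).
    apply: (@compact_at_right _ _ (fun d (pq : (R * R) * (R * R)) => near_plane d pq.1 pq.2 -> near_coord e (G pq.1) (G pq.2))).
      by apply: compact_setX; exact: unit_disc_compact.
    move=> [p q] [/= dp dq].
    have [<-|pq] := eqVneq p q.
      have e2 : 0 < e / 2 by rewrite divr_gt0.
      have N := @filter_forall _ V (fun v q => unit_disc q -> `|G p v - G q v| < e / 2) (nbhs p) (nbhs_filter p)
        (fun v => Gc v p dp _ e2).
      have N1 := near_fst p N.
      have N2 := near_snd p N.
      near=> pq d => -[/= dp' dq'] _ v.
      have h1 : forall v, unit_disc pq.1 -> `|G p v - G pq.1 v| < e / 2 by near: pq; exact: N1.
      have h2 : forall v, unit_disc pq.2 -> `|G p v - G pq.2 v| < e / 2 by near: pq; exact: N2.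
      have := ler_distD (G p v) (G pq.1 v) (G pq.2 v); rewrite (distrC (G pq.1 v) (G p v)).
      move: (h1 v dp') (h2 v dq'); lra.
    have [c c0 cpq] : exists2 c, 0 < c & ~~ near_plane (3 * c) p q.
      have [h1|h1] := ltP 0 `|p.1 - q.1|.
        exists (`|p.1 - q.1| / 3); first by rewrite divr_gt0.
        by rewrite /near_plane (mulrC 3) divfK ?pnatr_eq0 ?ltxx.
      have [h2|h2] := ltP 0 `|p.2 - q.2|.
        exists (`|p.2 - q.2| / 3); first by rewrite divr_gt0.
        by apply/negP => /andP[_]; rewrite mulrC divfK ?pnatr_eq0 // ltxx.
      case/eqP: pq; apply/eqP; rewrite [p]surjective_pairing [q]surjective_pairing.
      by move: h1 h2; rewrite !normr_le0 !subr_eq0 => /eqP -> /eqP ->.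
    have N1 := near_fst q (near_plane_nbhs p c0).
    have N2 := near_snd p (near_plane_nbhs q c0).
    near=> pq' d => -[/= dp' dq'] dpq.
    have a : near_plane c p pq'.1 by near: pq'; exact: N1.
    have b : near_plane c q pq'.2 by near: pq'; exact: N2.
    have dc : d <= c by near: d; exact: nbhs_right_le.
    case/negP: cpq; rewrite (_ : 3 * c = c + (c + c)); last by ring.
    apply: near_planeD a (near_planeD _ _) => [|]; last by rewrite near_plane_sym; exact: b.
    by case/andP: dpq => h1 h2; apply/andP; split; [apply: lt_le_trans h1 dc|apply: lt_le_trans h2 dc].
  by exists d => // p q dp dq pq; apply: (Pd (p, q)).
Unshelve. all: end_near.
Qed.

Definition simplices : {set {set V}} := [set A : {set V} | `[< D [fset v in A]%fset >]].

Definition supp (x : V -> R) : {set V} := [set v | 0 < x v].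

Definition bary (K : {set {set V}}) (x : V -> R) : Prop :=
  [/\ forall v, 0 <= x v, \sum_v x v = 1 & supp x \in K].

Lemma simplicesP (A : {set V}) : reflect (D [fset v in A]%fset) (A \in simplices).
Proof. by rewrite finset.inE; exact: asboolP. Qed.

Lemma simplices_face (A B : {set V}) : A \in simplices -> B != finset.set0 -> B \subset A -> B \in simplices.
Proof.
move=> /simplicesP DA B0 sBA; apply/simplicesP.
suff: forall B' : {fset V}, (B' = [fset v in B])%fset -> D B' by exact.
move=> B' EB; apply: (simplex_face DA); rewrite {}EB.
  by have [v vB] := finset.set0Pn _ B0; apply/fset0Pn; exists v; rewrite inE.
by apply/fsubsetP => v; rewrite !inE /=; exact: (fintype.subsetP sBA).
Qed.

Lemma simplices_neq0 (A : {set V}) : A \in simplices -> A != finset.set0.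
Proof.
move=> /simplicesP /simplex_neq0 /fset0Pn[v]; rewrite inE /= => vA.
by apply/finset.set0Pn; exists v.
Qed.

Lemma sum_fset (A : {fset V}) (x : V -> R) : \sum_(v | v \in A) x v = \sum_(v <- A) x v.
Proof.
rewrite -big_filter; apply: perm_big; apply: uniq_perm => [||v].
- exact/filter_uniq/index_enum_uniq.
- exact: fset_uniq.
- by rewrite mem_filter mem_index_enum andbT.
Qed.

(** A point lies in the simplex spanned by its support, so membership becomes a condition on
    [supp x] alone. *)
Lemma polyhedronE : polyhedron D = bary simplices.
Proof.
apply/seteqP; split=> x.
  case=> A DA [x0 xA xs].
  have xE : \sum_v x v = 1.
    rewrite -[RHS]xs [LHS](bigID (fun v => v \in A)) /= [X in _ + X]big1 ?addr0; last by move=> v /xA.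
    exact: sum_fset.
  split=> //; apply/simplicesP.
  suff: forall B : {fset V}, (B = [fset v in supp x])%fset -> D B by exact.
  move=> B EB; apply: (simplex_face DA); rewrite {}EB.
    have [v xv] : exists v, 0 < x v.
      apply: contrapT => /forallNP h; have : \sum_v x v <= 0.
        by apply: sumr_le0 => v _; have /negP := h v; rewrite -leNgt.
      by rewrite xE; lra.
    by apply/fset0Pn; exists v; rewrite !inE.
  apply/fsubsetP => v; rewrite !inE /= => xv; apply: contraT => /xA xv0.
  by rewrite xv0 ltxx in xv.
case=> x0 xs /simplicesP DA.
exists [fset v in supp x]%fset => //.
have xN v : v \notin [fset v in supp x]%fset -> x v = 0.
  by rewrite !inE /= -leNgt => xv; apply/eqP; rewrite eq_le xv x0.
split => //.
rewrite -[RHS]xs [RHS](bigID (fun v => v \in [fset v in supp x]%fset)) /=.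
by rewrite [X in _ = _ + X]big1 ?addr0 ?sum_fset // => v /xN.
Qed.

End Chart.

End Charts.

(** * Mod 2 winding in the plane *)

Section PathSum.
Variables (X : Type) (c : X -> X -> bool).
Implicit Types f g : nat -> X.

Definition path_sum f (N : nat) := \big[addb/false]_(i < N) c (f i) (f i.+1).

(** A discrete homotopy: the squares between the two paths telescope and leave the first and last
    rungs. *)
Lemma path_sum_ladder f g N :
  (forall i, (i < N)%N -> c (f i) (f i.+1) (+) c (f i.+1) (g i.+1) =
                          c (f i) (g i) (+) c (g i) (g i.+1)) ->
  path_sum f N (+) path_sum g N = c (f 0) (g 0) (+) c (f N) (g N).
Proof.
rewrite /path_sum; elim: N => [|N IH] h; first by rewrite !big_ord0 !addbb.
have {IH} := IH (fun i iN => h i (leqW iN)); have := h N (ltnSn N).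
rewrite !big_ord_recr /=; set A := \big[_/_]_(i < N) _; set B := \big[_/_]_(i < N) _.
move: A B (c (f 0) (g 0)) (c (f N) (g N)) (c (g N) (g N.+1)) (c (f N) (f N.+1)) (c (f N.+1) (g N.+1)).
by do 7!case.
Qed.

Lemma path_sum_coboundary (b : nat -> bool) f N :
  (forall i, (i < N)%N -> c (f i) (f i.+1) = b i (+) b i.+1) ->
  path_sum f N = b 0%N (+) b N.
Proof.
rewrite /path_sum; elim: N => [|N IH] h; first by rewrite big_ord0 addbb.
rewrite big_ord_recr /= IH => [|i iN]; last by apply: h; exact: leqW.
by rewrite h // addbA -(addbA (b 0%N)) addbb addbF.
Qed.

End PathSum.

Section Winding.
Variable R : realType.
Implicit Types (u v w p q r : R * R) (m d e : R).

(** A crossing of the half-line of negative first coordinates. Only the first coordinate of [u] is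
    tested, which is harmless for close points far from the origin. *)
Definition wind u v : bool := (u.1 < 0) && ((0 <= u.2) (+) (0 <= v.2)).

Definition far m u : bool := (m <= `|u.1|) || (m <= `|u.2|).

Lemma windxx u : wind u u = false.
Proof. by rewrite /wind addbb andbF. Qed.

Lemma near_planexx (d : R) p : 0 < d -> near_plane d p p.
Proof. by move=> d0; rewrite /near_plane !subrr normr0 d0. Qed.

Lemma near_plane_le d e p q : d <= e -> near_plane d p q -> near_plane e p q.
Proof. by move=> de /andP[h1 h2]; rewrite /near_plane !(lt_le_trans _ de). Qed.

Lemma near_planeB d p q r : near_plane d (p - r) (q - r) = near_plane d p q.
Proof.
rewrite /near_plane /= (_ : p.1 - r.1 - (q.1 - r.1) = p.1 - q.1); last by ring.
by rewrite (_ : p.2 - r.2 - (q.2 - r.2) = p.2 - q.2); last by ring.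
Qed.

Lemma near_planeBl (d : R) p q r : near_plane d (r - p) (r - q) = near_plane d p q.
Proof.
rewrite near_plane_sym /near_plane /= (_ : r.1 - q.1 - (r.1 - p.1) = p.1 - q.1); last by ring.
by rewrite (_ : r.2 - q.2 - (r.2 - p.2) = p.2 - q.2); last by ring.
Qed.

Lemma farN_near m p q : far m (p - q) = ~~ near_plane m p q.
Proof. by rewrite /far /near_plane negb_and -!leNgt. Qed.

(** If of two close points just one has a negative first coordinate, both first coordinates are
    small. The second ones are then large and of the same sign, so there is no crossing whichever
    point is tested. *)
Lemma wind_cocycle m u v w : 0 < m -> far m u -> far m v -> far m w ->
  near_plane (m / 4) u v -> near_plane (m / 4) v w -> near_plane (m / 4) u w ->
  wind u v (+) wind v w = wind u w.
Proof.
move=> m0; rewrite /far !ler_normr => fu fv fw.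
rewrite /near_plane !ltr_norml => /andP[/andP[a1 a2] /andP[a3 a4]]
  /andP[/andP[b1 b2] /andP[b3 b4]] /andP[/andP[c1 c2] /andP[c3 c4]].
rewrite /wind.
have [hu|hu] := ltP u.1 0; have [hv|hv] := ltP v.1 0 => //=.
- by rewrite addbA -(addbA (0 <= u.2)) addbb addbF.
- have vw : (0 <= v.2) = (0 <= w.2).
    have [h1|h1] := leP 0 v.2; have [h2|h2] := leP 0 w.2 => //; exfalso;
    case/orP: fv => [/orP[h|h]|/orP[h|h]]; lra.
  by rewrite vw addbF.
- have -> : (0 <= v.2) = (0 <= w.2).
    have [h1|h1] := leP 0 v.2; have [h2|h2] := leP 0 w.2 => //; exfalso;
    case/orP: fv => [/orP[h|h]|/orP[h|h]]; lra.
  by rewrite addbb.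
Qed.

(** Steps and rungs below [m / 8] keep the diagonals of the squares below the [m / 4] of the cocycle
    rule. *)
Lemma wind_ladder m (f g : nat -> R * R) N : 0 < m ->
  (forall i, (i <= N)%N -> [/\ far m (f i), far m (g i) & near_plane (m / 8) (f i) (g i)]) ->
  (forall i, (i < N)%N -> near_plane (m / 8) (f i) (f i.+1) /\
                          near_plane (m / 8) (g i) (g i.+1)) ->
  path_sum wind f N (+) path_sum wind g N = wind (f 0) (g 0) (+) wind (f N) (g N).
Proof.
move=> m0 h1 h2; apply: path_sum_ladder => i iN.
have [fN gN nN] := h1 i (ltnW iN); have [fS gS nS] := h1 i.+1 iN.
have [nf ng] := h2 i iN.
have m84 : m / 8 + m / 8 = m / 4 by field.
have le84 : m / 8 <= m / 4 by lra.
have nd : near_plane (m / 4) (f i) (g i.+1) by rewrite -m84; exact: near_planeD nN ng.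
rewrite (wind_cocycle m0 fN fS gS (near_plane_le le84 nf) (near_plane_le le84 nS) nd).
by rewrite (wind_cocycle m0 fN gN gS (near_plane_le le84 nN) (near_plane_le le84 ng) nd).
Qed.

(* The four sides of the square are subdivided; only the left one meets the cut. *)
Lemma wind_square (r e : R) (b : R * R -> bool) : 0 < r -> 0 < e ->
  ~ (forall u v, far r u -> far r v -> `|u.1| <= r -> `|u.2| <= r ->
       `|v.1| <= r -> `|v.2| <= r -> near_plane e u v -> wind u v = b u (+) b v).
Proof.
move=> r0 e0 hb.
have [N eN] : exists N : nat, 2 * r / e < N.+1%:R.
  exists (Num.truncn (2 * r / e)); exact: Num.Theory.truncnS_gt.
have N0 : 0 < N.+1%:R :> R by rewrite ltr0n.
pose s (i : nat) : R := r - (2 * r) * (i%:R / N.+1%:R).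
have s0 : s 0%N = r by rewrite /s mul0r mulr0 subr0.
have sN : s N.+1 = - r by rewrite /s divff ?gt_eqF //; ring.
have sb i : (i <= N.+1)%N -> `|s i| <= r.
  move=> iN; have h1 : 0 <= i%:R / N.+1%:R :> R by rewrite divr_ge0 // ler0n.
  have h2 : i%:R / N.+1%:R <= 1 :> R by rewrite ler_pdivrMr // mul1r ler_nat.
  rewrite ler_norml /s; move: (i%:R / _) h1 h2 => t h1 h2.
  have h3 : 0 <= r * t by rewrite mulr_ge0 ?(ltW r0).
  have h4 : 0 <= r * (1 - t) by rewrite mulr_ge0 ?(ltW r0) ?subr_ge0.
  by lra.
have sd i : `|s i - s i.+1| < e.
  have -> : s i - s i.+1 = 2 * r / N.+1%:R.
    rewrite /s -(natr1 i) mulrDl mul1r; ring.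
  by rewrite gtr0_norm ?divr_gt0 ?mulr_gt0 // ltr_pdivrMr // (mulrC e) -ltr_pdivrMr.
have side (f : nat -> R * R) :
    (forall i, (i <= N.+1)%N -> [/\ far r (f i), `|(f i).1| <= r & `|(f i).2| <= r]) ->
    (forall i, near_plane e (f i) (f i.+1)) ->
    path_sum wind f N.+1 = b (f 0%N) (+) b (f N.+1).
  move=> h1 h2; apply: (path_sum_coboundary (b := b \o f)) => i iN.
  by have [? ? ?] := h1 i (ltnW iN); have [? ? ?] := h1 i.+1 iN; exact: hb.
have := side (fun i => (s i, r)); have := side (fun i => (s i, - r)).
have := side (fun i => (r, s i)); have := side (fun i => (- r, s i)).
rewrite /= !s0 !sN.
have sides x (f : nat -> R * R) : (f = fun i => (x, s i)) \/ (f = fun i => (s i, x)) -> `|x| = r ->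
   (forall i, (i <= N.+1)%N -> [/\ far r (f i), `|(f i).1| <= r & `|(f i).2| <= r]) /\
   (forall i, near_plane e (f i) (f i.+1)).
  by move=> [] -> xr; split=> i; rewrite /far /near_plane /= ?subrr ?normr0 ?e0 ?sd // => iN;
    rewrite xr lexx ?orbT; split => //; exact: sb.
have nR : `|r| = r by rewrite ger0_norm ?ltW.
have nNR : `|- r| = r by rewrite normrN.
have [p1 p2] := sides (- r) (fun i => (- r, s i)) (or_introl erefl) nNR; move=> /(_ p1 p2).
have [q1 q2] := sides r (fun i => (r, s i)) (or_introl erefl) nR; move=> + /(_ q1 q2).
have [t1 t2] := sides (- r) (fun i => (s i, - r)) (or_intror erefl) nNR; move=> + + /(_ t1 t2).
have [v1 v2] := sides r (fun i => (s i, r)) (or_intror erefl) nR; move=> + + + /(_ v1 v2).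
have -> : path_sum wind (fun i => (r, s i)) N.+1 = false.
  by rewrite /path_sum big1 // => i _; rewrite /wind /= ltNge (ltW r0).
have -> : path_sum wind (fun i => (s i, r)) N.+1 = false.
  by rewrite /path_sum big1 // => i _; rewrite /wind /= addbb andbF.
have -> : path_sum wind (fun i => (s i, - r)) N.+1 = false.
  by rewrite /path_sum big1 // => i _; rewrite /wind /= addbb andbF.
have -> : path_sum wind (fun i => (- r, s i)) N.+1 = true.
  rewrite (path_sum_coboundary (b := fun i => 0 <= s i)).
    by rewrite s0 sN (ltW r0) oppr_ge0 leNgt r0.
  by move=> i iN; rewrite /wind /= oppr_lt0 r0.
by move: (b _) (b _) (b _) (b _); do 4!case.
Qed.

End Winding.

From mathcomp Require Import fintype finset.

(** * Crossing numbers of affine segments *)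

Section Segments.
Variables (R : realType) (V : finType).
Implicit Types (x y z : V -> R) (A B T : {set V}) (m d e t : R) (p q : R * R) (a b v w : V).

Definition simplex_pt A x : Prop :=
  [/\ forall v, 0 <= x v, \sum_v x v = 1 & forall v, v \notin A -> x v = 0].

Definition mix t x y : V -> R := fun v => (1 - t) * x v + t * y v.

Definition vtx a : V -> R := fun v => (v == a)%:R.

Lemma mix_simplex A x y t : 0 <= t <= 1 -> simplex_pt A x -> simplex_pt A y ->
  simplex_pt A (mix t x y).
Proof.
move=> /andP[t0 t1] [x0 x1 xA] [y0 y1 yA]; split.
- by move=> v; rewrite /mix addr_ge0 // mulr_ge0 // subr_ge0.
- by rewrite /mix big_split /= -!mulr_sumr x1 y1; lra.
- by move=> v vA; rewrite /mix xA // yA // !mulr0 addr0.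
Qed.

Lemma simplexS A B x : A \subset B -> simplex_pt A x -> simplex_pt B x.
Proof.
move=> /subsetP AB [x0 x1 xA]; split=> // v vB; apply: xA.
by apply: contra vB; exact: AB.
Qed.

Lemma supp_simplex A x : simplex_pt A x -> supp x \subset A.
Proof.
case=> x0 x1 xA; apply/subsetP => v; rewrite inE; apply: contraTT => /xA ->.
by rewrite ltxx.
Qed.

Lemma vtx_simplex a : simplex_pt [set a] (vtx a).
Proof.
split=> [v||v]; first exact: ler0n.
  by rewrite (bigD1 a) //= big1 /vtx ?eqxx ?addr0 // => v /negbTE ->.
by rewrite inE /vtx => /negbTE ->.
Qed.

Lemma simplex_pt_le1 A x v : simplex_pt A x -> x v <= 1.
Proof.
by case=> x0 <- _; rewrite (bigD1 v) //= lerDl; apply: sumr_ge0.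
Qed.

Lemma simplex_ptN0 A x : simplex_pt A x -> exists2 v, v \in supp x & v \in A.
Proof.
move=> xA; have sA := supp_simplex xA; case: xA => x0 x1 xA.
have [v vs] : exists v, v \in supp x.
  apply: contrapT => /forallNP h; have := x1; rewrite big1 => [/esym/eqP|v _]; first by rewrite oner_eq0.
  by have /negP := h v; rewrite inE -leNgt => xv; apply/eqP; rewrite eq_le xv x0.
by exists v => //; exact: (subsetP sA).
Qed.

Lemma mix0 x y : mix 0 x y = x.
Proof. by apply: funext => v; rewrite /mix; ring. Qed.

Lemma mix1 x y : mix 1 x y = y.
Proof. by apply: funext => v; rewrite /mix; ring. Qed.

Lemma mixxx t x : mix t x x = x.
Proof. by apply: funext => v; rewrite /mix; ring. Qed.

Lemma near_mix d t x y x' y' : 0 <= t <= 1 -> near_coord d x x' -> near_coord d y y' ->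
  near_coord d (mix t x y) (mix t x' y').
Proof.
move=> /andP[t0 t1] hx hy v; rewrite /mix.
rewrite (_ : _ - _ = (1 - t) * (x v - x' v) + t * (y v - y' v)); last by ring.
apply: le_lt_trans (ler_normD _ _) _; rewrite !normrM (ger0_norm t0) (@ger0_norm _ (1 - t)) ?subr_ge0 //.
have := hx v; have := hy v; set a := `|x v - _|; set b := `|y v - _| => hb ha.
have [->|tn] := eqVneq t 0; first by rewrite mul0r; lra.
have tp : 0 < t by rewrite lt_neqAle eq_sym tn.
have h1 : t * b < t * d by rewrite ltr_pM2l.
have h2 : (1 - t) * a <= (1 - t) * d by rewrite ler_wpM2l ?subr_ge0 // ltW.
by lra.
Qed.

Lemma near_coord_sym d x y : near_coord d x y -> near_coord d y x.
Proof. by move=> h v; rewrite distrC. Qed.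

Lemma near_coord_le d e x y : d <= e -> near_coord d x y -> near_coord e x y.
Proof. by move=> de h v; exact: lt_le_trans (h v) de. Qed.

Variables (K : {set {set V}}) (H : (V -> R) -> R * R).
Hypothesis Kface : forall A B, A \in K -> B != set0 -> B \subset A -> B \in K.

Lemma simplex_bary A x : A \in K -> simplex_pt A x -> bary K x.
Proof.
move=> KA xA; have [v vs _] := simplex_ptN0 xA.
have sA := supp_simplex xA; case: xA => x0 x1 xA; split=> //.
by apply: Kface sA => //; apply/set0Pn; exists v.
Qed.

Lemma bary_simplex x : bary K x -> simplex_pt (supp x) x.
Proof.
case=> x0 x1 sK; split=> // v; rewrite inE -leNgt => xv.
by apply/eqP; rewrite eq_le xv x0.
Qed.

Definition modulus m d : Prop := 0 < d /\ forall x y, bary K x -> bary K y ->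
  near_coord d x y -> near_plane (m / 8) (H x) (H y).

Definition fine m (N : nat) : Prop := exists2 d, modulus m d & 1 < N%:R * d.

Definition clear m p A : Prop := forall y, simplex_pt A y -> far m (H y - p).

(** The crossings mod 2, by the image of the segment from [x] to [y], of the half-line issuing from
    [p] in the negative first direction, sampled at [N] equal steps. *)
Definition seg (N : nat) p x y : bool :=
  path_sum (@wind R) (fun i => H (mix (i%:R / N%:R) x y) - p) N.

Definition seg_clear m p x y : Prop := forall t, 0 <= t <= 1 ->
  bary K (mix t x y) /\ far m (H (mix t x y) - p).

Lemma simplex_seg_clear m p A x y : A \in K -> clear m p A ->
  simplex_pt A x -> simplex_pt A y -> seg_clear m p x y.
Proof.
move=> KA cA xA yA t t01; have xy := mix_simplex t01 xA yA.
by split; [exact: simplex_bary KA xy | exact: cA].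
Qed.

Lemma fineW d (N : nat) : 0 < d -> 1 < N%:R * d -> (0 < N)%N /\ 1 / N%:R < d.
Proof.
move=> d0 Nd; have N0 : (0 < N)%N by case: N Nd => //; rewrite mul0r; lra.
by split=> //; rewrite ltr_pdivrMr ?ltr0n // mulrC.
Qed.

Lemma frac01 (N i : nat) : (0 < N)%N -> (i <= N)%N -> 0 <= (i%:R / N%:R : R) <= 1.
Proof.
move=> N0 iN; rewrite divr_ge0 ?ler0n //=.
by rewrite ler_pdivrMr ?ltr0n // mul1r ler_nat.
Qed.

Lemma near_step d (N i : nat) x y : 1 < N%:R * d -> 0 < d -> bary K x -> bary K y ->
  near_coord d (mix (i%:R / N%:R) x y) (mix (i.+1%:R / N%:R) x y).
Proof.
move=> Nd d0 bx byy v; have [N0 N1] := fineW d0 Nd.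
rewrite /mix -natr1 (_ : _ - _ = (x v - y v) / N%:R); last by rewrite mulrDl mul1r; ring.
have x1 := simplex_pt_le1 v (bary_simplex bx); have y1 := simplex_pt_le1 v (bary_simplex byy).
have x0 : 0 <= x v by case: bx. have y0 : 0 <= y v by case: byy.
rewrite normrM [X in _ * X]gtr0_norm ?invr_gt0 ?ltr0n //; apply: le_lt_trans N1.
by rewrite ler_wpM2r ?invr_ge0 ?ler0n // ler_norml; apply/andP; split; lra.
Qed.

Lemma seg_ladder m d N p x y x' y' : 0 < m -> modulus m d -> 1 < N%:R * d ->
  seg_clear m p x y -> seg_clear m p x' y' -> near_coord d x x' -> near_coord d y y' ->
  seg N p x y (+) seg N p x' y' =
  wind (H x - p) (H x' - p) (+) wind (H y - p) (H y' - p).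
Proof.
move=> m0 [d0 md] Nd cxy cxy' nx ny; have [N0 _] := fineW d0 Nd.
have c0 : forall z z', seg_clear m p z z' -> bary K z /\ bary K z'.
  move=> z z' c; have [] := c 0 _; first by rewrite lexx ler01.
  rewrite mix0 => bz _; have [] := c 1 _; first by rewrite lexx ler01.
  by rewrite mix1.
have [bx byy] := c0 _ _ cxy; have [bx' by'] := c0 _ _ cxy'.
rewrite /seg (wind_ladder m0) => [|i iN|i iN].
- by rewrite mul0r divff ?pnatr_eq0 -?lt0n // !mix0 !mix1.
- have t01 := frac01 N0 iN.
  have [? ?] := cxy _ t01; have [? ?] := cxy' _ t01; split=> //.
  by rewrite near_planeB; apply: md => //; exact: near_mix.
- have t01 := frac01 N0 (ltnW iN); have s01 := frac01 N0 iN.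
  have [? ?] := cxy _ t01; have [? ?] := cxy' _ t01.
  have [? ?] := cxy _ s01; have [? ?] := cxy' _ s01.
  by rewrite !near_planeB; split; apply: md => //; exact: near_step.
Qed.

(** Sweep the side from [y] to [z]: the ladder between the segments from [x] to two consecutive
    points of that side turns each step into a difference of values of [seg] from [x]. *)
Lemma seg_triangle m N p A x y z : 0 < m -> fine m N -> A \in K -> clear m p A ->
  simplex_pt A x -> simplex_pt A y -> simplex_pt A z ->
  seg N p x y (+) seg N p y z = seg N p x z.
Proof.
move=> m0 [d md Nd] KA cA xA yA zA; have d0 := md.1; have [N0 _] := fineW d0 Nd.
rewrite [X in _ (+) X]/seg.
rewrite (path_sum_coboundary (b := fun i => seg N p x (mix (i%:R / N%:R) y z))).
  by rewrite mul0r divff ?pnatr_eq0 -?lt0n // !mix0 !mix1 addKb.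
move=> i iN /=; have t01 := frac01 N0 (ltnW iN); have s01 := frac01 N0 iN.
have h1 := mix_simplex t01 yA zA; have h2 := mix_simplex s01 yA zA.
rewrite (seg_ladder m0 md Nd) ?windxx //.
- exact: simplex_seg_clear cA _ _.
- exact: simplex_seg_clear cA _ _.
- by move=> v; rewrite subrr normr0.
- by apply: near_step => //; apply: simplex_bary KA _.
Qed.

Lemma segxx N p x : seg N p x x = false.
Proof. by rewrite /seg /path_sum big1 // => i _; rewrite !mixxx windxx. Qed.

Lemma segC m N p A x y : 0 < m -> fine m N -> A \in K -> clear m p A ->
  simplex_pt A x -> simplex_pt A y -> seg N p x y = seg N p y x.
Proof.
move=> m0 fN KA cA xA yA; have := seg_triangle m0 fN KA cA xA yA xA.
by rewrite segxx; case: seg; case: seg.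
Qed.

Lemma clearS m p A B : B \subset A -> clear m p A -> clear m p B.
Proof. by move=> BA cA y yB; apply: cA; exact: simplexS yB. Qed.

Lemma vtx_in A a : a \in A -> simplex_pt A (vtx a).
Proof. by move=> aA; apply: simplexS (vtx_simplex a); rewrite sub1set. Qed.

Lemma big_coord A x : simplex_pt A x -> exists2 a, a \in A & (#|V|%:R)^-1 <= x a.
Proof.
move=> xA; have [v0 _ _] := simplex_ptN0 xA; case: (xA) => x0 x1 _.
have V0 : 0 < #|V|%:R :> R by rewrite ltr0n; apply/card_gt0P; exists v0.
have [a xa] : exists a, (#|V|%:R)^-1 <= x a.
  apply: contrapT => /forallNP h; have := x1; apply/eqP; rewrite lt_eqF //.
  have -> : 1 = \sum_(v : V) (#|V|%:R)^-1 :> R by rewrite sumr_const -[RHS]mulr_natr mulVf ?gt_eqF.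
  apply: ltr_sum; first by apply/hasP; exists v0; rewrite ?mem_index_enum.
  by move=> v _; have /negP := h v; rewrite -ltNge.
exists a => //; apply: (subsetP (supp_simplex xA)); rewrite inE.
by apply: lt_le_trans xa; rewrite invr_gt0.
Qed.

(** The potential of [y] is that of a vertex [g y] with coordinate at least 1 / #|V|, plus the
    crossings of the segment from this vertex to [y]. A smaller move of [y] keeps [g y] in the
    support, and within one simplex another choice of vertex gives the same value. *)
Lemma glue m N p (L : {set {set V}}) (psi : V -> bool) (v0 : V) : 0 < m -> fine m N -> L \subset K ->
  (forall A, A \in L -> clear m p A) ->
  (forall a b, [set a; b] \in L -> seg N p (vtx a) (vtx b) = psi a (+) psi b) ->
  (forall A B, A \in L -> B != set0 -> B \subset A -> B \in L) ->
  exists e (b : (V -> R) -> bool), 0 < e /\ forall y y', bary L y -> bary L y' ->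
    near_coord e y y' -> wind (H y - p) (H y' - p) = b y (+) b y'.
Proof.
move=> m0 fN /subsetP LK cL hpsi Lface.
have [d md Nd] := fN.
have bL y : bary L y -> supp y \in L /\ simplex_pt (supp y) y.
  move=> yL; have [y0 y1 sy] := yL; split => //; apply: bary_simplex; split=> //; exact: LK.
have [g hg] : exists g : (V -> R) -> V, forall y, bary L y -> g y \in supp y /\ (#|V|%:R)^-1 <= y (g y).
  have gP y : exists a, bary L y -> a \in supp y /\ (#|V|%:R)^-1 <= y a.
    have [yL|] := pselect (bary L y); last by exists v0.
    by have [a a1 a2] := big_coord (bL y yL).2; exists a.
  by have [g0 hg0] := choice gP; exists g0.
have V0 : 0 < (#|V|%:R)^-1 :> R by rewrite invr_gt0 ltr0n; apply/card_gt0P; exists v0.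
exists (Num.min d (#|V|%:R)^-1), (fun y => psi (g y) (+) seg N p (vtx (g y)) y).
split=> [|y y' yL y'L nyy']; first by rewrite lt_min md.1.
have [sL ys] := bL _ yL; have [sL' ys'] := bL _ y'L.
have [gy gyV] := hg _ yL; have [gy' gyV'] := hg _ y'L.
have gyy' : g y \in supp y'.
  rewrite inE; have := nyy' (g y); rewrite lt_min !ltr_norml => /andP[_ /andP[_ h]].
  by move: h gyV; set z := (#|V|%:R)^-1; lra.
have E : psi (g y') (+) seg N p (vtx (g y')) y' = psi (g y) (+) seg N p (vtx (g y)) y'.
  have KA := LK _ sL'.
  rewrite -(seg_triangle m0 fN KA (cL _ sL') (vtx_in gy') (vtx_in gyy') ys').
  have := seg_triangle m0 fN KA (cL _ sL') (vtx_in gy') (vtx_in gyy') (vtx_in gyy').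
  have [->|gn] := eqVneq (g y') (g y); first by rewrite segxx.
  rewrite hpsi; first by move: (psi _) (psi _) (seg _ _ _ _) (seg _ _ _ _) => [] [] [] [].
  apply: (Lface _ _ sL'); first by apply/set0Pn; exists (g y); rewrite !inE eqxx orbT.
  by apply/subsetP => v; rewrite !inE => /orP[] /eqP ->; [move: gy'|move: gyy']; rewrite inE.
rewrite E addbACA addbb addFb (seg_ladder m0 md Nd) ?windxx //.
- exact: simplex_seg_clear (LK _ sL) (cL _ sL) (vtx_in gy) ys.
- exact: simplex_seg_clear (LK _ sL') (cL _ sL') (vtx_in gyy') ys'.
- by move=> v; rewrite subrr normr0 md.1.
- by move: nyy'; apply: near_coord_le; rewrite ge_min lexx.
Qed.

End Segments.

(** * The local obstruction at a point of the open disc *)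

Section Cone.
Variables (R : realType) (V : finType) (K : {set {set V}}).
Variables (H : (V -> R) -> R * R) (G : R * R -> V -> R).
Hypothesis Kface : forall A B, A \in K -> B != set0 -> B \subset A -> B \in K.
Hypothesis chart : disc_chart (bary K) H G.
Implicit Types (x y z : V -> R) (A B T : {set V}) (m d e : R) (p q u : R * R) (a b v w : V).

Definition open_disc p : Prop := p.1 ^+ 2 + p.2 ^+ 2 < 1.

Lemma open_discW p : open_disc p -> unit_disc p.
Proof. exact: ltW. Qed.

Lemma sqr_le1 (c : R) : c ^+ 2 <= 1 -> `|c| <= 1.
Proof. by move=> h; rewrite ler_norml; nra. Qed.

Lemma unit_disc_le1 p : unit_disc p -> `|p.1| <= 1 /\ `|p.2| <= 1.
Proof.
rewrite /unit_disc /= => h; have := sqr_ge0 p.1; have := sqr_ge0 p.2.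
by split; apply: sqr_le1; lra.
Qed.

Lemma open_disc_near p : open_disc p ->
  exists2 r, 0 < r & forall u, `|u.1| <= r -> `|u.2| <= r -> open_disc (p.1 + u.1, p.2 + u.2).
Proof.
move=> po; have [] := unit_disc_le1 (open_discW po).
rewrite !ler_norml => /andP[a1 a2] /andP[b1 b2].
rewrite /open_disc in po; exists ((1 - (p.1 ^+ 2 + p.2 ^+ 2)) / 8); first by lra.
have := sqr_ge0 p.1; have := sqr_ge0 p.2.
move: po; set s := p.1 ^+ 2 + _ => po s1 s2 u.
have sE : s = p.1 ^+ 2 + p.2 ^+ 2 by [].
rewrite !ler_norml /open_disc /= => /andP[c1 c2] /andP[d1 d2].
have h1 : p.1 * u.1 <= (1 - s) / 8 by nra.
have h2 : p.2 * u.2 <= (1 - s) / 8 by nra.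
have s0 : 0 <= s <= 1 by apply/andP; split; rewrite ?sE; lra.
have h3 : u.1 ^+ 2 <= (1 - s) / 8 by nra.
have h4 : u.2 ^+ 2 <= (1 - s) / 8 by nra.
rewrite (_ : _ + _ = s + 2 * (p.1 * u.1) + 2 * (p.2 * u.2) + u.1 ^+ 2 + u.2 ^+ 2); last by rewrite sE; ring.
by lra.
Qed.

Lemma min_coord x : bary K x -> exists2 r, 0 < r & forall v, v \in supp x -> r <= x v.
Proof.
move=> bx; have [v0 v0s _] := simplex_ptN0 (bary_simplex bx).
have [v vs hv] := @arg_minP _ _ _ v0 (mem (supp x)) x v0s.
exists (x v) => //.
by have : v \in supp x by []; rewrite inE.
Qed.

(** Contract the image slightly towards the origin; by continuity of [G] the positive coordinates of
    [x] stay positive. *)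
Lemma disc_perturb x e : bary K x -> 0 < e -> exists x',
  [/\ bary K x', near_coord e x x', open_disc (H x') & supp x \subset supp x'].
Proof.
move=> bx e0; have [r r0 hr] := min_coord bx.
have er0 : 0 < Num.min e r by rewrite lt_min e0.
have [d d0 hd] := chart_inv_unif chart er0.
have Hd := chart_disc chart bx; have [h1 h2] := unit_disc_le1 Hd.
pose t := Num.min (1 / 2) (d / 2).
have t0 : 0 < t by rewrite lt_min !divr_gt0.
have t1 : t <= 1 / 2 by rewrite ge_min lexx.
have td : t < d by apply: le_lt_trans (_ : d / 2 < d); [rewrite ge_min lexx orbT|lra].
pose q := ((1 - t) * (H x).1, (1 - t) * (H x).2).
have qo : open_disc q.
  rewrite /open_disc /= !exprMn -mulrDr; move: Hd; rewrite /unit_disc /=.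
  set s := _ + _ => s1; have s0 : 0 <= s by rewrite addr_ge0 // sqr_ge0.
  by nra.
have nq : near_plane d (H x) q.
  rewrite /near_plane /= (_ : (H x).1 - _ = t * (H x).1); last by ring.
  rewrite (_ : (H x).2 - _ = t * (H x).2); last by ring.
  by rewrite !normrM gtr0_norm //; apply/andP; split; nra.
have := hd _ _ Hd (open_discW qo) nq; rewrite (chartK chart bx) => nx.
exists (G q); split; first exact: (chart_inv chart (open_discW qo)).
- by apply: near_coord_le nx; rewrite ge_min lexx.
- by rewrite (chart_invK chart (open_discW qo)).
- apply/subsetP => v vs; rewrite inE; have := hr v vs; have := nx v.
  by rewrite lt_min !ltr_norml => /andP[_ /andP[_ h]]; lra.
Qed.

(** The frontier of the open star of the carrier of [x]: the join of the boundary of [supp x] with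
    its link in the usual sense. Radial projection from [x] lands there. *)
Definition link x : {set {set V}} := [set A in K | (A :|: supp x \in K) && ~~ (supp x \subset A)].

Lemma link_face x A B : A \in link x -> B != set0 -> B \subset A -> B \in link x.
Proof.
rewrite !inE => /and3P[KA KAx xA] B0 BA; apply/and3P; split.
- exact: Kface BA.
- apply: Kface KAx _ _; last by rewrite setSU.
  by case/set0Pn: B0 => v vB; apply/set0Pn; exists v; rewrite inE vB.
- by apply: contra xA => /subset_trans; apply.
Qed.

(* Radial projection from [x] carries a square around [H x] to the link of [x], where the winding
   cocycle is assumed to be a coboundary. *)
Lemma cone_obstruction x : bary K x -> open_disc (H x) -> exists m,
  [/\ 0 < m, forall A, A \in link x -> clear H m (H x) A &
   forall N psi, fine K H m N ->
    ~ (forall a b, [set a; b] \in link x ->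
         seg H N (H x) (vtx R a) (vtx R b) = psi a (+) psi b)].
Proof.
move=> bx xo; set p := H x; have [x0 x1 sK] := bx.
have xs := bary_simplex bx; have xdisc := chart_disc chart bx.
have [v0 v0s _] := simplex_ptN0 xs.
have [rho rho0 hrho] := min_coord bx.
have [r1 r10 hr1] := open_disc_near xo.
have [d1 d10 hd1] := chart_inv_unif chart rho0.
pose r := Num.min r1 (d1 / 2).
have r0 : 0 < r by rewrite lt_min r10 divr_gt0.
have rr1 : r <= r1 by rewrite ge_min lexx.
have rd1 : r < d1 by apply: le_lt_trans (_ : d1 / 2 < d1); [rewrite ge_min lexx orbT|lra].
have [rho2 rho20 hrho2] := chart_unif chart r0.
have [m2 m20 hm2] := chart_inv_unif chart rho20.
(* [d1] keeps the link away from [H x]; [m2] does the same for the radial segments from the link to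
   the preimage of the square. *)
pose m := Num.min d1 m2.
have m0 : 0 < m by rewrite lt_min d10.
have Lclear A : A \in link x -> clear H m p A.
  rewrite inE => /and3P[KA _ /subsetPn[v vx vA]] z zA.
  have bz : bary K z by exact: simplex_bary KA zA.
  rewrite farN_near near_plane_sym; apply/negP => nz.
  have := hd1 _ _ xdisc (chart_disc chart bz) (near_plane_le (_ : m <= d1) nz).
  rewrite ge_min lexx => /(_ isT) /(_ v); rewrite !(chartK chart) //.
  case: zA => _ _ /(_ v vA) ->; rewrite subr0 ger0_norm // ltNge => /negP; apply.
  exact: hrho.
exists m; split=> // N psi fN hpsi.
have LK : link x \subset K by apply/subsetP => A; rewrite inE => /andP[].
have [e [b [e0 hb]]] := glue Kface v0 m0 fN LK Lclear hpsi (@link_face x).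
have [d md Nd] := fN; have d0 := md.1.
(* [w y] is the vertex of [supp x] whose coordinate vanishes first on the ray from [x] through [y].
   Thus 1 - [mu y] is the largest multiple of [x] that can be subtracted from [y]. *)
have [w hw] : exists w : (V -> R) -> V, forall y, w y \in supp x /\
    forall v, v \in supp x -> 1 - y v / x v <= 1 - y (w y) / x (w y).
  have wP y : exists w, w \in supp x /\ forall v, v \in supp x -> 1 - y v / x v <= 1 - y w / x w.
    by have [v vs hv] := @arg_maxP _ _ _ v0 (mem (supp x)) (fun v => 1 - y v / x v) v0s; exists v.
  by have [w hw] := choice wP; exists w.
pose mu y := 1 - y (w y) / x (w y).
have xp v : v \in supp x -> 0 < x v by rewrite inE.
have x00 v : v \notin supp x -> x v = 0 by move=> vs; case: xs => _ _ ->.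
(* The open star of [x] without a neighbourhood of [x]; the distance to [x] is what bounds [mu]
   below by [rho2]. *)
pose good y := [/\ bary K y, supp x \subset supp y & exists v, rho2 <= `|x v - y v|].
have mu1 y : good y -> forall v, (1 - mu y) * x v <= y v.
  case=> -[y0 _ _] _ _ v; have [vs|vs] := boolP (v \in supp x); last by rewrite x00 // mulr0.
  have := (hw y).2 v vs; rewrite -/(mu y) => h.
  by rewrite -ler_pdivlMr ?xp //; lra.
have mu2 y : (1 - mu y) * x (w y) = y (w y).
  by rewrite /mu opprB addrC subrK divfK // gt_eqF // xp //; case: (hw y).
have mu3 y : good y -> rho2 <= mu y /\ mu y <= 1.
  move=> gy; have := mu1 y gy; have [[y0 y1 _] _ [v hv]] := gy => h1; split; last first.
    by rewrite /mu; have := divr_ge0 (y0 (w y)) (ltW (xp _ (hw y).1)); lra.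
  have S : \sum_v (y v - (1 - mu y) * x v) = mu y.
    by rewrite big_split /= sumrN -mulr_sumr x1 y1; ring.
  have S1 : y v - (1 - mu y) * x v <= mu y.
    by rewrite -[leRHS]S (bigD1 v) //= lerDl; apply: sumr_ge0 => i _; rewrite subr_ge0.
  have S0 : 0 <= mu y by rewrite -S; apply: sumr_ge0 => i _; rewrite subr_ge0.
  have xv1 := simplex_pt_le1 v xs; have yv0 := y0 v; have xv0 := x0 v; have h1v := h1 v.
  by move: hv; rewrite ler_normr => /orP[hv|hv]; nra.
have rho1 : rho <= 1 by apply: le_trans (hrho _ v0s) (simplex_pt_le1 _ xs).
(* Defined so that [y] is the mixture of [x] and [proj y] with weight [mu y] on the latter. *)
pose proj y v := x v + (y v - x v) / mu y.
have projS y : good y -> simplex_pt (supp y) (proj y) /\ bary (link x) (proj y).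
  move=> gy; have [h1 h2] := mu3 y gy; have [by_ sxy _] := gy; have [y0 y1 yK] := by_.
  have mp : 0 < mu y by exact: lt_le_trans h1.
  have P0 v : 0 <= proj y v.
    rewrite /proj (_ : _ + _ = (y v - (1 - mu y) * x v) / mu y); last by field; rewrite gt_eqF.
    by rewrite divr_ge0 ?(ltW mp) // subr_ge0 mu1.
  have P1 : \sum_v proj y v = 1.
    rewrite /proj big_split /= x1 -mulr_suml big_split /= sumrN x1 y1; ring.
  have PS : simplex_pt (supp y) (proj y).
    split=> // v vs; have yv : y v = 0 by case: (bary_simplex by_) => _ _ ->.
    have xv : x v = 0 by apply: x00; apply: contra vs; exact: (subsetP sxy).
    by rewrite /proj yv xv subrr mul0r addr0.
  split=> //; split=> //; rewrite inE; apply/and3P; split.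
  - by have [] := simplex_bary Kface yK PS.
  - apply: (Kface yK); last by rewrite subUset sxy supp_simplex.
    by apply/set0Pn; exists v0; rewrite inE v0s orbT.
  - apply/subsetPn; exists (w y); first by case: (hw y).
    rewrite inE /proj -mu2 (_ : _ + _ = 0) ?ltxx //.
    by field; rewrite gt_eqF.
have projC y : good y -> seg_clear K H m p (proj y) y.
  move=> gy t t01; have [PS _] := projS y gy; have [by_ _ [v hv]] := gy.
  have bm : bary K (mix t (proj y) y).
    by case: (by_) => _ _ yK; apply: simplex_bary yK _ => //; exact: mix_simplex (bary_simplex by_).
  split=> //; have [h1 h2] := mu3 y gy; have mp : 0 < mu y by exact: lt_le_trans h1.
  rewrite farN_near near_plane_sym; apply/negP => nz.
  have := hm2 _ _ xdisc (chart_disc chart bm) (near_plane_le (_ : m <= m2) nz).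
  rewrite ge_min lexx orbT => /(_ isT) /(_ v); rewrite !(chartK chart) // ltNge => /negP; apply.
  have -> : x v - mix t (proj y) y v = ((1 - t) / mu y + t) * (x v - y v).
    by rewrite /mix /proj; field; rewrite gt_eqF.
  case/andP: t01 => t0 t1; apply: le_trans hv _; rewrite normrM ler_peMl // ger0_norm; last first.
    by apply: addr_ge0 => //; apply: divr_ge0; [rewrite subr_ge0 | exact: ltW].
  have : 1 - t <= (1 - t) / mu y by rewrite ler_pdivlMr // ler_piMr ?subr_ge0.
  by lra.
have rho21 y : good y -> rho2 <= 1 by move=> gy; have [] := mu3 y gy; lra.
pose e' := Num.min d e.
have e'0 : 0 < e' by rewrite lt_min d0 e0.
(* A move of [eta] changes [proj] by at most [e' / 2]: a quarter of [e'] comes from the move of [y],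
   another from the change of [mu]. *)
pose eta := e' * (rho * rho2 ^+ 2) / 4.
have c0 : 0 < rho * rho2 ^+ 2 by rewrite mulr_gt0 // exprn_gt0.
have eta0 : 0 < eta by rewrite /eta divr_gt0 // mulr_gt0.
have muL y y' : good y -> near_coord eta y y' -> mu y <= mu y' + eta / rho.
  move=> gy nyy'; have [ws _] := hw y; have := (hw y').2 _ ws; rewrite -/(mu y').
  have := nyy' (w y); rewrite ltr_norml => /andP[h1 _].
  have : (y' (w y) - y (w y)) / x (w y) <= eta / rho.
    apply: le_trans (_ : eta / x (w y) <= _).
      by rewrite ler_wpM2r ?invr_ge0 ?(ltW (xp _ ws)) //; lra.
    by rewrite ler_wpM2l ?(ltW eta0) // lef_pV2 ?posrE ?xp ?hrho.
  by rewrite /mu mulrBl; lra.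
have projL y y' : good y -> good y' -> near_coord eta y y' -> near_coord e' (proj y) (proj y').
  move=> gy gy' nyy' v.
  have L1 := muL _ _ gy nyy'; have L2 := muL _ _ gy' (near_coord_sym nyy').
  have [h1 h2] := mu3 y gy; have [h1' h2'] := mu3 y' gy'; have q1 := rho21 y gy.
  have := nyy' v; rewrite ltr_norml => /andP[n1 n2].
  have P : 0 < mu y by lra. have P' : 0 < mu y' by lra.
  pose K1 := (y v - y' v) / mu y; pose K2 := (y' v - x v) * (mu y' - mu y) / (mu y * mu y').
  have -> : proj y v - proj y' v = K1 + K2.
    by rewrite /proj /K1 /K2; field; rewrite !gt_eqF.
  have B1 : `|K1| <= eta / (rho * rho2 ^+ 2).
    rewrite /K1 normrM; apply: ler_pM => //; first by rewrite ler_norml; apply/andP; split; lra.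
    rewrite gtr0_norm ?invr_gt0 // lef_pV2 ?posrE //; apply: le_trans h1.
    by rewrite expr2 mulrA ler_piMl ?(ltW rho20) // mulr_ile1 ?(ltW rho0) ?(ltW rho20).
  have B2 : `|K2| <= eta / (rho * rho2 ^+ 2).
    have [[y0' y1' _] _ _] := gy'; have c1 := simplex_pt_le1 v (bary_simplex (let: And3 b _ _ := gy' in b)).
    have c2 := simplex_pt_le1 v xs; have c3 := x0 v; have c4 := y0' v.
    rewrite /K2 2!normrM.
    apply: (@le_trans _ _ ((1 * (eta / rho)) * (rho2 * rho2)^-1)).
      apply: ler_pM => //; first by rewrite mulr_ge0.
        by apply: ler_pM => //; rewrite ler_norml; apply/andP; split; lra.
      rewrite gtr0_norm ?invr_gt0 ?mulr_gt0 // lef_pV2 ?posrE ?mulr_gt0 //.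
      by apply: ler_pM => //; exact: ltW.
    by rewrite le_eqVlt; apply/orP; left; apply/eqP; field; rewrite !gt_eqF.
  have E : eta / (rho * rho2 ^+ 2) = e' / 4 by rewrite /eta; field; rewrite !gt_eqF.
  by apply: le_lt_trans (ler_normD _ _) _; move: B1 B2; rewrite E; lra.
have [d3 d30 hd3] := chart_inv_unif chart eta0.
pose q u := (p.1 + u.1, p.2 + u.2).
have qB u : q u - p = u by rewrite [u in RHS]surjective_pairing; congr pair; rewrite /=; ring.
(* The potential on the link, plus the crossings of the radial segment leading back to the square,
   is a potential on the square. *)
apply: (@wind_square R r d3 (fun u => b (proj (G (q u))) (+) seg H N p (proj (G (q u))) (G (q u)))) => //.
move=> u u' fu fu' u1 u2 u1' u2' nu.
have qd t : `|t.1| <= r -> `|t.2| <= r -> unit_disc (q t).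
  by move=> t1 t2; apply: open_discW; apply: hr1; [exact: le_trans t1 rr1 | exact: le_trans t2 rr1].
have qg t : far r t -> `|t.1| <= r -> `|t.2| <= r -> good (G (q t)).
  move=> ft t1 t2; have tq := qd t t1 t2; have bG := chart_inv chart tq; split=> //.
    apply/subsetP => v vs; rewrite inE.
    have nq : near_plane d1 p (q t).
      by rewrite near_plane_sym -(near_planeB _ _ _ p) qB subrr /near_plane !subr0; apply/andP; split; apply: le_lt_trans rd1.
    have := hd1 _ _ xdisc tq nq v; rewrite (chartK chart bx) ltr_norml.
    by have := hrho v vs; move=> ? /andP[]; lra.
  apply: contrapT => /forallNP h; have : near_coord rho2 x (G (q t)).
    by move=> v; have /negP := h v; rewrite -ltNge.
  move=> /(hrho2 _ _ bx bG); rewrite (chart_invK chart tq) near_plane_sym; apply/negP.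
  by rewrite -farN_near qB.
have gu := qg u fu u1 u2; have gu' := qg u' fu' u1' u2'.
have nG : near_coord eta (G (q u)) (G (q u')).
  apply: hd3; [exact: qd | exact: qd |].
  by rewrite -(near_planeB _ _ _ p) !qB.
have etad : eta <= d.
  have q1 := rho21 _ gu; have h : rho * rho2 ^+ 2 <= 1.
    by apply: mulr_ile1; rewrite ?(ltW rho0) ?exprn_ge0 ?exprn_ile1 ?(ltW rho20).
  have h' : e' <= d by rewrite ge_min lexx.
  by rewrite /eta; nra.
have := hb _ _ (projS _ gu).2 (projS _ gu').2 (near_coord_le (_ : e' <= e) (projL _ _ gu gu' nG)).
rewrite ge_min lexx orbT => /(_ isT) hbb.
have := seg_ladder m0 md Nd (projC _ gu) (projC _ gu') (near_coord_le (_ : e' <= d) (projL _ _ gu gu' nG)) (near_coord_le etad nG).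
rewrite ge_min lexx => /(_ isT); rewrite hbb !(chart_invK chart) ?qB; try exact: qd.
by move: (b _) (b _) (seg _ _ _ _ _) (seg _ _ _ _ _) (wind _ _) => [] [] [] [] [].
Qed.

End Cone.

(** * Mod 2 chains *)

Section Pairs.
Variable V : finType.
Implicit Types (A B T e : {set V}) (Z Y : {set {set V}}) (a b c v w : V).

Definition pairs T : {set {set V}} := [set e : {set V} | (e \subset T) && (#|e| == 2%N)].

Definition bd Z : {set {set V}} := [set e : {set V} | (#|e| == 2%N) && odd #|[set T in Z | e \subset T]|].

Lemma card3P T : reflect (exists a b c, [/\ a != b, a != c, b != c & T = [set a; b; c]]) (#|T| == 3%N).
Proof.
apply: (iffP idP) => [|[a [b [c [ab ac bc ->]]]]]; last first.
  by rewrite setUC cardsU1 !inE negb_or [c == a]eq_sym ac [c == b]eq_sym bc /= cards2 ab.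
move=> T3; have /set0Pn[a aT] : T != set0 by rewrite -card_gt0 (eqP T3).
have : #|T :\ a| == 2%N by rewrite (cardsD1 a) aT add1n eqSS in T3.
case/cards2P => b [c [bc E]].
have : (b \in T :\ a) && (c \in T :\ a) by rewrite E !inE !eqxx orbT.
rewrite !inE => /andP[/andP[ba bT] /andP[ca cT]].
exists a, b, c; split=> //; try by rewrite eq_sym.
by rewrite -setUA -E setD1K.
Qed.

Lemma big_pairs3 (f : {set V} -> bool) a b c : a != b -> a != c -> b != c ->
  \big[addb/false]_(e in pairs [set a; b; c]) f e =
  f [set a; b] (+) f [set a; c] (+) f [set b; c].
Proof.
move=> ab ac bc.
have E : pairs [set a; b; c] = [set [set a; b]; [set a; c]; [set b; c]].
  apply/setP => e; rewrite !inE; apply/andP/orP; last first.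
    move=> h; suff : e = [set a; b] \/ e = [set a; c] \/ e = [set b; c].
      by case=> [->|[->|->]]; rewrite cards2 ?ab ?ac ?bc eqxx; split=> //;
         apply/subsetP => v; rewrite !inE => /orP[] ->; rewrite ?orbT.
    by case: h => [/orP[/eqP|/eqP]|/eqP]; auto.
  case=> /subsetP eT /cards2P[u [v [uv eE]]].
  have := eT u; have := eT v; rewrite eE !inE !eqxx ?orbT => /(_ isT) hv /(_ isT) hu.
  move: hu hv uv => /orP[/orP[]|] /eqP -> /orP[/orP[]|] /eqP ->; rewrite ?eqxx // => _.
  - by left.
  - by left; rewrite orbT.
  - by left; rewrite setUC eqxx.
  - by right.
  - by left; rewrite [[set c; a]]setUC eqxx orbT.
  - by right; rewrite setUC.
have n1 : [set a; b] != [set a; c].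
  by apply/eqP => /setP/(_ b); rewrite !inE eqxx orbT eq_sym (negbTE ab) (negbTE bc).
have n2 : [set a; b] != [set b; c].
  by apply/eqP => /setP/(_ a); rewrite !inE eqxx (negbTE ab) (negbTE ac).
have n3 : [set a; c] != [set b; c].
  by apply/eqP => /setP/(_ a); rewrite !inE eqxx (negbTE ab) (negbTE ac).
rewrite E setUC big_setU1; last by rewrite !inE negb_or eq_sym n2 eq_sym n3.
by rewrite big_setU1 ?inE //= big_set1 addbC.
Qed.

Lemma odd_bigaddb (I : finType) (P : pred I) : odd #|[set i | P i]| = \big[addb/false]_i P i.
Proof.
rewrite -sum1dep_card big_mkcond /=.
by elim/big_rec2: _ => // i x y _ <-; rewrite oddD; case: (P i).
Qed.

(** Stokes' formula mod 2, by exchanging the two sums. *)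
Lemma big_bd (f : {set V} -> bool) Z :
  \big[addb/false]_(e in bd Z) f e = \big[addb/false]_(T in Z) \big[addb/false]_(e in pairs T) f e.
Proof.
rewrite (exchange_big_dep (fun e : {set V} => #|e| == 2%N)) /=; last first.
  by move=> T e _; rewrite inE => /andP[].
rewrite big_mkcond [RHS]big_mkcond /=; apply: eq_bigr => e _.
rewrite inE; case: eqP => //= e2.
rewrite (eq_bigl (fun T => (T \in Z) && (e \subset T))); last first.
  by move=> T; rewrite inE e2 eqxx andbT.
rewrite odd_bigaddb big_mkcond /= [RHS]big_mkcond /=.
rewrite -[RHS](_ : \big[addb/false]_i (((i \in Z) && (e \subset i)) && f e) = _); last first.
  by apply: eq_bigr => T _; case: ifP.
by rewrite -big_distrl /=; case: (\big[_/_]_i _).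
Qed.

Definition vsum (k : V -> bool) e := \big[addb/false]_(a in e) k a.

Lemma vsum2 k a b : a != b -> vsum k [set a; b] = k a (+) k b.
Proof. by move=> ab; rewrite /vsum big_setU1 ?inE //= big_set1. Qed.

Lemma vsum_bd k Z : (forall T, T \in Z -> #|T| = 3%N) ->
  \big[addb/false]_(e in bd Z) vsum k e = false.
Proof.
move=> Z3; rewrite big_bd big1 // => T /Z3/eqP/card3P[a [b [c [ab ac bc ->]]]].
by rewrite big_pairs3 // !vsum2 //; case: (k a); case: (k b); case: (k c).
Qed.

End Pairs.

(** * Dimension of a disc and winding of a triangle *)

Section Disc.
Variables (R : realType) (V : finType) (K : {set {set V}}).
Variables (H : (V -> R) -> R * R) (G : R * R -> V -> R).
Hypothesis K0 : forall A, A \in K -> A != set0.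
Hypothesis Kface : forall A B, A \in K -> B != set0 -> B \subset A -> B \in K.
Hypothesis chart : disc_chart (bary K) H G.
Implicit Types (x y z : V -> R) (A B T e : {set V}) (Z Y : {set {set V}}) (m d : R)
  (p q u : R * R) (a b c v w : V) (N : nat).

Local Notation vtx := (vtx R).

Lemma fine_exists m : 0 < m -> exists N, fine K H m N.
Proof.
move=> m0; have m80 : 0 < m / 8 by rewrite divr_gt0.
have [d d0 hd] := chart_unif chart m80.
exists (Num.truncn (1 / d)).+1, d; first by [].
by rewrite -ltr_pdivrMr //; exact: Num.Theory.truncnS_gt.
Qed.

Lemma fine_le m m' N : m <= m' -> fine K H m N -> fine K H m' N.
Proof.
move=> mm' [d [d0 hd] dN]; exists d => //; split=> // x y bx byy nxy.
by apply: near_plane_le (hd _ _ bx byy nxy); lra.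
Qed.

Lemma far_le m m' u : m <= m' -> far m' u -> far m u.
Proof. by move=> mm' /orP[] h; apply/orP; [left|right]; exact: le_trans h. Qed.

Lemma clear_le m m' p A : m <= m' -> clear H m' p A -> clear H m p A.
Proof. by move=> mm' c y yA; apply: far_le mm' (c y yA). Qed.

Lemma clear_notsub x : bary K x -> exists2 m, 0 < m &
  forall A, A \in K -> ~~ (supp x \subset A) -> clear H m (H x) A.
Proof.
move=> bx; have [rho rho0 hrho] := min_coord bx.
have [d1 d10 hd1] := chart_inv_unif chart rho0.
exists d1 => // A KA /subsetPn[v vx vA] z zA.
have bz : bary K z by exact: simplex_bary KA zA.
rewrite farN_near near_plane_sym; apply/negP => nz.
have := hd1 _ _ (chart_disc chart bx) (chart_disc chart bz) nz v; rewrite !(chartK chart) //.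
case: zA => _ _ /(_ v vA) ->; rewrite subr0 => h.
by have := le_lt_trans (le_trans (hrho v vx) (ler_norm _)) h; rewrite ltxx.
Qed.

Definition center A : V -> R := fun v => if v \in A then #|A|%:R^-1 else 0.

Lemma center_simplex A : A != set0 -> simplex_pt A (center A) /\ supp (center A) = A.
Proof.
rewrite -card_gt0 => A0; have A0' : 0 < #|A|%:R :> R by rewrite ltr0n.
split; first split.
- by move=> v; rewrite /center; case: ifP => // _; rewrite invr_ge0 ltW.
- by rewrite /center -big_mkcond /= sumr_const -[LHS]mulr_natr mulVf // gt_eqF.
- by move=> v /negbTE vA; rewrite /center vA.
- by apply/setP => v; rewrite inE /center; case: ifP; rewrite ?ltxx // invr_gt0 A0'.
Qed.

Lemma setU2_sub a b A : ([set a; b] \subset A) = (a \in A) && (b \in A).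
Proof. by rewrite subUset !sub1set. Qed.

Lemma set3_sub a b c A : ([set a; b; c] \subset A) = [&& a \in A, b \in A & c \in A].
Proof. by rewrite subUset setU2_sub sub1set andbA. Qed.

Lemma set_neq0 a A : a \in A -> A != set0.
Proof. by move=> aA; apply/set0Pn; exists a. Qed.

(** For a maximal simplex [Q] with at least four vertices, the link of an inner point is the
    boundary of [Q], in which any three vertices span a simplex. Crossing numbers from a base vertex
    [a0] are then a potential, against [cone_obstruction]. *)
Lemma card_simplex_le3 A : A \in K -> (#|A| <= 3)%N.
Proof.
move=> KA; rewrite leqNgt; apply/negP => A3.
have [Q /maxsetP[KQ Qmax] AQ] := @maxset_exists _ (fun B => B \in K) A KA.
have Q3 : (3 < #|Q|)%N by apply: leq_trans A3 (subset_leq_card AQ).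
have [cQ sQ] := center_simplex (K0 KQ).
have [x [bx _ xo]] := disc_perturb chart (simplex_bary Kface KQ cQ) (ltr01 : 0 < 1 :> R).
rewrite sQ => Qx; have xQ : supp x = Q by apply: Qmax => //; case: bx.
have [m [m0 mc mno]] := cone_obstruction Kface chart bx xo.
have [N fN] := fine_exists m0.
have [a0 a0Q] := set0Pn _ (K0 KQ).
have in_link a b : a \in Q -> b \in Q -> [set a0; a; b] \in link K x.
  move=> aQ bQ; have sQ3 : [set a0; a; b] \subset Q by rewrite set3_sub a0Q aQ.
  rewrite inE xQ (Kface KQ _ sQ3) /= ?(setUidPr sQ3) ?KQ /=; last first.
    by apply: (@set_neq0 a0); rewrite !inE eqxx.
  apply: contraTN Q3 => /subset_leq_card h; rewrite -leqNgt; apply: leq_trans h _.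
  rewrite setUC cardsU1; apply: leq_trans (leq_add (leq_b1 _) (leqnn _)) _.
  by rewrite cards2 add1n; case: (a0 != a).
apply: (mno N (fun a => seg H N (H x) (vtx a0) (vtx a)) fN) => a b.
rewrite inE xQ => /and3P[_ KQ' _].
have /setUidPr : [set a; b] :|: Q = Q by apply: Qmax => //; exact: subsetUr.
rewrite setU2_sub => /andP[aQ bQ]; have L := in_link a b aQ bQ.
have KL : [set a0; a; b] \in K by move: L; rewrite inE => /andP[].
have cL := mc _ L.
have i1 : simplex_pt [set a0; a; b] (vtx a0) by apply: vtx_in; rewrite !inE eqxx.
have i2 : simplex_pt [set a0; a; b] (vtx a) by apply: vtx_in; rewrite !inE eqxx orbT.
have i3 : simplex_pt [set a0; a; b] (vtx b) by apply: vtx_in; rewrite !inE eqxx orbT.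
rewrite -(seg_triangle Kface m0 fN KL cL i2 i1 i3).
by rewrite (segC Kface m0 fN KL cL i2 i1).
Qed.

(** The order in which [enum] lists the two ends is immaterial for an edge clear of [p]. *)
Definition eseg N p e : bool :=
  if enum e is a :: b :: _ then seg H N p (vtx a) (vtx b) else false.

Lemma esegE m N p a b : 0 < m -> fine K H m N -> [set a; b] \in K -> clear H m p [set a; b] ->
  a != b -> eseg N p [set a; b] = seg H N p (vtx a) (vtx b).
Proof.
move=> m0 fN Kab cab ab; rewrite /eseg.
have sz : size (enum [set a; b]) = 2%N by rewrite -cardE cards2 ab.
have un := enum_uniq [set a; b]; have me v := mem_enum [set a; b] v.
case: (enum _) sz un me => [|u [|w [|]]] //= _; rewrite inE andbT => uw me.
have := me u; have := me w; rewrite !inE !eqxx orbT => /esym hw /esym hu.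
have i1 : simplex_pt [set a; b] (vtx a) by apply: vtx_in; rewrite !inE eqxx.
have i2 : simplex_pt [set a; b] (vtx b) by apply: vtx_in; rewrite !inE eqxx orbT.
move: hu hw uw => /orP[] /eqP -> /orP[] /eqP ->; rewrite ?eqxx // => _.
exact: (segC Kface m0 fN Kab cab i2 i1).
Qed.

Lemma eseg_boundary m N p T : 0 < m -> fine K H m N -> T \in K -> clear H m p T -> #|T| = 3%N ->
  \big[addb/false]_(e in pairs T) eseg N p e = false.
Proof.
move=> m0 fN KT cT /eqP/card3P[a [b [c [ab ac bc E]]]].
have sub (u w : V) : u \in T -> w \in T -> [set u; w] \in K /\ clear H m p [set u; w].
  move=> uT wT; have s : [set u; w] \subset T by rewrite setU2_sub uT.
  by split; [apply: Kface KT _ s; apply: (@set_neq0 u); rewrite !inE eqxx | exact: clearS s cT].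
have [aT bT cT'] : [/\ a \in T, b \in T & c \in T] by rewrite E !inE !eqxx !orbT.
have [s1 s1'] := sub _ _ aT bT; have [s2 s2'] := sub _ _ aT cT'; have [s3 s3'] := sub _ _ bT cT'.
rewrite E big_pairs3 // !(esegE m0 fN) //.
rewrite -(seg_triangle Kface m0 fN KT cT (vtx_in _ aT) (vtx_in _ bT) (vtx_in _ cT')).
by case: seg; case: seg.
Qed.

(** Were the sum over the three sides zero, crossing numbers from one corner would be a potential on
    the boundary of [T], which is the link of [x]. *)
Lemma eseg_boundary_inside x T : bary K x -> supp x = T -> #|T| = 3%N -> open_disc (H x) ->
  exists2 m, 0 < m & forall N, fine K H m N ->
    \big[addb/false]_(e in pairs T) eseg N (H x) e = true.
Proof.
move=> bx xT T3 xo; have [m [m0 mc mno]] := cone_obstruction Kface chart bx xo.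
have KT : T \in K by rewrite -xT; case: bx.
have sub (u w : V) : u \in T -> w \in T ->
    [/\ [set u; w] \in link K x, [set u; w] \in K & clear H m (H x) [set u; w]].
  move=> uT wT; have s : [set u; w] \subset T by rewrite setU2_sub uT.
  have Kuw : [set u; w] \in K by apply: Kface KT _ s; apply: (@set_neq0 u); rewrite !inE eqxx.
  suff L : [set u; w] \in link K x by split=> //; exact: mc.
  rewrite inE Kuw xT (setUidPr s) KT /=; apply: contra_eqN T3 => /subset_leq_card h.
  by apply/eqP => T3; move: h; rewrite T3 cards2; case: (u != w).
exists m => // N fN; apply/negPn/negP => /negbTE bd0.
have /eqP/card3P[a [b [c [ab ac bc E]]]] := T3.
have [aT bT cT'] : [/\ a \in T, b \in T & c \in T] by rewrite E !inE !eqxx !orbT.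
have [l1 s1 s1'] := sub _ _ aT bT; have [l2 s2 s2'] := sub _ _ aT cT'; have [l3 s3 s3'] := sub _ _ bT cT'.
rewrite E big_pairs3 // !(esegE m0 fN) // in bd0.
have sC (u w : V) : u \in T -> w \in T -> seg H N (H x) (vtx u) (vtx w) = seg H N (H x) (vtx w) (vtx u).
  move=> uT wT; have [_ k1 k2] := sub _ _ uT wT.
  by apply: (segC Kface m0 fN k1 k2); apply: vtx_in; rewrite !inE eqxx ?orbT.
apply: (mno N (fun v => seg H N (H x) (vtx a) (vtx v)) fN) => v w.
rewrite inE xT => /and3P[_ KU _].
have UT : [set v; w] :|: T = T.
  apply/esym/eqP; rewrite eqEcard subsetUr T3 /=.
  exact: card_simplex_le3.
have : [set v; w] \subset T by rewrite -UT subsetUl.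
rewrite setU2_sub {1 2}E !inE -!orbA => /andP[/or3P[] /eqP -> /or3P[] /eqP ->]; rewrite ?segxx ?addbb //.
- by rewrite addbF sC.
- by move: bd0; case: seg; case: seg; case: seg.
- by rewrite addbF sC.
- by rewrite (sC c b) //; move: bd0; case: seg; case: seg; case: seg.
Qed.

End Disc.

(** * Covered stars and triviality of cocycles *)

Section Star.
Variables (R : realType) (V : finType) (K : {set {set V}}).
Variables (H : (V -> R) -> R * R) (G : R * R -> V -> R).
Hypothesis K0 : forall A, A \in K -> A != set0.
Hypothesis Kface : forall A B, A \in K -> B != set0 -> B \subset A -> B \in K.
Hypothesis chart : disc_chart (bary K) H G.
Implicit Types (x y z : V -> R) (A B T e : {set V}) (Z Y : {set {set V}}) (m d : R)
  (p q : R * R) (a b c v w : V) (N : nat).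

Local Notation vtx := (vtx R).

Lemma near_mix_small x y d : 0 < d -> bary K x -> bary K y -> exists2 t, 0 < t <= 1 & near_coord d x (mix t x y).
Proof.
move=> d0 bx byy; pose t := Num.min 1 (d / 2).
have t0 : 0 < t by rewrite lt_min ltr01 divr_gt0.
have td : t < d by apply: le_lt_trans (_ : d / 2 < d); [rewrite ge_min lexx orbT|lra].
exists t; first by rewrite t0 ge_min lexx.
move=> v; rewrite /mix (_ : _ - _ = t * (x v - y v)); last by ring.
have x1 := simplex_pt_le1 v (bary_simplex bx); have y1 := simplex_pt_le1 v (bary_simplex byy).
have x0 : 0 <= x v by case: bx. have y0 : 0 <= y v by case: byy.
rewrite normrM gtr0_norm //; apply: le_lt_trans td.
by rewrite ler_piMr ?(ltW t0) // ler_norml; apply/andP; split; lra.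
Qed.

Lemma mix_center x A : A \in K -> bary K x -> supp x \subset A -> forall t, 0 < t <= 1 ->
  bary K (mix t x (center R A)) /\ supp (mix t x (center R A)) = A.
Proof.
move=> KA bx xA t /andP[t0 t1]; have [cA sA] := center_simplex R (K0 KA).
have xs := simplexS xA (bary_simplex bx).
have t01 : 0 <= t <= 1 by rewrite ltW.
have ms := mix_simplex t01 xs cA; split; first exact: simplex_bary KA ms.
apply/eqP; rewrite eqEsubset supp_simplex //=; apply/subsetP => v vA.
have cv : 0 < center R A v by move: vA; rewrite -{1}sA inE.
have xv : 0 <= x v by case: bx.
by rewrite inE /mix; apply: ltr_wpDl; rewrite ?mulr_gt0 // mulr_ge0 // subr_ge0.
Qed.

(* The winding number mod 2 of the boundary of [Z] is the same around [p] and around an interior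
   point of a triangle of [Z] close to [x]; there it is 1, whereas it vanishes off the image of [Z]. *)
Lemma no_hole Z x T0 : (forall T, T \in Z -> T \in K /\ #|T| = 3%N) -> bary K x ->
  T0 \in Z -> supp x \subset T0 -> (forall e, e \in bd Z -> ~~ (supp x \subset e)) ->
  exists2 r, 0 < r & forall p, near_plane r (H x) p ->
    ~ exists2 m, 0 < m & forall T, T \in Z -> clear H m p T.
Proof.
move=> Z3 bx T0Z xT0 xbd.
have bdK e : e \in bd Z -> e \in K /\ exists a b, a != b /\ e = [set a; b].
  rewrite inE => /andP[e2 o]; have /cards2P[a [b [ab eE]]] := e2; split; last by exists a, b.
  have [T] : exists T, T \in [set T in Z | e \subset T].
    by apply/set0Pn; apply: contraTneq o => ->; rewrite cards0.
  rewrite inE => /andP[TZ eT]; apply: Kface (Z3 _ TZ).1 _ eT.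
  by rewrite -card_gt0 (eqP e2).
have [m1 m10 hm1] := clear_notsub Kface chart bx.
have m32 : 0 < m1 / 32 by rewrite divr_gt0.
have [d d0 hd] := chart_unif chart m32.
exists (m1 / 32) => // p np [m2 m20 hm2].
have d20 : 0 < d / 2 by rewrite divr_gt0.
have [KT0 T03] := Z3 _ T0Z.
have [cT0 _] := center_simplex R (K0 KT0).
have [t t01 nt] := near_mix_small d20 bx (simplex_bary Kface KT0 cT0).
have [bt st] := mix_center KT0 bx xT0 t01.
have [x0 [bx0 nx0 x0o]] := disc_perturb chart bt d20; rewrite st => sx0.
have x0T : supp x0 = T0.
  apply/esym/eqP; rewrite eqEcard sx0 T03; apply: (card_simplex_le3 K0 Kface chart).
  by case: bx0.
have nxx0 : near_plane (m1 / 32) (H x) (H x0).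
  apply: hd => // v; have := ler_distD (mix t x (center R T0) v) (x v) (x0 v).
  by have := nt v; have := nx0 v; lra.
have [ma ma0 hma] := eseg_boundary_inside K0 Kface chart bx0 x0T T03 x0o.
have [mb mb0 hmb] := clear_notsub Kface chart bx0.
pose m := Num.min (m1 / 2) (Num.min m2 (Num.min ma mb)).
have m0 : 0 < m by rewrite !lt_min m20 ma0 mb0 divr_gt0.
have [l1 l2 l3 l4] : [/\ m <= m1 / 2, m <= m2, m <= ma & m <= mb].
  by rewrite /m !ge_min !lexx ?orbT.
have [N fN] := fine_exists chart m0.
have Hin : \big[addb/false]_(e in bd Z) eseg H N (H x0) e = true.
  rewrite big_bd (bigD1 T0) //= (hma N (fine_le l3 fN)) big1 // => T /andP[TZ TT0].
  have [KT T3] := Z3 _ TZ; apply: (eseg_boundary Kface m0 fN KT _ T3).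
  apply: (clear_le l4); apply: hmb => //; rewrite x0T; apply: contra TT0 => s.
  by apply/eqP/esym/eqP; rewrite eqEcard s T3 T03.
have Hout : \big[addb/false]_(e in bd Z) eseg H N p e = false.
  rewrite big_bd big1 // => T TZ; have [KT T3] := Z3 _ TZ.
  by apply: (eseg_boundary Kface m0 fN KT _ T3); apply: clear_le l2 _; exact: hm2.
have c1 e q : e \in bd Z -> near_plane (m1 / 32) (H x) q -> clear H (m1 / 2) q e.
  move=> ebd nq y ye; have := hm1 e (bdK e ebd).1 (xbd e ebd) y ye.
  rewrite !farN_near; apply: contra => h; have := near_planeD h _.
  rewrite near_plane_sym in nq; move=> /(_ _ _ nq); apply: near_plane_le; lra.
have fN' := fine_le l1 fN; have m120 : 0 < m1 / 2 by rewrite divr_gt0.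
(* Moving the base point from [H x0] to [p] changes the crossing number of a boundary edge by a
   difference of values at its ends; such differences sum to zero over [bd Z]. *)
have Hdiff e : e \in bd Z ->
    eseg H N (H x0) e (+) eseg H N p e = vsum (fun a => wind (H (vtx a) - H x0) (H (vtx a) - p)) e.
  move=> ebd; have [Ke [a [b [ab eE]]]] := bdK e ebd.
  have ca := c1 e _ ebd nxx0; have cb := c1 e _ ebd np; rewrite eE in Ke ca cb *.
  rewrite vsum2 // !(esegE Kface m120 fN') //.
  have i1 : simplex_pt [set a; b] (vtx a) by apply: vtx_in; rewrite !inE eqxx.
  have i2 : simplex_pt [set a; b] (vtx b) by apply: vtx_in; rewrite !inE eqxx orbT.
  have [d' [d'0 hd'] Nd'] := fN'; have [N0 _] := fineW d'0 Nd'.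
  rewrite /seg (wind_ladder m120) => [|i iN|i iN].
  - by rewrite mul0r divff ?pnatr_eq0 -?lt0n // !mix0 !mix1.
  - have ii := mix_simplex (frac01 R N0 iN) i1 i2.
    split; [exact: ca | exact: cb | ].
    rewrite near_planeBl; apply: near_plane_le (near_planeD _ np); last by rewrite near_plane_sym; exact: nxx0.
    by lra.
  - have t1 := frac01 R N0 (ltnW iN); have t2 := frac01 R N0 iN.
    have b1 := simplex_bary Kface Ke (mix_simplex t1 i1 i2).
    have b2 := simplex_bary Kface Ke (mix_simplex t2 i1 i2).
    by rewrite !near_planeB; split; apply: hd' => //; apply: near_step => //; apply: simplex_bary Ke _.
have : \big[addb/false]_(e in bd Z) (eseg H N (H x0) e (+) eseg H N p e) = false.
  by rewrite (eq_bigr _ Hdiff) vsum_bd // => T /Z3[].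
by rewrite big_split /= Hin Hout.
Qed.

(** Any point close to [H x] and missed by the image of [Z] contradicts [no_hole]. If [H x] is on
    the circle, such a point is found outside the disc; if a simplex around [x] lies in no triangle
    of [Z], it is found by moving [x] slightly into that simplex. *)
Theorem star_covered Z x T0 : (forall T, T \in Z -> T \in K /\ #|T| = 3%N) -> bary K x ->
  T0 \in Z -> supp x \subset T0 -> (forall e, e \in bd Z -> ~~ (supp x \subset e)) ->
  open_disc (H x) /\ forall A, A \in K -> supp x \subset A -> exists2 T, T \in Z & A \subset T.
Proof.
move=> Z3 bx T0Z xT0 xbd; have [r r0 hr] := no_hole Z3 bx T0Z xT0 xbd.
split.
  have := chart_disc chart bx; rewrite /unit_disc /= le_eqVlt => /orP[/eqP h1|//].
  have [h2 h3] := unit_disc_le1 (chart_disc chart bx).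
  exfalso; apply: (hr ((1 + r / 2) * (H x).1, (1 + r / 2) * (H x).2)).
    rewrite /near_plane /= (_ : _ - _ = - (r / 2 * (H x).1)); last by ring.
    rewrite (_ : _ - (1 + r / 2) * (H x).2 = - (r / 2 * (H x).2)); last by ring.
    have r2 : `|r / 2| = r / 2 by rewrite gtr0_norm ?divr_gt0.
    rewrite !normrN !(normrM (r / 2)) r2; have r20 : r / 2 < r by lra.
    by apply/andP; split; apply: le_lt_trans r20; rewrite ler_piMr // ltW ?divr_gt0.
  exists (r / 8); first by rewrite divr_gt0.
  move=> T TZ y yT; have := chart_disc chart (simplex_bary Kface (Z3 _ TZ).1 yT).
  rewrite farN_near /unit_disc /=; set q := H y => hq; apply/negP => /andP[/=].
  move: h1 h2 h3; move: (H x) => p h1; rewrite !ler_norml !ltr_norml.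
  move=> /andP[a1 a2] /andP[a3 a4] /andP[b1 b2] /andP[b3 b4].
  (* A point [q] of the disc within [r / 8] of the pushed point would have scalar product at least 1
     + r / 4 with the unit vector [p]. *)
  have inner : q.1 * p.1 + q.2 * p.2 <= 1.
    by have := sqr_ge0 (q.1 - p.1); have := sqr_ge0 (q.2 - p.2); rewrite !sqrrB; lra.
  have E : (q.1 - (1 + r / 2) * p.1) * p.1 + (q.2 - (1 + r / 2) * p.2) * p.2 =
           q.1 * p.1 + q.2 * p.2 - (1 + r / 2) * (p.1 ^+ 2 + p.2 ^+ 2) by ring.
  rewrite h1 in E; move: E b1 b2 b3 b4; set u := q.1 - _; set w := q.2 - _ => E b1 b2 b3 b4.
  have B (s k : R) : - (r / 8) < s -> s < r / 8 -> -1 <= k -> k <= 1 -> - (r / 8) <= s * k.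
    by move=> *; nra.
  have := B _ _ b1 b2 a1 a2; have := B _ _ b3 b4 a3 a4.
  by lra.
move=> A KA xA; apply: contrapT => hA.
have [d d0 hd] := chart_unif chart r0.
have [cA _] := center_simplex R (K0 KA).
have [t t01 nt] := near_mix_small d0 bx (simplex_bary Kface KA cA).
have [bt st] := mix_center KA bx xA t01.
apply: (hr (H (mix t x (center R A)))); first exact: hd.
have [m m0 hm] := clear_notsub Kface chart bt.
exists m => // T TZ; apply: hm (Z3 _ TZ).1 _.
by rewrite st; apply/negP => AT; apply: hA; exists T.
Qed.

(* Simplicial approximation: a point of the disc is sent to a vertex with a large coordinate. *)
Theorem cocycle_trivial (phi : V -> V -> bool) :
  (forall a b c, [set a; b; c] \in K -> phi a b (+) phi b c = phi a c) ->
  exists psi : V -> bool, forall a b, [set a; b] \in K -> phi a b = psi a (+) psi b.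
Proof.
move=> coc.
have [v0|V0] := pickP (fun v : V => true); last by exists (fun=> false) => a; have := V0 a.
have V0 : 0 < (#|V|%:R)^-1 :> R by rewrite invr_gt0 ltr0n; apply/card_gt0P; exists v0.
have gP y : exists a, bary K y -> a \in supp y /\ (#|V|%:R)^-1 <= y a.
  have [yL|] := pselect (bary K y); last by exists v0.
  by have [a a1 a2] := big_coord (bary_simplex yL); exists a.
have [g hg] := choice gP.
have [d d0 hd] := chart_inv_unif chart V0.
pose c p q := phi (g (G p)) (g (G q)).
have gs p q : unit_disc p -> unit_disc q -> near_plane d p q -> g (G q) \in supp (G p).
  move=> dp dq npq; have [_ h1] := hg _ (chart_inv chart dq).
  rewrite inE; have := hd _ _ dp dq npq (g (G q)).
  by rewrite ltr_norml => /andP[h2 _]; move: h1 h2; set z := _^-1; lra.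
have cP p q r : unit_disc p -> unit_disc q -> unit_disc r -> near_plane d p q -> near_plane d p r ->
    c p q (+) c q r = c p r.
  move=> dp dq dr pq pr; apply: coc; have bp := chart_inv chart dp.
  have s : [set g (G p); g (G q); g (G r)] \subset supp (G p).
    by rewrite set3_sub !gs // near_planexx.
  by apply: Kface s; [case: bp | apply: (@set_neq0 _ (g (G p))); rewrite !inE eqxx].
have [N [N0 Nd]] : exists N : nat, (0 < N)%N /\ 2 / N%:R < d :> R.
  exists (Num.truncn (2 / d)).+1; split=> //.
  rewrite ltr_pdivrMr ?ltr0n // mulrC -ltr_pdivrMr //; exact: Num.Theory.truncnS_gt.
pose ray p (i : nat) : R * R := (i%:R / N%:R * p.1, i%:R / N%:R * p.2).
(* The Poincare lemma: [B] integrates the local cochain [c] along the ray from the origin, and the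
   ladder between two nearby rays shows that [c] is its coboundary. *)
pose B p := path_sum c (ray p) N.
have rayd p i : unit_disc p -> (i <= N)%N -> unit_disc (ray p i).
  move=> dp iN; have /andP[t0 t1] := frac01 R N0 iN; move: dp.
  rewrite /unit_disc /=; move: (_ / _) t0 t1 => t t0 t1; rewrite !exprMn -mulrDr; set s := _ + _.
  move=> s1; have s0 : 0 <= s by rewrite addr_ge0 // sqr_ge0.
  have t21 : t ^+ 2 <= 1 by rewrite exprn_ile1.
  by apply: le_trans (_ : 1 * s <= 1); [rewrite ler_wpM2r|rewrite mul1r].
have rayn p i : unit_disc p -> near_plane (d / 2) (ray p i) (ray p i.+1).
  move=> dp; have [h1 h2] := unit_disc_le1 dp.
  have E (x : R) : i%:R / N%:R * x - i.+1%:R / N%:R * x = - (x / N%:R).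
    by rewrite -natr1 mulrDl mul1r; ring.
  have S (x : R) : `|x| <= 1 -> `|x / N%:R| < d / 2.
    move=> x1; rewrite normrM [X in _ * X]gtr0_norm ?invr_gt0 ?ltr0n //.
    apply: le_lt_trans (_ : 1 / N%:R < _); last by lra.
    by rewrite ler_wpM2r ?invr_ge0 ?ler0n.
  by rewrite /near_plane /= !E !normrN !S.
have rayq p q i : (i <= N)%N -> near_plane (d / 2) p q -> near_plane (d / 2) (ray p i) (ray q i).
  move=> iN /andP[h1 h2]; have /andP[t0 t1] := frac01 R N0 iN.
  rewrite /near_plane /= -!mulrBr; move: (i%:R / N%:R) t0 t1 => t t0 t1; rewrite !normrM ger0_norm //.
  by apply/andP; split; [apply: le_lt_trans h1|apply: le_lt_trans h2]; rewrite ler_piMl.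
have d2d : d / 2 <= d by lra.
have BP p q : unit_disc p -> unit_disc q -> near_plane (d / 2) p q -> c p q = B p (+) B q.
  move=> dp dq npq; rewrite /B path_sum_ladder.
    rewrite /ray mul0r !mul0r divff ?pnatr_eq0 -?lt0n // !mul1r -!surjective_pairing.
    rewrite [X in _ = X (+) _](_ : _ = false) //.
    have u0 : unit_disc (0 : R, 0 : R) by rewrite /unit_disc /= expr0n /= addr0 ler01.
    have := cP _ _ _ u0 u0 u0 (near_planexx _ d0) (near_planexx _ d0).
    by case: (c _ _).
  move=> i iN.
  have [r1 r2 r3 r4] : [/\ unit_disc (ray p i), unit_disc (ray q i), unit_disc (ray p i.+1) & unit_disc (ray q i.+1)].
    by split; apply: rayd => //; exact: ltnW.
  have n1 := rayn p i dp; have n2 := rayn q i dq; have n3 := rayq p q i (ltnW iN) npq.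
  have n4 : near_plane d (ray p i) (ray q i.+1) by rewrite [d]splitr; exact: near_planeD n3 n2.
  by rewrite !cP //; apply: near_plane_le d2d _.
exists (fun a => B (H (vtx a))) => a b Kab.
have d20 : 0 < d / 2 by rewrite divr_gt0.
have [e e0 he] := chart_unif chart d20.
have va : simplex_pt [set a; b] (vtx a) by apply: vtx_in; rewrite !inE eqxx.
have vb : simplex_pt [set a; b] (vtx b) by apply: vtx_in; rewrite !inE eqxx orbT.
pose M := (Num.truncn (1 / e)).+1.
have Me : 1 < M%:R * e by rewrite -ltr_pdivrMr //; exact: Num.Theory.truncnS_gt.
(* The edge is walked in short steps. On each of them [c] is a difference of values of [B] and also,
   since all chosen vertices are [a] or [b], a difference of values of [phi a]. *)
pose y j := mix (j%:R / M%:R) (vtx a) (vtx b).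
have yS k : (k <= M)%N -> simplex_pt [set a; b] (y k).
  by move=> kM; apply: mix_simplex => //; exact: frac01.
have yb k : (k <= M)%N -> bary K (y k) by move=> /yS; exact: simplex_bary.
have y0 : y 0%N = vtx a by rewrite /y mul0r mix0.
have yM : y M = vtx b by rewrite /y divff ?pnatr_eq0 // mix1.
have gy k : (k <= M)%N -> g (y k) \in [set a; b].
  by move=> kM; apply: (subsetP (supp_simplex (yS k kM))); case: (hg _ (yb k kM)).
have gv v : [set v] \in K -> g (vtx v) = v.
  move=> Kv; have [h _] := hg _ (simplex_bary Kface Kv (vtx_simplex R v)).
  by have := subsetP (supp_simplex (vtx_simplex R v)) _ h; rewrite inE => /eqP.
have Kv v : v \in [set a; b] -> [set v] \in K.
  by move=> vab; apply: Kface Kab _ _; [apply: (@set_neq0 _ v); rewrite inE | rewrite sub1set].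
have phi3 u v w : u \in [set a; b] -> v \in [set a; b] -> w \in [set a; b] -> phi u v (+) phi v w = phi u w.
  move=> hu hv hw; apply: coc; apply: Kface Kab _ _; last by rewrite set3_sub hu hv.
  by apply: (@set_neq0 _ u); rewrite !inE eqxx.
have aab : a \in [set a; b] by rewrite !inE eqxx.
have bab : b \in [set a; b] by rewrite !inE eqxx orbT.
have L1 : path_sum c (fun i => H (y i)) M = B (H (vtx a)) (+) B (H (vtx b)).
  rewrite -y0 -yM; apply: (path_sum_coboundary (b := fun k => B (H (y k)))) => k kM.
  apply: BP; [exact/(chart_disc chart)/yb/ltnW | exact/(chart_disc chart)/yb |].
  apply: he; [exact/yb/ltnW|exact: yb|].
  exact: (near_step k Me e0 (simplex_bary Kface Kab va) (simplex_bary Kface Kab vb)).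
rewrite -L1 (path_sum_coboundary (b := fun i => phi a (g (y i)))).
  have := phi3 _ _ _ aab aab aab; rewrite y0 yM (gv a) ?(gv b); try exact: Kv.
  by case: (phi a a); case: (phi a b).
move=> k kM; rewrite /c !(chartK chart); try exact: yb; last exact/yb/ltnW.
have := phi3 _ _ _ aab (gy _ (ltnW kM)) (gy _ kM).
by case: (phi a _); case: (phi _ _); case: (phi _ _).
Qed.

End Star.

(** * Even edge sets bound *)

Section Homology.
Variables (V : finType) (K : {set {set V}}).
Implicit Types (A B T e : {set V}) (Z Y : {set {set V}}) (a b c v w : V).

Definition triangles : {set {set V}} := [set T in K | #|T| == 3%N].
Definition edges : {set {set V}} := [set e in K | #|e| == 2%N].

Hypothesis cocycle_trivial : forall phi : V -> V -> bool,
  (forall a b c, [set a; b; c] \in K -> phi a b (+) phi b c = phi a c) ->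
  exists psi : V -> bool, forall a b, [set a; b] \in K -> phi a b = psi a (+) psi b.

Lemma sum_bool (I : finType) (F : I -> bool) : (\sum_i F i)%R = \big[addb/false]_i F i.
Proof. by []. Qed.

(** Duality over the field [bool]: if [Y] is not in the row space of the triangle-edge matrix, some
    column of the cokernel is a cocycle that does not vanish on [Y]. But this cocycle is a
    coboundary, and coboundaries vanish on even sets. *)
Theorem even_boundary Y : Y \subset edges -> (forall v, ~~ odd #|[set e in Y | v \in e]|) ->
  exists2 Z : {set {set V}}, Z \subset triangles & bd Z = Y.
Proof.
move=> /subsetP YE Yev; pose n := #|{: {set V}}|.
pose M : 'M[bool]_n := \matrix_(i, j) ((enum_val i \in triangles) && (enum_val j \in pairs (enum_val i))).
pose y : 'rV[bool]_n := \row_j (enum_val j \in Y).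
have [/submxP[u yE]|] := boolP (y <= M)%MS.
  pose Z := [set T in triangles | u ord0 (enum_rank T)].
  exists Z; first by apply/subsetP => T; rewrite inE => /andP[].
  apply/setP => e; have := congr1 (fun z : 'rV[bool]_n => z ord0 (enum_rank e)) yE.
  rewrite /y !mxE enum_rankK sum_bool => ->.
  rewrite inE odd_bigaddb (reindex _ (onW_bij _ (@enum_val_bij _))) /=.
  have [e2|e2] := boolP (#|e| == 2%N); last first.
    rewrite /= big1 // => i _; rewrite !mxE !inE enum_rankK (negbTE e2) !andbF.
    by rewrite mulr0.
  apply: eq_bigr => i _; rewrite !mxE !inE enum_rankK enum_valK e2 andbT.
  by case: (u _ _); case: (_ \in K); case: (_ == _); case: (e \subset _).
rewrite submxE => nz.
have [j yj] : exists j, (y *m cokermx M) ord0 j.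
  apply/existsP; apply: contraNT nz => /existsPn h; apply/eqP/rowP => j.
  by rewrite [RHS]mxE; exact/negbTE/h.
move: (mulmx_coker M) yj; move: (cokermx M) => C MC yj.
pose phi e := C (enum_rank e) j.
have phiT T : T \in triangles -> \big[addb/false]_(e in pairs T) phi e = false.
  move=> Ttri; have := congr1 (fun A : 'M[bool]_n => A (enum_rank T) j) MC.
  rewrite !mxE sum_bool [RHS](_ : _ = false) // => h; rewrite -[RHS]h.
  rewrite [LHS](reindex _ (onW_bij _ (@enum_val_bij _))) big_mkcond /=.
  apply: eq_bigr => i _; rewrite !mxE enum_rankK Ttri /= /phi enum_valK.
  by case: (_ \in pairs T); case: (C i j).
(* The value on a degenerate pair is set to 0, so that the cocycle rule also covers repeated
   vertices. *)
have [psi hpsi] : exists psi : V -> bool, forall a b, [set a; b] \in K ->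
    (a != b) && phi [set a; b] = psi a (+) psi b.
  apply: cocycle_trivial => a b c Kabc.
  have [->|ab] := eqVneq a b; first by [].
  have [E|bc] := boolP (b == c); first by move/eqP: E => <-; rewrite /= addbF ab.
  have [<-|ac] := eqVneq a c; first by rewrite /= [[set b; a]]setUC addbb.
  have : [set a; b; c] \in triangles by rewrite inE Kabc; apply/card3P; exists a, b, c.
  move=> /phiT; rewrite big_pairs3 //=.
  by case: (phi _); case: (phi _); case: (phi _).
suff : \big[addb/false]_(e in Y) phi e = false.
  have -> : \big[addb/false]_(e in Y) phi e = (y *m C) ord0 j; last by rewrite yj.
  rewrite !mxE sum_bool [LHS](reindex _ (onW_bij _ (@enum_val_bij _))) big_mkcond /=.
  apply: eq_bigr => i _; rewrite !mxE /phi enum_valK.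
  by case: (_ \in Y); case: (C i j).
have -> : \big[addb/false]_(e in Y) phi e = \big[addb/false]_(e in Y) vsum psi e.
  apply: eq_bigr => e /YE; rewrite inE => /andP[Ke /cards2P[a [b [ab eE]]]].
  by rewrite eE in Ke *; rewrite vsum2 // -hpsi // ab.
rewrite /vsum (exchange_big_dep xpredT) //= big1 // => v _.
rewrite big_mkcond /= (eq_bigr (fun e => ((e \in Y) && (v \in e)) && psi v)) => [|e _]; last by case: ifP.
by rewrite -big_distrl /= -odd_bigaddb (negbTE (Yev v)).
Qed.

End Homology.

(** * Local structure of a triangulated disc *)

Section DiscFacts.
Variables (R : realType) (V : finType) (D : complex V).
Hypothesis discD : triangulated_disc R D.
Implicit Types (A B T e : {set V}) (Z Y : {set {set V}}) (a b c v w : V).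

Variable K : {set {set V}}.
Hypothesis KE : K = simplices D.

Let KN0 : forall A, A \in K -> A != set0.
Proof. by rewrite KE => A; exact: simplices_neq0. Qed.

Let Kface : forall A B, A \in K -> B != set0 -> B \subset A -> B \in K.
Proof. by rewrite KE => A B; exact: simplices_face. Qed.

Let polyE : polyhedron D = @bary R V K.
Proof. by rewrite polyhedronE KE. Qed.

Lemma disc_has_chart : exists H G, disc_chart (@bary R V K) H G.
Proof.
by have [h /homeomorphism_chart[H [G [hHG _]]]] := discD; exists H, G; rewrite -polyE.
Qed.

Lemma disc_card_le3 A : A \in K -> (#|A| <= 3)%N.
Proof.
by have [H [G hHG]] := disc_has_chart; exact: card_simplex_le3 KN0 Kface hHG _.
Qed.

Lemma disc_even_boundary Y : Y \subset edges K -> (forall v, ~~ odd #|[set e in Y | v \in e]|) ->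
  exists2 Z : {set {set V}}, Z \subset triangles K & bd Z = Y.
Proof.
have [H [G hHG]] := disc_has_chart.
by apply: even_boundary => phi; exact: cocycle_trivial Kface hHG phi.
Qed.

Lemma trianglesP Z : Z \subset triangles K -> forall T, T \in Z -> T \in K /\ #|T| = 3%N.
Proof. by move=> /subsetP ZK T /ZK; rewrite inE => /andP[? /eqP]. Qed.

(** Two of three triangles on [e] form a chain whose boundary avoids [e]; by [star_covered] one of
    the two would contain the third. *)
Lemma disc_edge_le2 e : e \in edges K -> (#|[set T in triangles K | e \subset T]| <= 2)%N.
Proof.
move=> eE; rewrite leqNgt; apply/negP => h.
have [H [G hHG]] := disc_has_chart.
have /andP[Ke e2] : (e \in K) && (#|e| == 2%N) by move: eE; rewrite inE.
have [T1 T1s] : exists T1, T1 \in [set T in triangles K | e \subset T].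
  by apply/set0Pn; rewrite -card_gt0; apply: leq_ltn_trans h.
rewrite (cardsD1 T1) T1s ltnS in h.
have [T2 T2s] : exists T2, T2 \in [set T in triangles K | e \subset T] :\ T1.
  by apply/set0Pn; rewrite -card_gt0; apply: leq_ltn_trans h.
rewrite (cardsD1 T2) T2s ltnS in h.
have [T3 T3s] : exists T3, T3 \in ([set T in triangles K | e \subset T] :\ T1) :\ T2.
  by apply/set0Pn; rewrite -card_gt0; apply: leq_ltn_trans h.
have [cx sx] := center_simplex R (KN0 Ke).
have bx := simplex_bary Kface Ke cx.
move: T1s T2s T3s; rewrite !inE => /andP[T1t eT1] /and3P[T21 T2t eT2] /and4P[T32 T31 T3t eT3].
have Zt : [set T1; T2] \subset triangles K by rewrite subUset !sub1set !inE T1t T2t.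
have [|||_ cov] := star_covered KN0 Kface hHG (trianglesP Zt) bx (T0 := T1) _ _ _.
- by rewrite !inE eqxx.
- by rewrite sx.
- move=> e'; rewrite inE sx => /andP[e'2 o]; apply: contraL o => ee'.
  have -> : e' = e by apply/esym/eqP; rewrite eqEcard ee' (eqP e2) (eqP e'2).
  rewrite (_ : [set T in _ | _] = [set T1; T2]); first by rewrite cards2 eq_sym T21.
  by apply/setP => T; rewrite !inE; case: eqP => [->|_]; rewrite ?eT1 //=; case: eqP => [->|_]; rewrite ?eT2.
have /andP[KT3 T33] := T3t; have /andP[_ T13] := T1t; have /andP[_ T23] := T2t.
have := cov T3 KT3; rewrite sx => /(_ eT3)[T]; rewrite !inE => /orP[] /eqP -> s.
  by case/negP: T31; rewrite eqEcard s (eqP T33) (eqP T13).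
by case/negP: T32; rewrite eqEcard s (eqP T33) (eqP T23).
Qed.

Lemma vtx_supp v : supp (vtx R v) = [set v].
Proof. by apply/setP => u; rewrite !inE /vtx; case: eqP; rewrite ?ltr01 ?ltxx. Qed.

Lemma set1_fset (v : V) : [fset u in [set v]]%fset = [fset v]%fset.
Proof. by apply/fsetP => u; rewrite !finmap.inE. Qed.

(** [star_covered] applies to every chart, so no homeomorphism onto the disc sends [w] to the
    circle; this is what rules out a boundary vertex. *)
Lemma disc_even_star Z w T0 : Z \subset triangles K -> T0 \in Z -> w \in T0 ->
  (forall e, e \in bd Z -> w \notin e) ->
  interior_vertex R D w /\ forall A, A \in K -> w \in A -> exists2 T, T \in Z & A \subset T.
Proof.
move=> Zt T0Z wT0 wbd.
have Kw : [set w] \in K.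
  by apply: Kface (trianglesP Zt T0Z).1 _ _; rewrite ?sub1set //; apply: (@set_neq0 _ w); rewrite inE.
have bw := simplex_bary Kface Kw (vtx_simplex R w).
have hcov H G : disc_chart (bary K) H G -> open_disc (H (vtx R w)) /\
    forall A, A \in K -> w \in A -> exists2 T, T \in Z & A \subset T.
  move=> hHG; have [||o c] := star_covered KN0 Kface hHG (trianglesP Zt) bw T0Z _ _.
  - by rewrite vtx_supp sub1set.
  - by move=> e /wbd; rewrite vtx_supp sub1set.
  - by split=> // A KA wA; apply: c => //; rewrite vtx_supp sub1set.
split; last by have [H [G /hcov[]]] := disc_has_chart.
have Dw : D [fset w]%fset by rewrite -set1_fset; apply/simplicesP; rewrite -KE.
split=> // -[_ [h [hh hc]]].
have [H [G [hHG HE]]] := homeomorphism_chart hh; rewrite polyE in hHG.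
have pw : polyhedron D (vtx R w) by rewrite polyE.
have [+ _] := hcov H G hHG; rewrite (HE (Point pw)) /open_disc => o.
have := hc (Point pw); rewrite /unit_circle /= => hc'; move: o; rewrite hc' ?ltxx //.
have [x0 x1 xw] := vtx_simplex R w; split=> //.
- by move=> v vw; apply: xw; move: vw; rewrite finmap.inE inE.
- by rewrite big_seq_fset1 /vtx eqxx.
Qed.

(** Near [w] the edge has points sent into the open disc. With at most one triangle on [e], the link
    of such a point is a path through the third vertex [v], or two isolated points, and carries a
    potential. *)
Lemma disc_interior_edge w e : interior_vertex R D w -> e \in edges K -> w \in e ->
  (2 <= #|[set T in triangles K | e \subset T]|)%N.
Proof.
move=> [Dw wint] eE we; rewrite leqNgt ltnS; apply/negP => h.
have [h0 /[dup] hh0 /homeomorphism_chart[H [G [hHG HE]]]] := discD.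
rewrite polyE in hHG.
have /andP[Ke e2] : (e \in K) && (#|e| == 2%N) by move: eE; rewrite inE.
have Kw : [set w] \in K by rewrite KE; apply/simplicesP; rewrite set1_fset.
have bw := simplex_bary Kface Kw (vtx_simplex R w).
have pw : polyhedron D (vtx R w) by rewrite polyE.
have wo : open_disc (H (vtx R w)).
  rewrite /open_disc lt_neqAle (chart_disc hHG bw) andbT; apply/negP => /eqP Hw.
  apply: wint; split=> //; exists h0; split=> // x xw.
  suff -> : x = Point pw by rewrite -HE.
  apply: realization_eq => v /=; case: xw => x0 x1 x2.
  rewrite big_seq_fset1 in x2; rewrite /vtx; case: eqP => [->|/eqP vw]; first by rewrite x2.
  by rewrite x1 // finmap.inE.
have [r r0 hr] := open_disc_near wo.
have [d d0 hd] := chart_unif hHG r0.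
have [ce _] := center_simplex R (KN0 Ke).
have [t t01 nt] := near_mix_small d0 bw (simplex_bary Kface Ke ce).
have ws : supp (vtx R w) \subset e by rewrite vtx_supp sub1set.
have [bx sx] := mix_center KN0 Kface Ke bw ws t01.
set x := mix t _ _ in nt bx sx.
have xo : open_disc (H x).
  have /andP[n1 n2] := hd _ _ bw bx nt.
  have := hr ((H x).1 - (H (vtx R w)).1, (H x).2 - (H (vtx R w)).2) => /=.
  rewrite !(addrC _ (_ - _)) !subrK -surjective_pairing; apply; by rewrite distrC ltW.
have [m [m0 mc mno]] := cone_obstruction Kface hHG bx xo.
have [N fN] := fine_exists hHG m0.
have lsub a b : [set a; b] \in link K x ->
    a = b \/ exists2 T, T \in [set T in triangles K | e \subset T] &
       [&& a \in T, b \in T & ~~ (e \subset [set a; b])].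
  rewrite inE sx => /and3P[Kab KU nab]; have [U3|U3] := ltnP 2 #|[set a; b] :|: e|.
    right; exists ([set a; b] :|: e); last by rewrite !inE !eqxx nab orbT.
    by rewrite !inE KU subsetUr andbT eqn_leq U3 disc_card_le3.
  left; apply/eqP; apply: contraNT nab => ab.
  rewrite (_ : [set a; b] = e) //; apply/eqP; rewrite eqEcard (eqP e2) cards2 ab andbT.
  have -> : e = [set a; b] :|: e by apply/eqP; rewrite eqEcard subsetUr (eqP e2).
  exact: subsetUl.
have [E|/set0Pn[T Ts]] := eqVneq [set T in triangles K | e \subset T] set0.
  apply: (mno N (fun=> false) fN) => a b /lsub[->|[T]]; first by rewrite segxx.
  by rewrite E inE.
have TE T' : T' \in [set T in triangles K | e \subset T] -> T' = T.
  move=> T's; apply/eqP; apply: contraTT h => TT; rewrite -ltnNge.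
  rewrite (cardsD1 T) Ts (cardsD1 T'); suff -> : T' \in [set T in triangles K | e \subset T] :\ T by [].
  by move: T's; rewrite !inE TT.
have [Tt eT] : T \in triangles K /\ e \subset T by move: Ts; rewrite inE => /andP[].
have T3 : #|T| = 3%N by move: Tt; rewrite inE => /andP[_ /eqP].
have /cards1P[v Ev] : #|T :\: e| == 1%N.
  by rewrite cardsD (setIidPr eT) T3 (eqP e2).
have inT a : a \in T -> (a \in e) || (a == v).
  move=> aT; have [//|ae] := boolP (a \in e).
  by have : a \in T :\: e; [rewrite inE ae aT | rewrite Ev inE => ->].
apply: (mno N (fun u => seg H N (H x) (vtx R v) (vtx R u)) fN) => a b L.
have [->|[T' /TE -> /and3P[aT bT nab]]] := lsub a b L; first by rewrite segxx addbb.
have [->|av] := eqVneq a v; first by rewrite segxx.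
have [bv|bv] := eqVneq b v.
  rewrite bv in L *; rewrite segxx addbF; have KL : [set a; v] \in K by move: L; rewrite inE => /andP[].
  by apply: (segC Kface m0 fN KL (mc _ L)); apply: vtx_in; rewrite !inE eqxx ?orbT.
have := inT a aT; have := inT b bT; rewrite (negbTE av) (negbTE bv) !orbF => be ae.
have [->|ab] := eqVneq a b; first by rewrite segxx addbb.
by case/negP: nab; rewrite -[[set a; b]](_ : e = _) //; apply/esym/eqP; rewrite eqEcard setU2_sub ae be (eqP e2) cards2 ab.
Qed.

End DiscFacts.

(** * Combinatorial discs with interior degrees at least six *)

Local Close Scope ring_scope.

Section SymmetricDifference.
Variable V : finType.
Implicit Types (A B T e : {set V}) (Z Y : {set {set V}}) (v w : V).

Definition symd (X : finType) (A B : {set X}) : {set X} := [set x | (x \in A) (+) (x \in B)].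

Lemma symdK (X : finType) (A B : {set X}) : symd (symd A B) B = A.
Proof. by apply/setP => x; rewrite !inE addbK. Qed.

Lemma odd_symd (X : finType) (A B : {set X}) (p : pred X) :
  odd #|[set x in symd A B | p x]| = odd #|[set x in A | p x]| (+) odd #|[set x in B | p x]|.
Proof.
rewrite !odd_bigaddb -big_split /=; apply: eq_bigr => x _.
by rewrite !inE; case: (x \in A); case: (x \in B); case: (p x).
Qed.

Lemma bd_symd Z Y : bd (symd Z Y) = symd (bd Z) (bd Y).
Proof.
by apply/setP => e; rewrite !inE odd_symd; case: (#|e| == 2).
Qed.

Lemma odd_bd_star Z v : (forall T, T \in Z -> #|T| = 3) -> ~~ odd #|[set e in bd Z | v \in e]|.
Proof.
move=> Z3; rewrite odd_bigaddb; apply/negbT.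
rewrite -[RHS](vsum_bd (fun u => u == v) Z3) [RHS]big_mkcond /=; apply: eq_bigr => e _.
rewrite /vsum; case: (e \in bd Z) => //=.
rewrite big_mkcond /= (bigD1 v) //= eqxx big1; first by case: (v \in e).
by move=> u /negbTE ->; case: ifP.
Qed.

End SymmetricDifference.

Section GaussBonnet.
Variables (V : finType) (K : {set {set V}}) (I : {set V}).
Implicit Types (A B T e : {set V}) (Z Y : {set {set V}}) (a b c u v w x : V).

Definition adj : rel V := fun u w => (u != w) && ([set u; w] \in K).
Definition nbrs w : {set V} := [set u | adj w u].

(** The interface between topology and combinatorics, with [I] standing for the interior vertices.
    [dl_star] is the field that certifies a vertex as interior. *)
Record disc_like : Prop := DiscLike {
  dl_neq0 : forall A, A \in K -> A != set0;
  dl_face : forall A B, A \in K -> B != set0 -> B \subset A -> B \in K;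
  dl_card : forall A, A \in K -> #|A| <= 3;
  dl_boundary : forall Y, Y \subset edges K -> (forall v, ~~ odd #|[set e in Y | v \in e]|) ->
    exists2 Z : {set {set V}}, Z \subset triangles K & bd Z = Y;
  dl_edge : forall e, e \in edges K -> #|[set T in triangles K | e \subset T]| <= 2;
  dl_star : forall Z w T0, Z \subset triangles K -> T0 \in Z -> w \in T0 ->
    (forall e, e \in bd Z -> w \notin e) ->
    w \in I /\ forall A, A \in K -> w \in A -> exists2 T, T \in Z & A \subset T;
  dl_interior : forall w e, w \in I -> e \in edges K -> w \in e ->
    2 <= #|[set T in triangles K | e \subset T]| }.

Hypothesis KD : disc_like.

Lemma adj_sym u w : adj u w = adj w u.
Proof. by rewrite /adj eq_sym setUC. Qed.

Lemma adj_edge u w : adj u w -> [set u; w] \in edges K.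
Proof. by move=> /andP[uw Kuw]; rewrite inE Kuw cards2 uw. Qed.

Lemma triangleP T : T \in triangles K -> T \in K /\ #|T| = 3.
Proof. by rewrite inE => /andP[? /eqP]. Qed.

Lemma triangle_adj T u w : T \in triangles K -> u \in T -> w \in T -> u != w -> adj u w.
Proof.
move=> /triangleP[KT _] uT wT uw; rewrite /adj uw; apply: (dl_face KD KT).
  by apply: (@set_neq0 _ u); rewrite !inE eqxx.
by rewrite setU2_sub uT.
Qed.

Definition tau Z w := #|[set T in Z | w \in T]|.

(* Double counting of the pairs (triangle at [w], edge of it at [w]). *)
Lemma sum_edge_triangles Z w : Z \subset triangles K ->
  \sum_(u in nbrs w) #|[set T in Z | [set w; u] \subset T]| = 2 * tau Z w.
Proof.
move=> /subsetP Zt.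
transitivity (\sum_(u in nbrs w) \sum_(T in Z) (([set w; u] \subset T) : nat)).
  apply: eq_bigr => u _; rewrite -sum1dep_card big_mkcondr /=.
  by apply: eq_bigr => T _; case: (_ \subset T).
rewrite exchange_big /= /tau -sum1dep_card big_distrr /= big_mkcondr /=.
apply: eq_bigr => T TZ; have Tt := Zt T TZ; have [KT T3] := triangleP Tt.
case: ifP => wT; last first.
  by rewrite big1 // => u _; rewrite setU2_sub wT.
rewrite -big_mkcondr /= sum1dep_card muln1.
rewrite (_ : [set u in _ | _] = T :\ w); first by have := cardsD1 w T; rewrite wT T3; lia.
apply/setP => u; rewrite !inE setU2_sub wT /= eq_sym; apply/andP/andP => -[h1 h2].
  by split=> //; case/andP: h1.
by split=> //; exact: triangle_adj Tt wT h2 h1.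
Qed.

Lemma tau_nbrs w : w \in I -> 2 * #|nbrs w| <= 2 * tau (triangles K) w.
Proof.
move=> wI; rewrite -sum_edge_triangles // mulnC -sum_nat_const.
apply: leq_sum => u; rewrite inE => wu.
by apply: (dl_interior KD wI (adj_edge wu)); rewrite !inE eqxx.
Qed.

Definition closure_edges Z : {set {set V}} :=
  [set e in edges K | [exists T in Z, e \subset T]].

Lemma bd_edges Z : Z \subset triangles K -> bd Z \subset closure_edges Z.
Proof.
move=> /subsetP Zt; apply/subsetP => e; rewrite !inE => /andP[e2 o].
have [T] : exists T, T \in [set T in Z | e \subset T].
  by apply/set0Pn; apply: contraTneq o => ->; rewrite cards0.
rewrite inE => /andP[TZ eT]; rewrite e2 andbT; apply/andP; split; last by apply/existsP; exists T; rewrite TZ.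
apply: (dl_face KD (triangleP (Zt _ TZ)).1 _ eT).
by rewrite -card_gt0 (eqP e2).
Qed.

Lemma card_star_le2 Z e : Z \subset triangles K -> e \in edges K -> #|[set T in Z | e \subset T]| <= 2.
Proof.
move=> /subsetP Zt eE; apply: leq_trans (dl_edge KD eE); apply: subset_leq_card.
by apply/subsetP => T; rewrite !inE => /andP[/Zt]; rewrite inE => ->.
Qed.

Definition minimal_cycle Y : Prop := forall Y', Y' \subset Y ->
  (forall v, ~~ odd #|[set e in Y' | v \in e]|) -> Y' = set0 \/ Y' = Y.

(** A filling of [Y] may leave [Z]. As an edge lies in at most two triangles, the part [B2] outside
    [Z] has its boundary inside [bd Z]. By minimality this boundary is empty or all of [bd Z]; in
    the second case [Z] can replace [B2]. *)
Lemma even_boundary_in Z Y : Z \subset triangles K -> minimal_cycle (bd Z) ->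
  Y \subset closure_edges Z -> (forall v, ~~ odd #|[set e in Y | v \in e]|) ->
  exists2 B : {set {set V}}, B \subset Z & bd B = Y.
Proof.
move=> Zt Zmin YZ Yev.
have YE : Y \subset edges K by apply: subset_trans YZ _; apply/subsetP => e; rewrite inE => /andP[].
have [B Bt BY] := dl_boundary KD YE Yev.
pose B1 := B :&: Z; pose B2 := B :\: Z.
have BE : B = symd B1 B2.
  by apply/setP => T; rewrite !inE; case: (T \in B); case: (T \in Z).
have B1Z : B1 \subset Z by apply: subsetIr.
have B2t : B2 \subset triangles K by apply: subset_trans Bt; apply: subsetDl.
have bdE : Y = symd (bd B1) (bd B2) by rewrite -BY {1}BE bd_symd.
have sub : bd B2 \subset bd Z.
  apply/subsetP => e eB2; have /subsetP/(_ e eB2) := bd_edges B2t.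
  rewrite inE => /andP[eE /existsP[T /andP[TB2 eT]]].
  have [TB TZ] : T \in B /\ T \notin Z by move: TB2; rewrite inE => /andP[].
  have eZ : e \in closure_edges Z.
    apply: contraTT eB2 => eZ.
    have h1 : e \notin Y by apply: contra eZ; exact: (subsetP YZ).
    have h2 : e \notin bd B1.
      apply: contra eZ => /(subsetP (bd_edges (subset_trans B1Z Zt))).
      rewrite !inE => /andP[-> /existsP[T' /andP[T'B1 eT']]] /=; apply/existsP; exists T'.
      by rewrite eT' andbT; apply: (subsetP B1Z).
    by move: h1; rewrite bdE inE (negbTE h2).
  move: eZ; rewrite inE => /andP[_ /existsP[T' /andP[T'Z eT']]].
  rewrite inE; have := eE; rewrite inE => /andP[_ ->] /=.
  suff -> : [set T0 in Z | e \subset T0] = [set T'] by rewrite cards1.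
  apply/setP => T''; rewrite !inE; apply/andP/eqP => [[T''Z eT'']|->]; last by [].
  apply/eqP; apply: contraT => T''T'.
  have := dl_edge KD eE; rewrite leqNgt => /negP[].
  have s : [set T; T'; T''] \subset [set T0 in triangles K | e \subset T0].
    by rewrite set3_sub !inE eT eT' eT'' !andbT; apply/and3P; split;
      [move: (subsetP Bt _ TB)|move: (subsetP Zt _ T'Z)|move: (subsetP Zt _ T''Z)]; rewrite !inE.
  apply: leq_trans (subset_leq_card s).
  have /eqP -> // : #|[set T; T'; T'']| == 3.
  apply/card3P; exists T, T', T''; split=> //; last by rewrite eq_sym.
  - by apply: contraNneq TZ => ->.
  - by apply: contraNneq TZ => ->.
have ev2 v : ~~ odd #|[set e in bd B2 | v \in e]|.
  by apply: odd_bd_star => T /(subsetP B2t)/triangleP[].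
have [E|E] := Zmin _ sub ev2.
  by exists B1 => //; rewrite bdE E; apply/setP => e; rewrite !inE addbF.
exists (symd B1 Z); last by rewrite bd_symd bdE E.
by apply/subsetP => T; rewrite !inE; case: (T \in Z); rewrite ?andbF.
Qed.

(** An edge set is determined by its odd vertices other than a base [v1], together with a chain of
    [Z] bounding its difference with a chosen set that has the same odd vertices. Hence 2^E is at
    most 2^(V - 1 + F). *)
Lemma euler_bound Z : Z \subset triangles K -> Z != set0 -> minimal_cycle (bd Z) ->
  #|closure_edges Z| < #|cover Z| + #|Z|.
Proof.
move=> Zt Z0 Zmin; have [T0 T0Z] := set0Pn _ Z0.
have [v1 v1T0] := set0Pn _ (dl_neq0 KD (triangleP (subsetP Zt _ T0Z)).1).
have v1Z : v1 \in cover Z by apply/bigcupP; exists T0.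
pose E := closure_edges Z; pose dv Y := [set v | odd #|[set e in Y | v \in e]|] :\ v1.
pose rep (U : {set V}) : {set {set V}} := odflt set0 [pick Y : {set {set V}} | (Y \subset E) && (dv Y == U)].
pose fill (Y : {set {set V}}) : {set {set V}} := odflt set0 [pick B : {set {set V}} | (B \subset Z) && (bd B == symd Y (rep (dv Y)))].
have repP Y : Y \subset E -> rep (dv Y) \subset E /\ dv (rep (dv Y)) = dv Y.
  move=> YE; rewrite /rep; case: pickP => [Y' /andP[? /eqP]|/(_ Y)] //=.
  by rewrite YE eqxx.
have dvev Y Y' : Y \subset E -> Y' \subset E -> dv Y = dv Y' -> forall v, ~~ odd #|[set e in symd Y Y' | v \in e]|.
  move=> YE YE' h; have hv v : v != v1 -> ~~ odd #|[set e in symd Y Y' | v \in e]|.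
    by move=> vv1; move/setP/(_ v): h; rewrite odd_symd !inE vv1 /= => ->; rewrite addbb.
  (* At [v1] the parity is forced by the handshake lemma. *)
  move=> v; have [->|] := eqVneq v v1; last exact: hv.
  pose S := symd Y Y'.
  have SE e : e \in S -> #|e| = 2.
    move=> eS; have : e \in E.
      by move: eS; rewrite inE; case eY: (e \in Y); [move=> _; exact: (subsetP YE)|move=> /= ?; exact: (subsetP YE')].
    by rewrite !inE => /andP[/andP[_ /eqP]].
  have : \big[addb/false]_v odd #|[set e in S | v \in e]| = false.
    rewrite (eq_bigr (fun v => \big[addb/false]_e ((e \in S) && (v \in e)))) => [|u _]; last by rewrite odd_bigaddb.
    rewrite exchange_big big1 //= => e _; case eS: (e \in S) => /=; last by rewrite big1.
    by rewrite -odd_bigaddb (_ : [set _ | _] = e) ?SE //; apply/setP => u; rewrite inE.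
  rewrite (bigD1 v1) //= big1 ?addbF => [->//|u uv1]; exact/negbTE/hv.
have fillP Y : Y \subset E -> fill Y \subset Z /\ bd (fill Y) = symd Y (rep (dv Y)).
  move=> YE; rewrite /fill; case: pickP => [B /andP[? /eqP]|] //= nB; exfalso.
  have [rE rd] := repP Y YE.
  have [||B BZ bB] := @even_boundary_in Z (symd Y (rep (dv Y))) Zt Zmin.
  - apply/subsetP => e; rewrite inE; case eY: (e \in Y); first by move=> _; exact: (subsetP YE).
    by move=> /= ?; exact: (subsetP rE).
  - exact: dvev.
  by have := nB B; rewrite BZ bB eqxx.
have inj : {in powerset E &, injective (fun Y => (dv Y, fill Y))}.
  move=> Y Y'; rewrite !inE => YE YE' [h1 h2].
  have [_ f1] := fillP Y YE; have [_ f2] := fillP Y' YE'.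
  by rewrite -[Y](symdK _ (rep (dv Y))) -f1 h2 f2 h1 symdK.
have sub : (fun Y => (dv Y, fill Y)) @: powerset E \subset setX (powerset (cover Z :\ v1)) (powerset Z).
  apply/subsetP => _ /imsetP[Y YE ->]; rewrite inE in YE; rewrite !inE /= (fillP Y YE).1 andbT.
  apply/subsetP => v; rewrite !inE => /andP[-> o] /=.
  have [e] : exists e, e \in [set e in Y | v \in e].
    by apply/set0Pn; apply: contraTneq o => ->; rewrite cards0.
  rewrite inE => /andP[/(subsetP YE)]; rewrite inE => /andP[_ /existsP[T /andP[TZ eT]]] ve.
  by apply/bigcupP; exists T => //; exact: (subsetP eT).
have := subset_leq_card sub; rewrite card_in_imset // cardsX !card_powerset -expnD leq_exp2l //.
have := cardsD1 v1 (cover Z); rewrite v1Z; rewrite /E; lia.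
Qed.

(* Discrete Gauss-Bonnet: interior vertices have non-positive curvature [6 - tau]. *)
Theorem gauss_bonnet Z : (forall w, w \in I -> 6 <= #|nbrs w|) ->
  Z \subset triangles K -> Z != set0 -> minimal_cycle (bd Z) ->
  6 + 3 * #|bd Z| + \sum_(w in cover (bd Z)) tau Z w <= 6 * #|cover (bd Z)|.
Proof.
move=> deg6 Zt Z0 Zmin; have eul := euler_bound Zt Z0 Zmin.
have Z3 T : T \in Z -> #|T| = 3 by move=> /(subsetP Zt)/triangleP[].
have bdE := subsetP (bd_edges Zt).
have ctau : \sum_(w in cover Z) tau Z w = 3 * #|Z|.
  transitivity (\sum_(w in cover Z) \sum_(T in Z) ((w \in T) : nat)).
    by apply: eq_bigr => w _; rewrite /tau -sum1dep_card big_mkcondr /=; apply: eq_bigr => T _; case: (w \in T).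
  rewrite exchange_big /= mulnC -sum_nat_const; apply: eq_bigr => T TZ.
  rewrite -big_mkcondr /= sum1dep_card -(Z3 T TZ); apply: eq_card => w.
  by rewrite inE; apply: andb_idl => wT; apply/bigcupP; exists T.
have cedge : 3 * #|Z| + #|bd Z| = 2 * #|closure_edges Z|.
  have -> : 3 * #|Z| = \sum_(e in closure_edges Z) #|[set T in Z | e \subset T]|.
    rewrite mulnC -sum_nat_const.
    transitivity (\sum_(e in closure_edges Z) \sum_(T in Z) ((e \subset T) : nat)); last first.
      by apply: eq_bigr => e _; rewrite -sum1dep_card big_mkcondr /=; apply: eq_bigr => T _; case: (e \subset T).
    rewrite exchange_big /=; apply: eq_bigr => T TZ.
    rewrite -big_mkcondr /= sum1dep_card.
    have -> : [set e in closure_edges Z | e \subset T] = [set A : {set V} | (A \subset T) & (#|A| == 2)].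
      apply/setP => e; rewrite !inE; apply/andP/andP => [[/andP[/andP[_ ->] _] ->]//|[eT e2]].
      rewrite eT e2 andbT; split=> //; apply/andP; split; last by apply/existsP; exists T; rewrite TZ.
      by apply: (dl_face KD (triangleP (subsetP Zt _ TZ)).1 _ eT); rewrite -card_gt0 (eqP e2).
    by rewrite cards_draws (Z3 T TZ).
  have -> : #|bd Z| = \sum_(e in closure_edges Z) ((e \in bd Z) : nat).
    rewrite -sum1_card -big_mkcondr /=; apply: eq_bigl => e.
    by apply/idP/andP => [eb|[]//]; split=> //; exact: bdE.
  rewrite -big_split /= mulnC -sum_nat_const; apply: eq_bigr => e.
  rewrite inE => /andP[eE /existsP[T /andP[TZ eT]]].
  have := card_star_le2 Zt eE; have : 0 < #|[set T in Z | e \subset T]|.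
    by apply/card_gt0P; exists T; rewrite inE TZ.
  rewrite [e \in bd Z]inE; have -> : #|e| == 2 by move: eE; rewrite inE => /andP[].
  by case: #|[set T in Z | e \subset T]| => [|[|[]]].
have sub : cover (bd Z) \subset cover Z.
  apply/subsetP => w /bigcupP[e /bdE]; rewrite inE => /andP[_ /existsP[T /andP[TZ eT]]] we.
  by apply/bigcupP; exists T => //; exact: (subsetP eT).
(* Off the boundary the whole star lies in [Z], so [tau Z] counts all triangles at the vertex. *)
have int : 6 * #|cover Z :\: cover (bd Z)| <= \sum_(w in cover Z :\: cover (bd Z)) tau Z w.
  rewrite mulnC -sum_nat_const; apply: leq_sum => w; rewrite inE => /andP[wb /bigcupP[T TZ wT]].
  have [|wI cov] := dl_star KD Zt TZ wT.
    by move=> e eb; apply: contra wb => we; apply/bigcupP; exists e.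
  have tE : tau Z w = tau (triangles K) w.
    apply: eq_card => T'; rewrite !inE; case wT' : (w \in T'); rewrite ?andbF // !andbT.
    apply/idP/idP => [/(subsetP Zt)|]; first by rewrite inE.
    move=> /andP[KT' /eqP T'3]; have [T'' T''Z s] := cov T' KT' wT'.
    by have /eqP -> : T' == T'' by rewrite eqEcard s T'3 Z3.
  by rewrite tE; have := deg6 w wI; have := tau_nbrs wI; lia.
have split_sum : \sum_(w in cover Z) tau Z w =
    \sum_(w in cover (bd Z)) tau Z w + \sum_(w in cover Z :\: cover (bd Z)) tau Z w.
  rewrite (bigID (fun w => w \in cover (bd Z))) /=; congr (_ + _); apply: eq_bigl => w.
    by rewrite andb_idl //; exact: (subsetP sub).
  by rewrite inE andbC.
have := cardsD (cover Z) (cover (bd Z)); rewrite (setIidPr sub).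
have := subset_leq_card sub.
move: int; rewrite split_sum in ctau; lia.
Qed.

End GaussBonnet.

(** * Simple cycles *)

Section Cycles.
Variables (V : finType) (n : nat) (g : 'I_n -> V).
Hypotheses (n3 : 3 <= n) (ginj : injective g).
Implicit Types (e : {set V}) (Y : {set {set V}}) (i j : 'I_n).

Definition cedge i : {set V} := [set g i; g (ordS i)].
Definition cycle_edges : {set {set V}} := [set cedge i | i : 'I_n].

Lemma ordS_neq i : ordS i != i.
Proof.
apply/eqP => /(congr1 val) /=; case: (ltngtP i.+1 n) (ltn_ord i) => // h _.
  by rewrite modn_small //; lia.
by rewrite h modnn; lia.
Qed.

Lemma ordSS_neq i : ordS (ordS i) != i.
Proof.
apply/eqP => /(congr1 val) /=; case: (ltngtP i.+1 n) (ltn_ord i) => // h _.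
  rewrite (modn_small h); case: (ltngtP i.+2 n) h => // h _; first by rewrite modn_small //; lia.
  by rewrite h modnn; lia.
by rewrite h modnn modn_small; lia.
Qed.

Lemma mem_cedge i j : (g j \in cedge i) = (i == j) || (ordS i == j).
Proof. by rewrite !inE !(inj_eq ginj) eq_sym [j == _]eq_sym. Qed.

Lemma cedge_inj : injective cedge.
Proof.
move=> i j E; have : g i \in cedge j by rewrite -E mem_cedge eqxx.
rewrite mem_cedge => /orP[/eqP //|/eqP ji].
have : g (ordS i) \in cedge j by rewrite -E mem_cedge eqxx orbT.
rewrite mem_cedge => /orP[/eqP h|/eqP h].
  by have := ordSS_neq j; rewrite ji -h eqxx.
by have := ordS_neq i; rewrite -h ji eqxx.
Qed.

Lemma card_cycle_edges : #|cycle_edges| = n.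
Proof. by rewrite card_imset ?card_ord //; exact: cedge_inj. Qed.

Lemma cover_cycle_edges : cover cycle_edges = [set g i | i : 'I_n].
Proof.
apply/setP => v; apply/bigcupP/imsetP => [[e /imsetP[i _ ->]]|[i _ ->]].
  by rewrite !inE => /orP[] /eqP ->; [exists i|exists (ordS i)].
by exists (cedge i); rewrite ?imset_f // mem_cedge eqxx.
Qed.

Lemma cycle_star Y i : Y \subset cycle_edges ->
  odd #|[set e in Y | g (ordS i) \in e]| = (cedge i \in Y) (+) (cedge (ordS i) \in Y).
Proof.
move=> /subsetP YC; rewrite odd_bigaddb (bigD1 (cedge i)) //= (bigD1 (cedge (ordS i))) /=; last first.
  by apply: contraTneq isT => /cedge_inj/eqP; rewrite (negbTE (ordS_neq i)).
rewrite !mem_cedge !eqxx orbT /= !andbT big1 ?addbF // => e /andP[e1 e2].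
apply/negbTE/negP => /andP[/YC/imsetP[j _ ej]]; rewrite ej mem_cedge => /orP[/eqP jE|/eqP jE].
  by move: e2; rewrite ej jE eqxx.
by move: e1; rewrite ej (can_inj (@ordSK n) jE) eqxx.
Qed.

Lemma even_cycle_edges v : ~~ odd #|[set e in cycle_edges | v \in e]|.
Proof.
have [/imsetP[i _ ->]|vC] := boolP (v \in [set g i | i : 'I_n]).
  by rewrite -(ord_predK i) cycle_star // !imset_f.
rewrite (_ : [set _ in _ | _] = set0) ?cards0 //; apply/setP => e; rewrite !inE.
apply: contraNF vC => /andP[eC ve]; rewrite -cover_cycle_edges.
by apply/bigcupP; exists e.
Qed.

(** An even part contains both or neither of two consecutive edges of the cycle. *)
Lemma minimal_cycle_edges : minimal_cycle cycle_edges.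
Proof.
move=> Y YC Yev.
have step i : (cedge i \in Y) = (cedge (ordS i) \in Y).
  by have := Yev (g (ordS i)); rewrite cycle_star //; case: (_ \in Y); case: (_ \in Y).
have n0 : 0 < n by lia.
have all0 k (kn : k < n) : (cedge (Ordinal kn) \in Y) = (cedge (Ordinal n0) \in Y).
  elim: k kn => [|k IH] kn; first by congr (cedge _ \in Y); exact: val_inj.
  rewrite -(IH (ltnW kn)) [RHS]step; congr (cedge _ \in Y); apply: val_inj => /=.
  by rewrite modn_small.
have [h|h] := boolP (cedge (Ordinal n0) \in Y); [right|left].
  apply/eqP; rewrite eqEsubset YC; apply/subsetP => _ /imsetP[[k kn] _ ->].
  by rewrite all0.
apply/setP => e; rewrite inE; apply: contraNF h => eY.
have /imsetP[[k kn] _ ek] := subsetP YC _ eY.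
by rewrite -(all0 k kn) -ek.
Qed.

End Cycles.

Section CycleCurvature.
Variables (V : finType) (K : {set {set V}}) (I : {set V}).
Hypothesis KD : disc_like K I.
Hypothesis deg6 : forall w, w \in I -> 6 <= #|nbrs K w|.
Implicit Types (A B T e : {set V}) (Z Y : {set {set V}}) (a b c u v w x : V).

(** With equilateral triangles, the turning at a vertex of the cycle is 3 - [tau] in units of pi /
    3; the bound says that the total turning is at least a full turn. *)
Lemma cycle_gauss_bonnet n (g : 'I_n -> V) Z : 3 <= n -> injective g ->
  Z \subset triangles K -> bd Z = cycle_edges g -> 6 + \sum_i tau Z (g i) <= 3 * n.
Proof.
move=> n3 ginj Zt bZ.
have Z0 : Z != set0.
  apply: contraTneq (isT : true) => Z0; have := card_cycle_edges n3 ginj; rewrite -bZ Z0.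
  rewrite (_ : bd set0 = set0) ?cards0; first by lia.
  apply/setP => e; rewrite !inE (_ : [set _ in _ | _] = set0) ?cards0 ?andbF //.
  by apply/setP => T; rewrite !inE.
have Zmin : minimal_cycle (bd Z) by rewrite bZ; exact: minimal_cycle_edges.
have := gauss_bonnet KD deg6 Zt Z0 Zmin; rewrite bZ (card_cycle_edges n3 ginj).
rewrite (cover_cycle_edges ginj) (card_imset _ ginj) card_ord big_imset /=; last by move=> i j _ _; exact: ginj.
by rewrite (eq_bigl predT) //; lia.
Qed.

Lemma bd_triangle Z e : e \in bd Z -> exists2 T, T \in Z & e \subset T.
Proof.
rewrite inE => /andP[_ o]; have [T] : exists T, T \in [set T in Z | e \subset T].
  by apply/set0Pn; apply: contraTneq o => ->; rewrite cards0.
by rewrite inE => /andP[]; exists T.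
Qed.

Lemma tau_gt0 Z e w : e \in bd Z -> w \in e -> 0 < tau Z w.
Proof.
move=> /bd_triangle[T TZ eT] we; apply/card_gt0P; exists T.
by rewrite inE TZ (subsetP eT).
Qed.

Lemma tau1 Z w a b : Z \subset triangles K -> tau Z w = 1 -> [set w; a] \in bd Z -> [set w; b] \in bd Z ->
  w != a -> w != b -> a != b -> [set w; a; b] \in K.
Proof.
move=> Zt /eqP/cards1P[T0 E] /bd_triangle[T TZ sT] /bd_triangle[T' T'Z sT'] wa wb ab.
have : T \in [set T0] by rewrite -E inE TZ (subsetP sT) // !inE eqxx.
have : T' \in [set T0] by rewrite -E inE T'Z (subsetP sT') // !inE eqxx.
rewrite !inE => /eqP T'E /eqP TE; rewrite T'E in sT' T'Z; rewrite TE in sT.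
have [KT T3] := triangleP (subsetP Zt _ T'Z).
rewrite (_ : [set w; a; b] = T0) //; apply/eqP; rewrite eqEcard T3.
have /eqP -> : #|[set w; a; b]| == 3 by apply/card3P; exists w, a, b.
by move: sT sT'; rewrite set3_sub !setU2_sub => /andP[-> ->] /andP[_ ->].
Qed.

(** The two triangles have four edge incidences at [w]. An edge met once is a boundary edge, hence
    one of the two given ones; the other two incidences must be the same edge. *)
Lemma tau2 Z w a b : Z \subset triangles K -> tau Z w = 2 -> [set w; a] \in bd Z -> [set w; b] \in bd Z ->
  (forall e, e \in bd Z -> w \in e -> e = [set w; a] \/ e = [set w; b]) ->
  w != a -> w != b -> a != b ->
  exists x, [/\ x != w, x != a, x != b, [set w; a; x] \in Z & [set w; b; x] \in Z].
Proof.
move=> Zt t2 ea eb only wa wb ab.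
have [T1 T1Z s1] := bd_triangle ea.
have [aT1 wT1] : a \in T1 /\ w \in T1 by split; apply: (subsetP s1); rewrite !inE eqxx ?orbT.
have [_ T13] := triangleP (subsetP Zt _ T1Z).
have [x T1E] : exists x, [/\ x != w, x != a & T1 = [set w; a; x]].
  have : 0 < #|T1 :\: [set w; a]| by rewrite cardsD (setIidPr s1) T13 cards2 wa.
  move=> /card_gt0P[x]; rewrite !inE negb_or => /andP[/andP[xw xa] xT1]; exists x; split=> //.
  apply/esym/eqP; rewrite eqEcard T13 set3_sub wT1 aT1 xT1 /=.
  have /eqP -> // : #|[set w; a; x]| == 3 by apply/card3P; exists w, a, x; split=> //; rewrite eq_sym.
move: T1E => [xw xa T1E].
have TE (f : {set V}) T T' : T \in Z -> T' \in Z -> T != T' -> w \in f -> f \subset T -> f \subset T' -> #|f| = 2 ->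
    f \notin bd Z.
  move=> TZ T'Z TT' wf fT fT' f2; rewrite inE f2 eqxx /=.
  rewrite (_ : [set T0 in Z | f \subset T0] = [set T; T']) ?cards2 ?TT' //.
  apply/esym/eqP; rewrite eqEcard subUset !sub1set !inE TZ T'Z fT fT' /=.
  apply: leq_trans (subset_leq_card (_ : _ \subset [set T0 in Z | w \in T0])) _.
    by apply/subsetP => T0; rewrite !inE => /andP[-> /subsetP ->].
  by rewrite cards2 TT' -/(tau Z w) t2.
have T1s : T1 \in [set T in Z | w \in T] by rewrite inE T1Z.
have /cards1P[T2 T2E] : #|[set T in Z | w \in T] :\ T1| == 1.
  by have := cardsD1 T1 [set T in Z | w \in T]; rewrite T1s -/(tau Z w) t2 => /eqP; rewrite eqSS eq_sym.
have : T2 \in [set T in Z | w \in T] :\ T1 by rewrite T2E inE.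
rewrite !inE => /and3P[T21 T2Z wT2]; rewrite eq_sym in T21.
have T2only T : T \in Z -> w \in T -> T = T1 \/ T = T2.
  move=> TZ wT; have [->|TT1] := eqVneq T T1; [by left | right].
  by apply/eqP; rewrite -in_set1 -T2E !inE TT1 TZ.
have [_ T23] := triangleP (subsetP Zt _ T2Z).
have aT2 : a \notin T2.
  apply/negP => aT2; have : [set w; a] \notin bd Z; last by rewrite ea.
  by apply: (TE _ T1 T2) => //; rewrite ?setU2_sub ?wT1 ?wT2 ?aT1 ?aT2 ?cards2 ?wa // !inE eqxx.
have xT2 : x \in T2.
  have wxT1 : [set w; x] \subset T1 by rewrite setU2_sub T1E !inE !eqxx !orbT.
  apply: contraT => xT2; have : [set w; x] \in bd Z.
    rewrite inE cards2 [w == x]eq_sym xw /= (_ : [set T in Z | _] = [set T1]) ?cards1 //.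
    apply/setP => T; rewrite !inE; apply/andP/eqP => [[TZ sT]|->]; last by rewrite wxT1.
    have [|//|TT2] := T2only T TZ; first by move: sT; rewrite setU2_sub => /andP[].
    by move: sT xT2; rewrite TT2 setU2_sub => /andP[_ ->].
  move=> wxb; have [|E|E] := only _ wxb; first by rewrite !inE eqxx.
    have : a \in [set w; x] by rewrite E !inE eqxx orbT.
    by rewrite !inE [a == w]eq_sym (negbTE wa) [a == x]eq_sym (negbTE xa).
  have xb : x = b.
    have : x \in [set w; b] by rewrite -E !inE eqxx orbT.
    by rewrite !inE (negbTE xw) => /eqP.
  have [y yT2 yw] : exists2 y, y \in T2 & y != w.
    have : 0 < #|T2 :\ w| by have := cardsD1 w T2; rewrite wT2 T23 add1n => -[<-].
    by move=> /card_gt0P[y]; rewrite !inE => /andP[]; exists y.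
  have wyb : [set w; y] \in bd Z.
    rewrite inE cards2 [w == y]eq_sym yw /= (_ : [set T in Z | _] = [set T2]) ?cards1 //.
    apply/setP => T; rewrite !inE; apply/andP/eqP => [[TZ sT]|->]; last by rewrite setU2_sub wT2.
    have [|TT1|//] := T2only T TZ; first by move: sT; rewrite setU2_sub => /andP[].
    move: sT; rewrite TT1 setU2_sub T1E !inE (negbTE yw) /= => /andP[_ /orP[/eqP ya|/eqP yx]].
      by move: aT2; rewrite -ya yT2.
    by move: xT2; rewrite -yx yT2.
  have [|E'|E'] := only _ wyb; first by rewrite !inE eqxx.
    have : y \in [set w; a] by rewrite -E' !inE eqxx orbT.
    by rewrite !inE (negbTE yw) => /eqP ya; move: aT2; rewrite -ya yT2.
  have : y \in [set w; b] by rewrite -E' !inE eqxx orbT.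
  by rewrite !inE (negbTE yw) -xb => /eqP yx; move: xT2; rewrite -yx yT2.
have xb : x != b.
  apply/negP => /eqP xb; have : [set w; b] \notin bd Z; last by rewrite eb.
  apply: (TE _ T1 T2) => //; rewrite ?cards2 ?wb ?setU2_sub -?xb ?wT1 ?wT2 ?xT2 ?T1E // !inE ?eqxx ?orbT //.
have bT2 : b \in T2.
  have [T TZ sT] := bd_triangle eb; move: sT; rewrite setU2_sub => /andP[wT bT].
  have [TT|<-//] := T2only T TZ wT; move: bT; rewrite TT T1E !inE.
  by rewrite [b == w]eq_sym (negbTE wb) [b == a]eq_sym (negbTE ab) [b == x]eq_sym (negbTE xb).
exists x; split=> //; first by rewrite -T1E.
rewrite (_ : [set w; b; x] = T2) //; apply/eqP; rewrite eqEcard T23 set3_sub wT2 bT2 xT2 /=.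
have /eqP -> // : #|[set w; b; x]| == 3 by apply/card3P; exists w, b, x; split=> //; rewrite eq_sym.
Qed.

End CycleCurvature.

Lemma big_addb_unique (J : finType) (P : pred J) :
  (forall i j, P i -> P j -> i = j) -> \big[addb/false]_i P i = [exists i, P i].
Proof.
move=> uP; have [/existsP[i Pi]|/existsPn nP] := boolP [exists i, P i].
  rewrite (bigD1 i) //= Pi big1 // => j ji; apply/negbTE/negP => Pj.
  by move: ji; rewrite (uP _ _ Pj Pi) eqxx.
by rewrite big1 // => i _; exact/negbTE/nP.
Qed.

(** * Regions between two descending paths *)

Section Digons.
Variables (V : finType) (K : {set {set V}}) (I : {set V}) (lev : V -> nat).
Hypothesis KD : disc_like K I.
Hypothesis deg6 : forall w, w \in I -> 6 <= #|nbrs K w|.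
Implicit Types (A B T e : {set V}) (Z Y : {set {set V}}) (a b c u v w x : V) (f g : nat -> V).

(** On a 3-cycle Gauss-Bonnet bounds the sum of the three [tau] by 3, so that each corner has
    exactly one triangle. *)
Lemma triangle_of_adj a b c : adj K a b -> adj K b c -> adj K a c -> [set a; b; c] \in K.
Proof.
move=> ab bc ac; pose g (i : 'I_3) := nth a [:: a; b; c] i.
have ginj : injective g.
  have := andP ab; have := andP bc; have := andP ac => -[ac' _] [bc' _] [ab' _].
  have un : uniq [:: a; b; c] by rewrite /= !inE negb_or ab' ac' bc'.
  by move=> i j /eqP; rewrite (nth_uniq a) // => /eqP/val_inj.
have edg i : cedge g i \in edges K.
  rewrite /cedge /g; case: i => [[|[|[|]]]] //= _; try exact: adj_edge.
  by rewrite setUC; exact: adj_edge.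
have [||Z Zt bZ] := @dl_boundary _ _ _ KD (cycle_edges g).
- by apply/subsetP => _ /imsetP[i _ ->].
- by move=> v; apply: even_cycle_edges.
have := cycle_gauss_bonnet KD deg6 (isT : 3 <= 3) ginj Zt bZ.
have t0 i : 0 < tau Z (g i).
  apply: (@tau_gt0 _ Z (cedge g i)); first by rewrite bZ imset_f.
  by rewrite !inE eqxx.
rewrite !big_ord_recl big_ord0 addn0 => h.
have ta : tau Z a = 1.
  have := t0 ord0; have := t0 (lift ord0 ord0); have := t0 (lift ord0 (lift ord0 ord0)).
  by move: h; rewrite [g ord0]/(g _) /=; lia.
have e1 : [set a; b] \in bd Z by rewrite bZ; apply/imsetP; exists ord0.
have e2 : [set a; c] \in bd Z.
  by rewrite bZ; apply/imsetP; exists (@Ordinal 3 2 isT) => //; rewrite /cedge setUC.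
by apply: tau1 Zt ta e1 e2 _ _ _; [case/andP: ab|case/andP: ac|case/andP: bc].
Qed.

(** The region is closed at the top by a common vertex or by an edge, which serves respectively two
    parents of one vertex and two adjacent vertices of one level. Only the values of [f] and [g] up
    to [m] matter. *)
Record digon m f g : Prop := Digon {
  dg_m : 2 <= m;
  dg_f : forall i, i < m -> adj K (f i) (f i.+1) /\ lev (f i) = (lev (f i.+1)).+1;
  dg_g : forall i, i < m -> adj K (g i) (g i.+1) /\ lev (g i) = (lev (g i.+1)).+1;
  dg_end : f m = g m;
  dg_neq : forall i, 0 < i -> i < m -> f i != g i;
  dg_top : f 0 != g 0 -> adj K (f 0) (g 0) }.

Lemma digon_sym m f g : digon m f g -> digon m g f.
Proof.
case=> h1 h2 h3 h4 h5 h6; split=> // [i i0 im|]; first by rewrite eq_sym h5.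
by rewrite eq_sym adj_sym.
Qed.

(** Multiplicities mod 2, because in this form replacing one vertex of a side adds four terms and
    matches the boundary of two triangles. *)
Definition dsum m f g e : bool :=
  \big[addb/false]_(i < m) (e == [set f i; f i.+1]) (+)
  \big[addb/false]_(i < m) (e == [set g i; g i.+1]) (+)
  ((f 0 != g 0) && (e == [set f 0; g 0])).

Definition digon_edges m f g : {set {set V}} := [set e | dsum m f g e].

Lemma digon_edges_sym m f g : digon_edges m f g = digon_edges m g f.
Proof.
apply/setP => e; rewrite !inE /dsum (eq_sym (g 0)) [[set g 0; f 0]]setUC.
by congr (_ (+) _); exact: addbC.
Qed.

Lemma digon_lev m f g i : digon m f g -> i <= m -> lev (f i) = lev (f m) + (m - i).
Proof.
move=> dg im; have [j jE] : exists j, j = m - i by exists (m - i).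
elim: j i im jE => [|j IH] i im jE; first by rewrite -jE addn0 (_ : i = m) //; lia.
have im' : i < m by lia.
by rewrite (dg_f dg im').2 (IH i.+1) //; lia.
Qed.

Lemma digon_lev2 m f g i : digon m f g -> i <= m -> lev (g i) = lev (f m) + (m - i).
Proof. by move=> dg im; rewrite (digon_lev (digon_sym dg) im) (dg_end dg). Qed.

Lemma digon_f_inj m f g i j : digon m f g -> i <= m -> j <= m -> f i = f j -> i = j.
Proof.
by move=> dg im jm /(congr1 lev); rewrite (digon_lev dg im) (digon_lev dg jm); lia.
Qed.

Lemma digon_fg m f g i j : digon m f g -> i <= m -> j <= m -> f i = g j ->
  i = j /\ (i = 0 \/ i = m).
Proof.
move=> dg im jm E; have ij : i = j.
  by move/(congr1 lev): E; rewrite (digon_lev dg im) (digon_lev2 dg jm); lia.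
split=> //; have [i0|i0] := posnP i; first by left.
have [im'|] := ltnP i m; last by right; lia.
by have := dg_neq dg i0 im'; rewrite E ij eqxx.
Qed.

Lemma lev_edge_inj u u' w w' : lev u = (lev u').+1 -> lev w = (lev w').+1 ->
  [set u; u'] = [set w; w'] -> u = w /\ u' = w'.
Proof.
move=> hu hw E.
have : u \in [set w; w'] by rewrite -E !inE eqxx.
have : u' \in [set w; w'] by rewrite -E !inE eqxx orbT.
have : w \in [set u; u'] by rewrite E !inE eqxx.
rewrite !inE => /orP[] /eqP E1 /orP[] /eqP E2 /orP[] /eqP E3; subst; split=> //; lia.
Qed.

Lemma digon_edgesP m f g e : digon m f g ->
  reflect [\/ exists2 i, i < m & e = [set f i; f i.+1],
              exists2 i, i < m & e = [set g i; g i.+1] |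
              f 0 != g 0 /\ e = [set f 0; g 0]] (e \in digon_edges m f g).
Proof.
move=> dg; rewrite inE /dsum !big_addb_unique; first last.
- move=> i j /eqP -> /eqP h; apply: val_inj.
  have [h1 _] := lev_edge_inj (dg_f dg (ltn_ord i)).2 (dg_f dg (ltn_ord j)).2 h.
  by apply: (digon_f_inj dg) h1; exact: ltnW.
- move=> i j /eqP -> /eqP h; apply: val_inj.
  have [h1 _] := lev_edge_inj (dg_g dg (ltn_ord i)).2 (dg_g dg (ltn_ord j)).2 h.
  by apply: (digon_f_inj (digon_sym dg)) h1; exact: ltnW.
have m2 := dg_m dg.
have top : lev (f 0) = lev (g 0) by rewrite (digon_lev dg (leq0n m)) (digon_lev2 dg (leq0n m)).
have toplev u u' w w' : lev u = (lev u').+1 -> lev w = lev w' -> [set u; u'] != [set w; w'].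
  move=> h1 h2; apply/eqP => E.
  have : u \in [set w; w'] by rewrite -E !inE eqxx.
  have : u' \in [set w; w'] by rewrite -E !inE eqxx orbT.
  by rewrite !inE => /orP[] /eqP E1 /orP[] /eqP E2; subst; lia.
have x1 : ~~ ([exists i : 'I_m, e == [set f i; f i.+1]] && [exists i : 'I_m, e == [set g i; g i.+1]]).
  apply/negP => /andP[/existsP[i /eqP ei] /existsP[j /eqP ej]]; rewrite ei in ej.
  have [h1 h2] := lev_edge_inj (dg_f dg (ltn_ord i)).2 (dg_g dg (ltn_ord j)).2 ej.
  have := digon_fg dg (ltnW (ltn_ord i)) (ltnW (ltn_ord j)) h1.
  by have := digon_fg dg (ltn_ord i) (ltn_ord j) h2; have := ltn_ord i; lia.
have x2 : ~~ ([exists i : 'I_m, e == [set f i; f i.+1]] && ((f 0 != g 0) && (e == [set f 0; g 0]))).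
  apply/negP => /andP[/existsP[i /eqP ->]] /andP[_].
  by rewrite (negbTE (toplev _ _ _ _ (dg_f dg (ltn_ord i)).2 top)).
have x3 : ~~ ([exists i : 'I_m, e == [set g i; g i.+1]] && ((f 0 != g 0) && (e == [set f 0; g 0]))).
  apply/negP => /andP[/existsP[i /eqP ->]] /andP[_].
  by rewrite (negbTE (toplev _ _ _ _ (dg_g dg (ltn_ord i)).2 top)).
have -> : [exists i : 'I_m, e == [set f i; f i.+1]] (+) [exists i : 'I_m, e == [set g i; g i.+1]] (+)
    ((f 0 != g 0) && (e == [set f 0; g 0])) = [|| [exists i : 'I_m, e == [set f i; f i.+1]],
    [exists i : 'I_m, e == [set g i; g i.+1]] | (f 0 != g 0) && (e == [set f 0; g 0])].
  by move: x1 x2 x3; case: [exists _, _]; case: [exists _, _]; case: (f 0 != g 0); case: (e == [set f 0; g 0]).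
apply: (iffP idP) => [/or3P[]|[]].
- by move=> /existsP[i /eqP ei]; apply: Or31; exists i.
- by move=> /existsP[i /eqP ei]; apply: Or32; exists i.
- by move=> /andP[h /eqP ei]; exact: Or33.
- by move=> [i im ei]; apply/or3P/Or31/existsP; exists (Ordinal im); apply/eqP.
- by move=> [i im ei]; apply/or3P/Or32/existsP; exists (Ordinal im); apply/eqP.
- by move=> [h ->]; apply/or3P/Or33; rewrite h eqxx.
Qed.

(* The boundary walk: down along [f], then up along [g]. *)
Definition walk_fun m f g (k : nat) : V :=
  if k <= m then f k else if k <= m.*2 then g (m.*2 - k) else f 0.

Definition digon_size m f g := m.*2 + (f 0 != g 0).

Definition digon_cycle m f g (i : 'I_(digon_size m f g)) : V := walk_fun m f g i.

Lemma digon_cycleS m f g i : digon m f g ->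
  @digon_cycle m f g (ordS i) = walk_fun m f g i.+1.
Proof.
move=> dg; have m2 := dg_m dg; rewrite /digon_cycle /=; case: i => i /= h.
have [h1|h1] := ltnP i.+1 (digon_size m f g); first by rewrite modn_small.
have -> : i.+1 = digon_size m f g by lia.
rewrite modnn /walk_fun /digon_size; case: eqP => [E|] /=; last by rewrite addn1 ltnn; case: ifP => //; lia.
by rewrite addn0 leqnn subnn -E; case: ifP => //; lia.
Qed.

Lemma digon_cycle_inj m f g : digon m f g -> injective (@digon_cycle m f g).
Proof.
move=> dg [i hi] [j hj]; have m2 := dg_m dg; rewrite /digon_cycle /= => E; apply: val_inj => /=.
move: E hi hj; rewrite /walk_fun /digon_size.
have small k : k < m.*2 + (f 0 != g 0) -> k <= m.*2 by case: (_ != _) => /=; lia.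
move=> + hi hj; rewrite (small i) // (small j) //; have hi' := small i hi; have hj' := small j hj.
case: (leqP i m) => im; case: (leqP j m) => jm E.
- exact: digon_f_inj dg im jm E.
- have [|h1 h2] := digon_fg dg im _ E; first by lia.
  have i0 : i = 0 by lia.
  have j2 : j = m.*2 by lia.
  by exfalso; move: hj E; rewrite i0 j2 subnn => + E; rewrite E eqxx /=; lia.
- have [|h1 h2] := digon_fg dg jm _ (esym E); first by lia.
  have j0 : j = 0 by lia.
  have i2 : i = m.*2 by lia.
  by exfalso; move: hi E; rewrite j0 i2 subnn => + E; rewrite E eqxx /=; lia.
- have := digon_f_inj (digon_sym dg) _ _ E; lia.
Qed.

Lemma digon_cycle_edges m f g : digon m f g -> cycle_edges (@digon_cycle m f g) = digon_edges m f g.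
Proof.
move=> dg; have m2 := dg_m dg; apply/setP => e; apply/imsetP/(digon_edgesP _ dg).
  move=> [i _ ->]; rewrite /cedge digon_cycleS // /digon_cycle /walk_fun; case: i => i /= hi.
  have [im|im] := ltnP i m; first by rewrite ltnW //; apply: Or31; exists i.
  have [i2|i2] := ltnP i m.*2.
    apply: Or32; exists (m.*2 - i.+1); first by lia.
    rewrite setUC (_ : (m.*2 - i.+1).+1 = m.*2 - i); last by lia.
    have w2 : (if i <= m then f i else if i <= m.*2 then g (m.*2 - i) else f 0) = g (m.*2 - i).
      case: ifP => im'; last by rewrite ltnW.
      have -> : i = m by lia.
      by rewrite (dg_end dg); congr g; lia.
    by rewrite /= w2.
  move: hi; rewrite /digon_size; case: eqP => /= [|/eqP fg] hi; first by lia.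
  have -> : i = m.*2 by lia.
  have h0 : (m.*2 <= m) = false by lia.
  by apply: Or33; split=> //; rewrite leqnn subnn h0 /= setUC.
case=> [[i im ->]|[i im ->]|[fg ->]].
- have hi : i < digon_size m f g by rewrite /digon_size; lia.
  by exists (Ordinal hi) => //; rewrite /cedge digon_cycleS // /digon_cycle /walk_fun /= im ltnW.
- have hi : m.*2 - i.+1 < digon_size m f g by rewrite /digon_size; lia.
  exists (Ordinal hi) => //; rewrite /cedge digon_cycleS // /digon_cycle /walk_fun /= setUC.
  rewrite (_ : (m.*2 - i.+1).+1 = m.*2 - i); last by lia.
  have w1 : (if m.*2 - i <= m then f (m.*2 - i) else if m.*2 - i <= m.*2 then g (m.*2 - (m.*2 - i)) else f 0) = g i.
    by case: ifP => [|_]; [lia | rewrite leq_subr subKn //; lia].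
  have w2 : (if m.*2 - i.+1 <= m then f (m.*2 - i.+1) else
             if m.*2 - i.+1 <= m.*2 then g (m.*2 - (m.*2 - i.+1)) else f 0) = g i.+1.
    case: ifP => im'; last by rewrite leq_subr subKn //; lia.
    have -> : m.*2 - i.+1 = m by lia.
    by rewrite (dg_end dg); congr g; lia.
  by rewrite w1 w2.
have hi : m.*2 < digon_size m f g by rewrite /digon_size fg; lia.
exists (Ordinal hi) => //; rewrite /cedge digon_cycleS // /digon_cycle /walk_fun /= setUC leqnn subnn ltnn.
have -> : (m.*2 <= m) = false by lia.
by have -> : (m.*2 < m) = false by lia.
Qed.

End Digons.

Lemma sum_ord_eq n k : k < n -> \sum_(i < n) (val i == k : nat) = 1.
Proof.
move=> kn; rewrite (bigD1 (Ordinal kn)) //= eqxx big1 // => i ik.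
by case: eqP => // E; move: ik; rewrite -val_eqE /= E eqxx.
Qed.

Lemma mem_pairs3 (V : finType) (a b c : V) (e : {set V}) : a != b -> a != c -> b != c ->
  (e \in pairs [set a; b; c]) = (e == [set a; b]) (+) (e == [set a; c]) (+) (e == [set b; c]).
Proof.
move=> ab ac bc; rewrite -(big_pairs3 (fun e' => e == e') ab ac bc).
have [h|h] := boolP (e \in pairs _).
  by rewrite (bigD1 e) //= eqxx big1 // => e' /andP[_ /negbTE]; rewrite eq_sym.
by rewrite big1 // => e' he'; apply/negbTE; apply: contra h => /eqP ->.
Qed.

Lemma mem_bd2 (V : finType) (T1 T2 e : {set V}) : T1 != T2 ->
  (e \in bd [set T1; T2]) = (e \in pairs T1) (+) (e \in pairs T2).
Proof.
move=> T12; rewrite !inE andbC; have [e2|] := boolP (#|e| == 2); last by rewrite !andbF.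
rewrite !andbT odd_bigaddb (bigD1 T1) //= (bigD1 T2) 1?eq_sym //= !inE !eqxx orbT /=.
by rewrite big1 ?addbF // => T /andP[h1 h2]; rewrite !inE (negbTE h1) (negbTE h2).
Qed.

(** * Curvature of digons *)

Section Curvature.
Variables (V : finType) (K : {set {set V}}) (I : {set V}) (lev : V -> nat).
Hypothesis KD : disc_like K I.
Hypothesis deg6 : forall w, w \in I -> 6 <= #|nbrs K w|.
Hypothesis lev_adj : forall u w, adj K u w -> lev u <= (lev w).+1.
Implicit Types (A B T e : {set V}) (Z Y : {set {set V}}) (a b c u v w x : V) (f g : nat -> V).

Local Notation digon := (digon K lev).

Lemma digon_fill m f g : digon m f g ->
  exists2 Z : {set {set V}}, Z \subset triangles K & bd Z = digon_edges m f g.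
Proof.
move=> dg; have [m2 df dgg _ _ dt] := dg; apply: (dl_boundary KD).
  apply/subsetP => e /(digon_edgesP _ dg)[[i im ->]|[i im ->]|[fg ->]]; apply: adj_edge.
  - by case: (df i im).
  - by case: (dgg i im).
  - exact: dt.
move=> v; rewrite -(digon_cycle_edges dg); apply: even_cycle_edges; last exact: digon_cycle_inj dg.
by rewrite /digon_size; lia.
Qed.

Lemma digon_gauss_bonnet m f g Z : digon m f g -> Z \subset triangles K -> bd Z = digon_edges m f g ->
  6 + \sum_(i < digon_size m f g) tau Z (walk_fun m f g i) <= 3 * digon_size m f g.
Proof.
move=> dg Zt bZ; have m2 := dg_m dg.
apply: (cycle_gauss_bonnet KD deg6 _ (digon_cycle_inj dg) Zt); first by rewrite /digon_size; lia.
by rewrite (digon_cycle_edges dg).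
Qed.

(** The deficits 3 - [tau] are at most 1 at each top corner and 2 at the bottom, 4 in all, whereas
    Gauss-Bonnet requires 6. *)
Lemma digon_curvature_top m f g Z : digon m f g -> Z \subset triangles K -> bd Z = digon_edges m f g ->
  f 0 != g 0 -> 2 <= tau Z (f 0) -> 2 <= tau Z (g 0) ->
  (forall i, 0 < i -> i < m -> 3 <= tau Z (f i) /\ 3 <= tau Z (g i)) -> 1 <= tau Z (f m) -> False.
Proof.
move=> dg Zt bZ fg tf tg tfg tm; have m2 := dg_m dg; have := digon_gauss_bonnet dg Zt bZ.
have nE : digon_size m f g = m.*2.+1 by rewrite /digon_size fg addn1.
rewrite nE; have : \sum_(i < m.*2.+1) 3 <=
    \sum_(i < m.*2.+1) (tau Z (walk_fun m f g i) + (val i == 0) + (val i == m.*2) + (val i == m) + (val i == m)).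
  apply: leq_sum => -[i hi] _ /=; rewrite /walk_fun.
  have [im|im] := leqP i m.
    have [->|i0] := posnP i; first by lia.
    have [->|im'] := eqVneq i m; first by lia.
    by have [] := tfg i i0 _; lia.
  have -> : i <= m.*2 by lia.
  have [->|i2] := eqVneq i m.*2; first by rewrite subnn; lia.
  by have [] := tfg (m.*2 - i) _ _; lia.
rewrite !big_split /= !sum_ord_eq ?sum_nat_const ?card_ord; lia.
Qed.

(** The deficits are at most 1 at the apex, 1 at each of its two neighbours and 2 at the bottom: 5
    in all, still below 6. *)
Lemma digon_curvature_apex m f g Z : digon m f g -> Z \subset triangles K -> bd Z = digon_edges m f g ->
  f 0 = g 0 -> 2 <= tau Z (f 0) -> 2 <= tau Z (f 1) -> 2 <= tau Z (g 1) ->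
  (forall i, 1 < i -> i < m -> 3 <= tau Z (f i) /\ 3 <= tau Z (g i)) -> 1 <= tau Z (f m) -> False.
Proof.
move=> dg Zt bZ fg tf tf1 tg1 tfg tm; have m2 := dg_m dg; have := digon_gauss_bonnet dg Zt bZ.
have nE : digon_size m f g = m.*2 by rewrite /digon_size fg eqxx addn0.
rewrite nE; have : \sum_(i < m.*2) 3 <=
    \sum_(i < m.*2) (tau Z (walk_fun m f g i) + (val i == 0) + (val i == 1) + (val i == m.*2.-1) + (val i == m) + (val i == m)).
  apply: leq_sum => -[i hi] _ /=; rewrite /walk_fun.
  have [im|im] := leqP i m.
    have [->|i0] := posnP i; first by lia.
    have [->|i1] := eqVneq i 1; first by lia.
    have [->|im'] := eqVneq i m; first by lia.
    by have [] := tfg i _ _; lia.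
  have -> : i <= m.*2 by lia.
  have [->|i2] := eqVneq i m.*2.-1; first by rewrite (_ : m.*2 - m.*2.-1 = 1); lia.
  by have [] := tfg (m.*2 - i) _ _; lia.
rewrite !big_split /= !sum_ord_eq ?sum_nat_const ?card_ord; lia.
Qed.

Lemma digon_edge_f m f g i : digon m f g -> i < m -> [set f i; f i.+1] \in digon_edges m f g.
Proof. by move=> dg im; apply/(digon_edgesP _ dg)/Or31; exists i. Qed.

Lemma digon_edge_g m f g i : digon m f g -> i < m -> [set g i; g i.+1] \in digon_edges m f g.
Proof. by move=> dg im; apply/(digon_edgesP _ dg)/Or32; exists i. Qed.

Lemma adj_neq u w : adj K u w -> u != w.
Proof. by case/andP. Qed.

Lemma face2 A u w : A \in K -> u \in A -> w \in A -> u != w -> adj K u w.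
Proof.
move=> KA uA wA uw; rewrite /adj uw; apply: (dl_face KD KA); last by rewrite setU2_sub uA.
by apply: (@set_neq0 _ u); rewrite !inE eqxx.
Qed.

Lemma digon_no_chord m f g j : digon m f g -> j.+1 < m -> ~~ adj K (f j) (f j.+2).
Proof.
move=> dg jm; apply/negP => /lev_adj.
by rewrite (dg_f dg (ltnW jm)).2 (dg_f dg jm).2 ltnn.
Qed.

(** A single triangle at an inner vertex of a side would join vertices two levels apart. *)
Lemma digon_tau_ge2 m f g Z j : digon m f g -> Z \subset triangles K -> bd Z = digon_edges m f g ->
  j.+1 < m -> 2 <= tau Z (f j.+1).
Proof.
move=> dg Zt bZ jm.
have e1 : [set f j.+1; f j] \in bd Z by rewrite bZ setUC digon_edge_f //; exact: ltnW.
have e2 : [set f j.+1; f j.+2] \in bd Z by rewrite bZ digon_edge_f.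
have t0 : 0 < tau Z (f j.+1) by apply: tau_gt0 e1 _; rewrite !inE eqxx.
rewrite ltn_neqAle t0 andbT eq_sym; apply/eqP => t1.
have a1 := (dg_f dg (ltnW jm)).1; have a2 := (dg_f dg jm).1.
have ab : f j != f j.+2 by apply/eqP => /(congr1 lev); rewrite (dg_f dg (ltnW jm)).2 (dg_f dg jm).2; lia.
have KT := tau1 Zt t1 e1 e2 _ (adj_neq a2) ab; have := digon_no_chord dg jm.
by rewrite (face2 (KT _)) // ?inE ?eqxx ?orbT // eq_sym adj_neq.
Qed.

Definition update f i x (j : nat) : V := if j == i then x else f j.

Lemma dsum_update m f g j x e : j.+1 < m ->
  dsum m (update f j.+1 x) g e = dsum m f g e (+)
    ((e == [set f j; f j.+1]) (+) (e == [set f j.+1; f j.+2]) (+)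
     (e == [set f j; x]) (+) (e == [set x; f j.+2])).
Proof.
move=> jm; rewrite /dsum; have jm' := ltnW jm.
have nij : Ordinal jm != Ordinal jm' by rewrite -val_eqE /= gtn_eqF.
rewrite (bigD1 (Ordinal jm')) //= (bigD1 (Ordinal jm)) //=.
rewrite [in RHS](bigD1 (Ordinal jm')) //= [in RHS](bigD1 (Ordinal jm)) //=.
have -> : \big[addb/false]_(i < m | (i != Ordinal jm') && (i != Ordinal jm))
      (e == [set update f j.+1 x i; update f j.+1 x i.+1]) =
    \big[addb/false]_(i < m | (i != Ordinal jm') && (i != Ordinal jm)) (e == [set f i; f i.+1]).
  apply: eq_bigr => i; rewrite -!val_eqE /= => /andP[h1 h2].
  by rewrite /update (negbTE h2) eqSS (negbTE h1).
rewrite /update /= !eqxx ltn_eqF // [_.+2 == _]gtn_eqF //.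
move: (\big[_/_]_(i < m | _) _) (\big[_/_]_(i < m) _) (_ && _) => s1 s2 s3.
move: (e == [set f j; f j.+1]) (e == [set f j.+1; f j.+2]) (e == [set f j; x]) (e == [set x; f j.+2]).
by move: s1 s2 s3; do 7!case.
Qed.

Lemma lev_between (p q r s : nat) : p <= r.+1 -> r <= q.+1 -> p = s.+1 -> s = q.+1 -> r = s.
Proof. lia. Qed.

(** A vertex with only two triangles is exchanged for the far end [x] of their common edge.
    Adjacency of [x] to both path neighbours forces its level, so the side still descends, and the
    region loses the two triangles. *)
Lemma digon_push m f g Z j : digon m f g -> Z \subset triangles K -> bd Z = digon_edges m f g ->
  j.+1 < m -> tau Z (f j.+1) <= 2 ->
  exists x, [/\ adj K (f j) x, adj K x (f j.+2), lev x = lev (f j.+1) &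
    x != g j.+1 -> digon m (update f j.+1 x) g /\
      exists2 Z' : {set {set V}}, Z' \subset triangles K &
        bd Z' = digon_edges m (update f j.+1 x) g /\ #|Z'| < #|Z| ].
Proof.
move=> dg Zt bZ jm t2; have [m2 df dgg dend dneq dtop] := dg; have jm' := ltnW jm.
have [a1 l1] := df j jm'; have [a2 l2] := df _ jm.
have t2' : tau Z (f j.+1) = 2 by apply/eqP; rewrite eqn_leq t2 (digon_tau_ge2 dg Zt bZ).
have e1 : [set f j.+1; f j] \in bd Z by rewrite bZ setUC digon_edge_f.
have e2 : [set f j.+1; f j.+2] \in bd Z by rewrite bZ digon_edge_f.
have only e : e \in bd Z -> f j.+1 \in e -> e = [set f j.+1; f j] \/ e = [set f j.+1; f j.+2].
  rewrite bZ => /(digon_edgesP _ dg)[[i im ->]|[i im ->]|[fg ->]]; rewrite !inE => /orP[] /eqP E.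
  - by right; rewrite (digon_f_inj dg (ltnW jm) (ltnW im) E).
  - by left; have [->] := digon_f_inj dg (ltnW jm) im E; rewrite setUC.
  - by have := digon_fg dg (ltnW jm) (ltnW im) E; lia.
  - by have := digon_fg dg (ltnW jm) im E; lia.
  - by have := digon_f_inj dg (ltnW jm) (leq0n m) E.
  - by have := digon_fg dg (ltnW jm) (leq0n m) E; lia.
have ab : f j != f j.+2 by apply/eqP => /(congr1 lev); rewrite l1 l2; lia.
have wa : f j.+1 != f j by rewrite eq_sym adj_neq.
have [x [xw xa xb T1Z T2Z]] := tau2 Zt t2' e1 e2 only wa (adj_neq a2) ab.
have T1t := subsetP Zt _ T1Z; have T2t := subsetP Zt _ T2Z.
have ax : adj K (f j) x.
  by apply: (triangle_adj KD T1t); rewrite ?inE ?eqxx ?orbT // eq_sym.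
have bx : adj K x (f j.+2) by apply: (triangle_adj KD T2t); rewrite ?inE ?eqxx ?orbT.
have lx : lev x = lev (f j.+1).
  exact: lev_between (lev_adj ax) (lev_adj bx) l1 l2.
exists x; split=> // xg.
have dg' : digon m (update f j.+1 x) g.
  split=> //.
  - move=> i im; rewrite /update; have [->|ij] := eqVneq i j.+1.
      by rewrite gtn_eqF // lx.
    have [[->]|ij'] := eqVneq i.+1 j.+1; first by rewrite lx -l1.
    exact: df.
  - by rewrite /update gtn_eqF.
  - by move=> i i0 im; rewrite /update; have [->//|_] := eqVneq i j.+1; exact: dneq.
split=> //; exists (Z :\: [set [set f j.+1; f j; x]; [set f j.+1; f j.+2; x]]).
  by apply: subset_trans Zt; apply: subsetDl.
have T12 : [set f j.+1; f j; x] != [set f j.+1; f j.+2; x].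
  apply/eqP => /setP/(_ (f j)); rewrite !inE eqxx orbT /= => /esym.
  by rewrite eq_sym (negbTE wa) (negbTE ab) eq_sym (negbTE xa).
split; last first.
  apply: proper_card; rewrite properEneq subsetDl andbT; apply/eqP => E.
  by move: T1Z; rewrite -E !inE eqxx.
have -> : Z :\: [set [set f j.+1; f j; x]; [set f j.+1; f j.+2; x]] =
          symd Z [set [set f j.+1; f j; x]; [set f j.+1; f j.+2; x]].
  apply/setP => T; rewrite !inE; case: eqP => [->|_]; first by rewrite T1Z.
  by case: eqP => [->|_]; rewrite ?T2Z ?addbF.
rewrite bd_symd bZ; apply/setP => e; rewrite [LHS]inE mem_bd2 // ![e \in digon_edges _ _ _]inE.
rewrite dsum_update // !mem_pairs3 // 1?eq_sym ?xw // 1?eq_sym //; last exact: adj_neq.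
rewrite [[set f j.+1; f j]]setUC [[set f j.+2; x]]setUC; congr (_ (+) _).
case: (e == [set f j; f j.+1]); case: (e == [set f j.+1; x]); case: (e == [set f j; x]);
  by case: (e == [set f j.+1; f j.+2]); case: (e == [set x; f j.+2]).
Qed.

(** When the pushed vertex lands on the opposite side, the part above it is a shorter digon. *)
Lemma digon_cut m f g j x : digon m f g -> j.+1 < m -> 0 < j -> x = g j.+1 -> adj K (f j) x ->
  lev x = lev (f j.+1) -> digon j.+1 (update f j.+1 x) g.
Proof.
move=> dg jm j0 xg ax lx; have [m2 df dgg dend dneq dtop] := dg; split=> //.
- move=> i ij; rewrite /update ltn_eqF //; have [ij'|ij'] := eqVneq i.+1 j.+1.
    by case: ij' => ->; rewrite lx -(df j (ltnW jm)).2.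
  by apply: df; lia.
- by move=> i ij; apply: dgg; lia.
- by rewrite /update eqxx.
- by move=> i i0 ij; rewrite /update ltn_eqF //; apply: dneq => //; lia.
Qed.

Lemma digon_tau_end m f g Z : digon m f g -> bd Z = digon_edges m f g -> 1 <= tau Z (f m).
Proof.
move=> dg bZ; have m2 := dg_m dg; have [m' mE] : exists m', m = m'.+1 by exists m.-1; lia.
apply: (@tau_gt0 _ Z [set f m'; f m]); last by rewrite !inE eqxx orbT.
by rewrite bZ mE digon_edge_f // -?mE //; lia.
Qed.

(* Minimal counterexamples have no convex interior vertex on the two geodesics, so the curvature
   of the region between them is too small. *)
Lemma digon_top_parent m f g : digon m f g -> f 0 != g 0 ->
  ~ (forall x, adj K (f 0) x -> adj K (g 0) x -> lev (f 0) = (lev x).+1 -> False).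
Proof.
elim/ltn_ind: m f g => m IHm f g dg fg nopar.
have [Z Zt bZ] := digon_fill dg; move: dg fg nopar Zt bZ.
have [z zE] : exists z, z = #|Z| by exists #|Z|.
elim/ltn_ind: z f g Z zE => z IHz f g Z zE dg fg nopar Zt bZ.
have step f' g' i : digon m f' g' -> f' 0 != g' 0 ->
    (forall x, adj K (f' 0) x -> adj K (g' 0) x -> lev (f' 0) = (lev x).+1 -> False) ->
    bd Z = digon_edges m f' g' -> 0 < i -> i < m -> 3 <= tau Z (f' i).
  move=> dg' fg' nopar' bZ' i0 im; case: i i0 im => // j _ jm; rewrite leqNgt; apply/negP => tj.
  have [x [ax xb lx hx]] := digon_push dg' Zt bZ' jm tj.
  have [xg|xg] := eqVneq x (g' j.+1).
    (* Directly below the top, landing on the other side exhibits a common parent of the two top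
       vertices. *)
    have [j0|j0] := posnP j.
      rewrite j0 in xg ax lx jm; apply: (nopar' x ax).
        by rewrite xg; have [] := dg_g dg' (ltnW jm).
      by rewrite lx; have [_] := dg_f dg' (ltnW jm).
    by apply: (IHm j.+1 jm _ _ (digon_cut dg' jm j0 xg ax lx)).
  have [dg'' [Z' Z't [bZ'' Zlt]]] := hx xg.
  by apply: (IHz #|Z'| _ _ _ Z' erefl dg'') => //; rewrite zE.
have m2 := dg_m dg.
have tge f' g' : digon m f' g' -> f' 0 != g' 0 ->
    (forall x, adj K (f' 0) x -> adj K (g' 0) x -> lev (f' 0) = (lev x).+1 -> False) ->
    bd Z = digon_edges m f' g' -> 2 <= tau Z (f' 0).
  move=> dg' fg' nopar' bZ'; have m0 : 0 < m by lia.
  have e1 : [set f' 0; f' 1] \in bd Z by rewrite bZ' digon_edge_f.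
  have e2 : [set f' 0; g' 0] \in bd Z by rewrite bZ'; apply/(digon_edgesP _ dg')/Or33.
  have t0 : 0 < tau Z (f' 0) by apply: tau_gt0 e1 _; rewrite !inE eqxx.
  rewrite ltn_neqAle t0 andbT eq_sym; apply/eqP => t1.
  have [a1 l1] := dg_f dg' m0.
  have fg1 : f' 1 != g' 0.
    apply/eqP => /(congr1 lev); rewrite (digon_lev2 dg' (leq0n m)) -(digon_lev dg' (leq0n m)) l1; lia.
  have KT := tau1 Zt t1 e1 e2 (adj_neq a1) fg' fg1.
  apply: (nopar' (f' 1)) => //; apply: (face2 KT); rewrite ?inE ?eqxx ?orbT // eq_sym //.
have dgs := digon_sym dg; have gf : g 0 != f 0 by rewrite eq_sym.
have bZs : bd Z = digon_edges m g f by rewrite digon_edges_sym.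
have nopars x : adj K (g 0) x -> adj K (f 0) x -> lev (g 0) = (lev x).+1 -> False.
  by move=> h1 h2 h3; apply: (nopar x) => //; rewrite (digon_lev dg (leq0n m)) -(digon_lev2 dg (leq0n m)).
apply: (digon_curvature_top dg Zt bZ fg (tge _ _ dg fg nopar bZ) (tge _ _ dgs gf nopars bZs) _ (digon_tau_end dg bZ)).
by move=> i i0 im; split; [exact: step dg _ _ _ _ _ | exact: step dgs _ _ _ _ _].
Qed.

(** The descent of [digon_top_parent] restricted to indices at least 2, so that the two neighbours
    of the apex never move; the weaker bounds there are those allowed by [digon_curvature_apex]. *)
Lemma digon_apex_triangle m f g : digon m f g -> f 0 = g 0 -> f 1 != g 1 ->
  [set f 0; f 1; g 1] \in K.
Proof.
move=> dg fg fg1; apply: contraT => noT.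
elim/ltn_ind: m f g dg fg fg1 noT => m IHm f g dg fg fg1 noT.
have [Z Zt bZ] := digon_fill dg; move: dg fg fg1 noT Zt bZ.
have [z zE] : exists z, z = #|Z| by exists #|Z|.
elim/ltn_ind: z f g Z zE => z IHz f g Z zE dg fg fg1 noT Zt bZ; exfalso.
have step f' g' i : digon m f' g' -> f' 0 = g' 0 -> f' 1 != g' 1 ->
    [set f' 0; f' 1; g' 1] \notin K ->
    bd Z = digon_edges m f' g' -> 1 < i -> i < m -> 3 <= tau Z (f' i).
  move=> dg' fg' fg1' noT' bZ' i1 im; case: i i1 im => // j i1 jm; rewrite leqNgt; apply/negP => tj.
  have [x [ax xb lx hx]] := digon_push dg' Zt bZ' jm tj.
  have j0 : 0 < j by [].
  have u1 : update f' j.+1 x 1 = f' 1 by rewrite /update ltn_eqF.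
  have [xg|xg] := eqVneq x (g' j.+1).
    by have := IHm j.+1 jm _ _ (digon_cut dg' jm j0 xg ax lx); rewrite u1 => /(_ fg' fg1' noT').
  have [dg'' [Z' Z't [bZ'' Zlt]]] := hx xg.
  have Zz : #|Z'| < z by rewrite zE.
  by have := IHz #|Z'| Zz _ _ Z' erefl dg''; rewrite u1 => /(_ fg' fg1' noT' Z't bZ'').
have m2 := dg_m dg; have m0 : 0 < m by lia.
have [a1 l1] := dg_f dg m0; have [a2 l2] := dg_g dg m0.
have e1 : [set f 0; f 1] \in bd Z by rewrite bZ digon_edge_f.
have e2 : [set f 0; g 1] \in bd Z by rewrite bZ fg digon_edge_g.
have t0 : 2 <= tau Z (f 0).
  have t0 : 0 < tau Z (f 0) by apply: tau_gt0 e1 _; rewrite !inE eqxx.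
  rewrite ltn_neqAle t0 andbT eq_sym; apply/eqP => t1.
  by move: noT; rewrite (tau1 Zt t1 e1 e2 (adj_neq a1)) // fg adj_neq.
have dgs := digon_sym dg; have bZs : bd Z = digon_edges m g f by rewrite digon_edges_sym.
have noTs : [set g 0; g 1; f 1] \notin K by rewrite -setUA [[set g 1] :|: _]setUC setUA -fg.
have gf1 : g 1 != f 1 by rewrite eq_sym.
apply: (digon_curvature_apex dg Zt bZ fg t0 (digon_tau_ge2 dg Zt bZ _) (digon_tau_ge2 dgs Zt bZs _) _ (digon_tau_end dg bZ)) => //.
by move=> i i0 im; split; [exact: step dg _ _ _ _ _ _ | exact: step dgs _ _ _ _ _ _].
Qed.

End Curvature.

(** * Small wheels *)

Section Wheels.
Variables (V : finType) (K : {set {set V}}) (I : {set V}).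
Hypothesis KD : disc_like K I.
Hypothesis deg6 : forall w, w \in I -> 6 <= #|nbrs K w|.
Implicit Types (a b c d u w x y : V).

Lemma triangle_in a b c : adj K a b -> adj K a c -> adj K b c -> [set a; b; c] \in triangles K.
Proof.
move=> ab ac bc; rewrite inE (triangle_of_adj KD deg6) //=.
by apply/card3P; exists a, b, c; rewrite (adj_neq ab) (adj_neq ac) (adj_neq bc).
Qed.

(** The boundary of the fan around [a] avoids [a], so the fan is the whole star, [a] is interior,
    and its degree is at most 5. *)
Lemma no_small_wheel n (g : 'I_n -> V) a : 3 <= n -> n <= 5 -> injective g ->
  (forall i, adj K a (g i)) -> (forall i, adj K (g i) (g (ordS i))) -> False.
Proof.
move=> n3 n5 ginj ag gg; pose T i := a |: cedge g i.
have aN i : a \notin cedge g i.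
  by rewrite !inE negb_or (adj_neq (ag i)) (adj_neq (ag (ordS i))).
have Tt i : T i \in triangles K by rewrite /T /cedge setUA; exact: triangle_in.
have Tinj : injective T.
  move=> i j /(congr1 (fun A => A :\ a)); rewrite !setU1K //; exact: cedge_inj.
pose Z := [set T i | i : 'I_n].
have Zt : Z \subset triangles K by apply/subsetP => _ /imsetP[i _ ->].
have n0 : 0 < n by lia.
have [|aI cov] := dl_star KD Zt (imset_f T (isT : Ordinal n0 \in 'I_n)) (setU11 a _).
  move=> e; rewrite inE => /andP[/cards2P[x [y [xy eE]]] o]; apply: contraL o => ae.
  have [u uE] : exists u, e = [set a; u].
    move: ae; rewrite eE !inE => /orP[] /eqP ->; [by exists y | by exists x; rewrite setUC].
  have [|] := boolP [exists j, u == g j]; last first.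
    move=> /existsPn nu; rewrite (_ : [set _ in _ | _] = set0) ?cards0 //.
    apply/setP => T0; rewrite !inE; apply/negbTE/negP => /andP[/imsetP[i _ ->]].
    rewrite uE setU2_sub => /andP[_]; rewrite !inE => /or3P[] /eqP ui.
    - by move: xy; have := congr1 (fun A : {set V} => #|A|) eE; rewrite uE ui cards2 eqxx cards2; case: (x == y).
    - by have := nu i; rewrite ui eqxx.
    - by have := nu (ordS i); rewrite ui eqxx.
  move=> /existsP[j /eqP uj].
  have -> : [set T0 in Z | e \subset T0] = [set T i | i in [set j; ord_pred j]].
    apply/setP => T0; rewrite !inE; apply/andP/imsetP => [[/imsetP[i _ ->]]|[i ij ->]].
      rewrite uE setU2_sub setU11 /= in_setU1 uj eq_sym (negbTE (adj_neq (ag j))) /= mem_cedge //.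
      move=> h; exists i => //; rewrite !inE; case/orP: h => [->//|/eqP <-].
      by rewrite ordSK eqxx orbT.
    split; first by rewrite imset_f.
    rewrite uE setU2_sub setU11 /= in_setU1 uj mem_cedge //; move: ij; rewrite !inE => /orP[] /eqP ->.
      by rewrite eqxx orbT.
    by rewrite ord_predK eqxx !orbT.
  rewrite card_imset // cards2; case: eqP => // E.
  by have := ordS_neq n3 (ord_pred j); rewrite ord_predK -{1}E eqxx.
have := leq_trans (deg6 aI) (subset_leq_card (_ : _ \subset [set g i | i : 'I_n])).
rewrite card_imset // card_ord => h; have : 6 <= n; last by lia.
apply: h; apply/subsetP => u; rewrite inE => /andP[au Kau].
have [|_ /imsetP[i _ ->] sT] := cov _ Kau; first by rewrite !inE eqxx.
have : u \in T i by apply: (subsetP sT); rewrite !inE eqxx orbT.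
by rewrite !inE eq_sym (negbTE au) /= => /orP[] /eqP ->; apply: imset_f.
Qed.

Lemma no_wheel3 a b c d : adj K a b -> adj K a c -> adj K a d -> adj K b c -> adj K c d -> adj K b d -> False.
Proof.
move=> ab ac ad bc cd bd'; pose g (i : 'I_3) := nth a [:: b; c; d] i.
apply: (@no_small_wheel 3 g a) => //.
- have un : uniq [:: b; c; d].
    by rewrite /= !inE negb_or (adj_neq bc) (adj_neq cd) (adj_neq bd').
  by move=> i j /eqP; rewrite (nth_uniq a) // => /eqP/val_inj.
- by rewrite /g => -[[|[|[|]]]].
- by rewrite /g => -[[|[|[|]]]] //= _; rewrite adj_sym.
Qed.

Lemma no_wheel4 a b c d u : adj K a b -> adj K a c -> adj K a d -> adj K a u ->
  adj K b c -> adj K c d -> adj K d u -> adj K u b -> b != d -> c != u -> False.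
Proof.
move=> ab ac ad au bc cd du ub nbd ncu; pose g (i : 'I_4) := nth a [:: b; c; d; u] i.
apply: (@no_small_wheel 4 g a) => //.
- have un : uniq [:: b; c; d; u].
    by rewrite /= !inE !negb_or (adj_neq bc) nbd (eq_sym b u) (adj_neq ub) (adj_neq cd) ncu (adj_neq du).
  by move=> i j /eqP; rewrite (nth_uniq a) // => /eqP/val_inj.
- by rewrite /g => -[[|[|[|[|]]]]].
- by rewrite /g => -[[|[|[|[|]]]]].
Qed.

End Wheels.

(** * Parents and adjacency within a level *)

Section Levels.
Variables (V : finType) (K : {set {set V}}) (I : {set V}) (lev : V -> nat) (n : nat).
Hypothesis KD : disc_like K I.
Hypothesis deg6 : forall w, w \in I -> 6 <= #|nbrs K w|.
Hypothesis lev_adj : forall u w, adj K u w -> lev u <= (lev w).+1.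
Hypothesis lev_root : forall u w, lev u = 0 -> lev w = 0 -> u = w.
Hypothesis lev_parent : forall w, 0 < lev w -> lev w <= n -> exists2 u, adj K w u & lev w = (lev u).+1.
Implicit Types (a b c d p q u w x y : V) (e T : {set V}) (k : nat).

Definition parent w : V := odflt w [pick u | adj K w u && (lev w == (lev u).+1)].

Lemma parentP w : 0 < lev w -> lev w <= n -> adj K w (parent w) /\ lev w = (lev (parent w)).+1.
Proof.
move=> h1 h2; rewrite /parent; case: pickP => [u /andP[? /eqP]|h] //=.
by have [u u1 u2] := lev_parent h1 h2; have := h u; rewrite u1 u2 eqxx.
Qed.

Lemma iter_parent w i : lev w <= n -> i <= lev w -> lev (iter i parent w) = lev w - i.
Proof.
move=> wn; elim: i => [|i IH] iw; first by rewrite subn0.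
have IH' := IH (ltnW iw); rewrite iterS; have [||_] := @parentP (iter i parent w); rewrite ?IH'; lia.
Qed.

Lemma iter_parent_adj w i : lev w <= n -> i < lev w ->
  adj K (iter i parent w) (iter i.+1 parent w) /\ lev (iter i parent w) = (lev (iter i.+1 parent w)).+1.
Proof.
move=> wn iw; rewrite iterS; apply: parentP; rewrite iter_parent //; lia.
Qed.

(** Chains of chosen parents meet at the root at the latest; stopping at the first meeting makes
    them the sides of a digon. *)
Lemma meeting u w : lev u = lev w -> lev u <= n -> u != w ->
  exists m, [/\ 0 < m, m <= lev u, iter m parent u = iter m parent w &
    forall i, i < m -> iter i parent u != iter i parent w].
Proof.
move=> uw un nuw; have wn : lev w <= n by rewrite -uw.
have ex : exists m, iter m parent u == iter m parent w.
  exists (lev u); apply/eqP; apply: lev_root; rewrite iter_parent //; lia.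
case: (ex_minnP ex) => m /eqP mE mmin; exists m; split=> //.
- by case: m mE {mmin} => //= E; rewrite E eqxx in nuw.
- apply: mmin; apply/eqP; apply: lev_root; rewrite iter_parent //; lia.
- by move=> i im; apply/negP => /mmin; rewrite leqNgt im.
Qed.

(** If the chosen parents differ, the two chains bound a digon with the edge from [a] to [b] on
    top. *)
Lemma common_parent a b : adj K a b -> lev a = lev b -> 0 < lev a -> lev a <= n ->
  exists x, [/\ adj K a x, adj K b x & lev a = (lev x).+1].
Proof.
move=> ab lab a0 an; have bn : lev b <= n by rewrite -lab.
have [m [m0 ma mE mneq]] := meeting lab an (adj_neq ab).
have [m1|m1] := leqP m 1.
  have m1' : m = 1 by lia.
  have [h1 h2] := parentP a0 an; exists (parent a); split=> //.
  by move: mE; rewrite m1' /= => ->; have [] := @parentP b; rewrite -?lab.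
have dg : digon K lev m (fun i => iter i parent a) (fun i => iter i parent b).
  split=> //.
  - by move=> i im; apply: iter_parent_adj => //; lia.
  - by move=> i im; apply: iter_parent_adj => //; lia.
  - by move=> i _; exact: mneq.
apply: contrapT => nx; apply: (digon_top_parent KD deg6 lev_adj dg (adj_neq ab)) => x h1 h2 h3.
by apply: nx; exists x.
Qed.

(** The two parent chains, prolonged by [w], form a digon with apex [w]. *)
Lemma parents_triangle w p q : lev w <= n -> adj K w p -> adj K w q -> lev w = (lev p).+1 ->
  lev w = (lev q).+1 -> p != q -> adj K p q.
Proof.
move=> wn wp wq lp lq pq; have pn : lev p <= n by lia.
have lpq : lev p = lev q by lia.
have qn : lev q <= n by lia.
have [m [m0 mp mE mneq]] := meeting lpq pn pq.
pose f i := if i is j.+1 then iter j parent p else w.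
pose g i := if i is j.+1 then iter j parent q else w.
have dg : digon K lev m.+1 f g.
  split=> //.
  - by case=> [|i] im //=; apply: iter_parent_adj => //; lia.
  - by case=> [|i] im //=; apply: iter_parent_adj => //; lia.
  - by case=> [|i] // _ im; exact: mneq.
  - by rewrite eqxx.
have KT := digon_apex_triangle KD deg6 lev_adj dg erefl pq.
by apply: (face2 KD KT); rewrite ?inE ?eqxx ?orbT.
Qed.

(** Two common parents would be adjacent and make [a] the hub of a wheel with three spokes. *)
Lemma common_parent_unique a b x y : adj K a b -> lev a = lev b -> lev a <= n ->
  adj K a x -> adj K b x -> adj K a y -> adj K b y -> lev a = (lev x).+1 -> lev a = (lev y).+1 -> x = y.
Proof.
move=> ab lab an ax bx ay by' lx ly; apply/eqP; apply: contraT => xy; exfalso.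
have xy' := parents_triangle an ax ay lx ly xy.
by apply: (no_wheel3 KD deg6 ab ax ay bx xy' by').
Qed.

(** The common parents for the pairs [a], [b] and [a], [c] coincide or are adjacent, which makes [a]
    the hub of a wheel with three or four spokes. *)
Lemma no_level_triangle a b c : adj K a b -> adj K b c -> adj K a c ->
  lev a = lev b -> lev b = lev c -> lev a <= n -> False.
Proof.
move=> ab bc ac lab lbc an; have [a0|a0] := posnP (lev a).
  by have := adj_neq ab; rewrite (lev_root a0 (etrans (esym lab) a0)) eqxx.
have [x [ax bx lx]] := common_parent ab lab a0 an.
have [z [az cz lz]] := common_parent ac (etrans lab lbc) a0 an.
have [xz|xz] := eqVneq x z.
  by apply: (no_wheel3 KD deg6 ab ac ax bc _ bx); rewrite xz.
have xz' := parents_triangle an ax az lx lz xz.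
apply: (no_wheel4 KD deg6 ab ax az ac bx xz' _ _ _ _); try by rewrite adj_sym.
- by apply/eqP => /(congr1 lev); lia.
- by apply/eqP => /(congr1 lev); lia.
Qed.

End Levels.

(** * Counting on spheres *)

Section Counting.
Variables (V : finType) (K : {set {set V}}) (I : {set V}) (lev : V -> nat) (n : nat).
Hypothesis KD : disc_like K I.
Hypothesis deg6 : forall w, w \in I -> 6 <= #|nbrs K w|.
Hypothesis lev_adj : forall u w, adj K u w -> lev u <= (lev w).+1.
Hypothesis lev_root : forall u w, lev u = 0 -> lev w = 0 -> u = w.
Hypothesis lev_parent : forall w, 0 < lev w -> lev w <= n -> exists2 u, adj K w u & lev w = (lev u).+1.
Hypothesis lev_interior : forall w, lev w <= n -> w \in I.
Implicit Types (a b c d p q u w x y : V) (e T : {set V}) (j k : nat).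

Let common := common_parent KD deg6 lev_adj lev_root lev_parent.
Let unique_common := common_parent_unique KD deg6 lev_adj lev_root lev_parent.
Let parents_adj := parents_triangle KD deg6 lev_adj lev_root lev_parent.
Let no_level := no_level_triangle KD deg6 lev_adj lev_root lev_parent.

Definition sphere k : {set V} := [set w | lev w == k].
Definition sphere_edges k : {set {set V}} := [set e in edges K | e \subset sphere k].
Definition parents w : {set V} := [set u in nbrs K w | lev w == (lev u).+1].
Definition siblings w : {set V} := [set u in nbrs K w | lev u == lev w].
Definition links w u : {set V} := [set y in nbrs K w | adj K u y].

Lemma lev_adj2 a b : adj K a b -> lev b <= (lev a).+1.
Proof. by rewrite adj_sym => /lev_adj. Qed.

Lemma card_edge_triangles e w : lev w <= n -> e \in edges K -> w \in e ->
  #|[set T in triangles K | e \subset T]| = 2.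
Proof.
move=> wn eE we; apply/eqP; rewrite eqn_leq (dl_edge KD eE).
exact: (dl_interior KD (lev_interior wn) eE we).
Qed.

Lemma setU1_triangle a b y : adj K a b -> adj K a y -> adj K b y -> y |: [set a; b] \in triangles K.
Proof. by move=> ab ay by'; rewrite setUC; exact: (triangle_in KD deg6 ab ay by'). Qed.

(** By [triangle_of_adj], common neighbours of [w] and [u] correspond to triangles on the edge
    joining them. *)
Lemma card_links w u : lev w <= n -> adj K w u -> #|links w u| = 2.
Proof.
move=> wn wu; rewrite -(card_edge_triangles wn (adj_edge wu)) ?inE ?eqxx //.
have inj : {in links w u &, injective (fun y => y |: [set w; u])}.
  move=> y y'; rewrite !inE => /andP[wy uy] /andP[wy' uy'] /setP/(_ y).
  by rewrite !inE eqxx eq_sym (negbTE (adj_neq wy)) eq_sym (negbTE (adj_neq uy)) !orbF => /esym/eqP.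
rewrite -(card_in_imset inj); apply: eq_card => T; rewrite inE; apply/imsetP/andP.
  case=> y; rewrite !inE => /andP[wy uy] ->; split; last exact: subsetUr.
  by have := setU1_triangle wu wy uy; rewrite inE.
move=> [Tt s]; have [KT T3] := triangleP Tt.
have [wT uT] : w \in T /\ u \in T by move: s; rewrite setU2_sub => /andP.
have /card_gt0P[y] : 0 < #|T :\: [set w; u]|.
  by rewrite cardsD (setIidPr s) T3 cards2; case: (w != u).
rewrite !inE negb_or => /andP[/andP[yw yu] yT]; exists y.
  by rewrite !inE; apply/andP; split; apply: (triangle_adj KD Tt) => //; rewrite eq_sym.
apply/esym/eqP; rewrite eqEcard subUset sub1set yT s T3 cardsU1 !inE negb_or yw yu.
by rewrite cards2 (adj_neq wu).
Qed.

(** Three parents would be pairwise adjacent, and [w] the hub of a wheel with three spokes. *)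
Lemma card_parents w : 0 < lev w -> lev w <= n -> 0 < #|parents w| <= 2.
Proof.
move=> w0 wn; apply/andP; split.
  by have [u wu lu] := lev_parent w0 wn; apply/card_gt0P; exists u; rewrite !inE wu lu eqxx.
rewrite leqNgt; apply/negP => h.
have [p pP] : exists p, p \in parents w by apply/set0Pn; rewrite -card_gt0; apply: leq_trans h.
rewrite (cardsD1 p) pP add1n ltnS in h.
have [q qP] : exists q, q \in parents w :\ p by apply/set0Pn; rewrite -card_gt0; apply: leq_trans h.
rewrite (cardsD1 q) qP add1n ltnS in h.
have [r rP] : exists r, r \in (parents w :\ p) :\ q by apply/set0Pn; rewrite -card_gt0; apply: leq_trans h.
move: pP qP rP; rewrite !inE => /andP[wp /eqP lp] /and3P[qp wq /eqP lq] /and4P[rq rp wr /eqP lr].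
have pq := parents_adj wn wp wq lp lq; have qr := parents_adj wn wq wr lq lr.
have pr := parents_adj wn wp wr lp lr.
by apply: (no_wheel3 KD deg6 wp wq wr (pq _) (qr _) (pr _)); rewrite eq_sym.
Qed.

(* Each of the two link neighbours of a parent is a sibling or the other parent. *)
Lemma card_siblings w : 0 < lev w -> lev w <= n -> #|siblings w| = 2.
Proof.
move=> w0 wn; have /andP[P0 P2] := card_parents w0 wn.
have : \sum_(u in siblings w) \sum_(p in parents w) (adj K u p : nat) = #|siblings w|.
  rewrite -sum1_card; apply: eq_bigr => u; rewrite !inE => /andP[wu /eqP lu].
  have [x [wx ux lx]] := common wu (esym lu) w0 wn.
  rewrite (bigD1 x) ?inE ?wx ?lx ?eqxx //= ux big1 // => y.
  rewrite !inE => /andP[/andP[wy /eqP ly] yx]; case uy: (adj K u y) => //.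
  by move: yx; rewrite (unique_common wu (esym lu) wn wy uy wx ux ly lx) eqxx.
rewrite exchange_big /=.
have : \sum_(p in parents w) \sum_(u in siblings w) (adj K u p : nat) = \sum_(p in parents w) (3 - #|parents w|).
  apply: eq_bigr => p; rewrite !inE => /andP[wp /eqP lp].
  have lk := card_links wn wp.
  have lE : links w p = (parents w :\ p) :|: [set u in siblings w | adj K u p].
    apply/setP => u; rewrite !inE; apply/idP/idP.
      move=> /andP[wu pu]; rewrite wu /= (adj_sym _ u p) pu andbT.
      have := lev_adj2 wu; have := lev_adj wu; have := lev_adj2 pu.
      rewrite eq_sym (adj_neq pu) /=; move: lp; lia.
    case/orP; last by rewrite (adj_sym _ u p) => /andP[/andP[-> _] ->].
    move=> /and3P[up wu /eqP lu]; rewrite wu /=; apply: (parents_adj wn wp wu lp lu).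
    by rewrite eq_sym.
  have dis : (parents w :\ p) :&: [set u in siblings w | adj K u p] = set0.
    apply/setP => u; rewrite !inE; apply/negbTE/negP => /andP[/and3P[_ _ /eqP h1] /andP[/andP[_ /eqP h2] _]].
    by move: h1 h2; lia.
  rewrite lE cardsU dis cards0 subn0 in lk.
  have pP : p \in parents w by rewrite !inE wp lp eqxx.
  have := cardsD1 p (parents w); rewrite pP.
  have -> : \sum_(u in siblings w) (adj K u p : nat) = #|[set u in siblings w | adj K u p]|.
    by rewrite -sum1dep_card big_mkcondr /=; apply: eq_bigr => u _; case: adj.
  by move: lk; lia.
(* With P parents there are P (3 - P) siblings, which is 2 both for P = 1 and for P = 2. *)
rewrite sum_nat_const => -> <-.
by case: #|parents w| P0 P2 => [|[|[]]].
Qed.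

Lemma sphere_edgeP k e : reflect (exists a b, [/\ adj K a b, lev a = k, lev b = k & e = [set a; b]])
  (e \in sphere_edges k).
Proof.
rewrite !inE; apply: (iffP idP) => [/andP[/andP[Ke /cards2P[a [b [ab eE]]]]]|[a [b [ab la lb ->]]]].
  rewrite eE in Ke *; rewrite setU2_sub !inE => /andP[/eqP la /eqP lb]; exists a, b; split=> //.
  by rewrite /adj ab.
by case/andP: (ab) => _ ->; rewrite cards2 (adj_neq ab) setU2_sub !inE la lb eqxx.
Qed.

Lemma sphere_edges0 : sphere_edges 0 = set0.
Proof.
apply/setP => e; rewrite [RHS]inE; apply/negbTE/sphere_edgeP => -[a [b [ab la lb _]]].
by have := adj_neq ab; rewrite (lev_root la lb) eqxx.
Qed.

Theorem sum_sphere_edges k (chi : V -> nat) : 0 < k -> k <= n ->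
  \sum_(e in sphere_edges k) \sum_(w in e) chi w = 2 * \sum_(w in sphere k) chi w.
Proof.
move=> k0 kn; rewrite (exchange_big_dep (fun w => w \in sphere k)) /=; last first.
  by move=> e w; rewrite !inE => /andP[_ /subsetP s] /s; rewrite inE.
rewrite big_distrr /=; apply: eq_bigr => w; rewrite inE => /eqP wk.
rewrite sum_nat_const; congr (_ * _).
have w0 : 0 < lev w by rewrite wk.
have wn : lev w <= n by rewrite wk.
rewrite -(card_siblings w0 wn).
have inj : {in siblings w &, injective (fun u => [set w; u])}.
  move=> u u'; rewrite !inE => /andP[wu _] _ /setP/(_ u).
  by rewrite !inE eqxx orbT eq_sym (negbTE (adj_neq wu)) => /esym/eqP.
rewrite -(card_in_imset inj); apply: eq_card => e; rewrite unfold_in; apply/andP/imsetP.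
  move=> [/sphere_edgeP[a [b [ab la lb ->]]]]; rewrite !inE => /orP[] /eqP ->.
    by exists b => //; rewrite !inE ab lb la eqxx.
  by exists a; rewrite ?(setUC [set a]) // !inE adj_sym ab lb la eqxx.
case=> u /setIdP[wu /eqP lu] ->; rewrite inE in wu; split; last by rewrite !inE eqxx.
by apply/sphere_edgeP; exists w, u; rewrite lu wk.
Qed.

Corollary card_sphere_edges k : 0 < k -> k <= n -> #|sphere_edges k| = #|sphere k|.
Proof.
move=> k0 kn; have := sum_sphere_edges (fun=> 1) k0 kn.
rewrite sum1_card (eq_bigr (fun=> 2)) => [|e]; first by rewrite sum_nat_const mulnC => /eqP; rewrite eqn_pmul2l // => /eqP.
by rewrite !inE => /andP[/andP[_ /eqP e2] _]; rewrite sum1_card.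
Qed.

(** One common neighbour of the two ends is their unique common parent. The other is neither a
    second common parent nor on the same level, so it lies one level up. *)
Lemma level_edge_star k e : 0 < k -> k <= n -> e \in sphere_edges k ->
  exists x y, [/\ (lev x).+1 = k, lev y = k.+1 &
    [set T in triangles K | e \subset T] = [set x |: e; y |: e] /\ x |: e != y |: e].
Proof.
move=> k0 kn eS; have /sphere_edgeP[a [b [ab la lb eE]]] := eS.
have an : lev a <= n by rewrite la.
have a0 : 0 < lev a by rewrite la.
have lk := card_links an ab; have lab : lev a = lev b by rewrite la lb.
have [x [ax bx lx]] := common ab lab a0 an.
have xL : x \in links a b by rewrite !inE ax.
rewrite (cardsD1 x) xL add1n in lk; case: lk => /eqP/cards1P[y yE].
have : y \in links a b :\ x by rewrite yE inE.
rewrite !inE => /and3P[yx ay by'].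
have ly : lev y = k.+1.
  have h1 := lev_adj2 ay; have h2 := lev_adj ay; rewrite -la.
  have n1 : lev y <> lev a by move=> E; apply: (no_level ab by' ay lab _ an); rewrite E.
  have n2 : lev a <> (lev y).+1.
    by move=> E; move: yx; rewrite (unique_common ab lab an ay by' ax bx E lx) eqxx.
  by move: h1 h2 n1 n2; lia.
exists x, y; rewrite -lx la; split=> //.
have xe z : z \in links a b -> z \notin e.
  rewrite eE !inE negb_or => /andP[az bz].
  by rewrite eq_sym (adj_neq az) eq_sym (adj_neq bz).
have yL : y \in links a b by rewrite !inE ay.
have nxy : x |: e != y |: e.
  apply/eqP => /setP/(_ x); rewrite !inE eqxx /= (negbTE (xe x xL)) orbF => /esym/eqP E.
  by rewrite E eqxx in yx.
split=> //; have eEd : e \in edges K by rewrite eE adj_edge.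
apply/esym/eqP; rewrite eqEcard (card_edge_triangles an eEd) ?eE ?inE ?eqxx // -eE cards2 nxy andbT.
by rewrite subUset !sub1set !inE !subsetUr !andbT eE;
   have := setU1_triangle ab ax bx; have := setU1_triangle ab ay by'; rewrite !inE => -> ->.
Qed.

(** Levels go up to n + 1, since a triangle that meets the ball may have its level edge just
    outside. *)
Definition level_edges : {set {set V}} := [set e in edges K | [exists k : 'I_n.+2, e \subset sphere k]].

(** Levels in a triangle differ by at most one and are not all equal, so exactly one pair of corners
    shares a level. *)
Lemma level_edge_unique T w : T \in triangles K -> w \in T -> lev w <= n ->
  #|[set e in level_edges | e \subset T]| = 1.
Proof.
move=> Tt wT wn; have [KT /eqP/card3P[a [b [c [ab ac bc TE]]]]] := triangleP Tt.
have [aT bT cT] : [/\ a \in T, b \in T & c \in T] by rewrite TE !inE !eqxx !orbT.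
have ab' := triangle_adj KD Tt aT bT ab; have ac' := triangle_adj KD Tt aT cT ac.
have bc' := triangle_adj KD Tt bT cT bc.
have Tn u : u \in T -> lev u <= n.+1.
  move=> uT; have [->|uw] := eqVneq u w; first exact: leqW.
  by apply: leq_trans (lev_adj (triangle_adj KD Tt uT wT uw)) _.
have levE u u' : u \in T -> u' \in T -> u != u' -> ([set u; u'] \in level_edges) = (lev u == lev u').
  move=> uT u'T uu'; rewrite inE (adj_edge (triangle_adj KD Tt uT u'T uu')) /=.
  apply/existsP/eqP => [[k]|E]; first by rewrite setU2_sub !inE => /andP[/eqP -> /eqP ->].
  by exists (inord (lev u)); rewrite setU2_sub !inE inordK ?ltnS ?Tn // E eqxx.
have nall : ~ (lev a = lev b /\ lev b = lev c).
  move=> [h1 h2]; apply: (no_level ab' bc' ac' h1 h2).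
  by move: wT; rewrite TE !inE => /orP[/orP[]|] /eqP E; move: wn; rewrite E ?h1 ?h2 // -?h2.
have one (P : {set V} -> bool) : (P [set a; b] + P [set a; c] + P [set b; c] = 1)%N ->
    #|[set e in pairs T | P e]| = 1.
  move=> h; rewrite TE; have : odd #|[set e in pairs [set a; b; c] | P e]|.
    rewrite odd_bigaddb; have -> : \big[addb/false]_e ((e \in pairs [set a; b; c]) && P e) =
        \big[addb/false]_(e in pairs [set a; b; c]) P e.
      by rewrite [RHS]big_mkcond; apply: eq_bigr => e _; case: ifP.
    by rewrite big_pairs3 //; move: h; case: (P _); case: (P _); case: (P _).
  have : #|[set e in pairs [set a; b; c] | P e]| <= 2; last by case: #|_| => [|[|[]]].
  rewrite leqNgt; apply/negP => h3.
  have /eqP E : [set e in pairs [set a; b; c] | P e] == pairs [set a; b; c].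
    rewrite eqEcard; apply/andP; split; first by apply/subsetP => e; rewrite inE => /andP[].
    have T3 : #|[set a; b; c]| = 3 by rewrite -TE; case: (triangleP Tt).
    by rewrite {1}/pairs cards_draws T3.
  have allP e : e \in pairs [set a; b; c] -> P e by rewrite -E inE => /andP[].
  by move: h; rewrite !allP // inE cards2 ?ab ?ac ?bc andbT setU2_sub !inE !eqxx ?orbT.
rewrite -(one (fun e => e \in level_edges)).
  apply: eq_card => e; rewrite !inE; have [eT|] := boolP (e \subset T); last by rewrite !andbF.
  by rewrite andbT /=; case: (e \in K); case: (#|e| == 2).
rewrite !levE //; have := lev_adj ab'; have := lev_adj2 ab'; have := lev_adj ac'; have := lev_adj2 ac'.
by have := lev_adj bc'; have := lev_adj2 bc'; move: nall; lia.
Qed.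

Lemma sum_level_edges (h : {set V} -> nat) :
  \sum_(e in level_edges) h e = \sum_(k < n.+2) \sum_(e in sphere_edges k) h e.
Proof.
rewrite (exchange_big_dep (fun e => e \in level_edges)) /=; last first.
  move=> k e _; rewrite !inE => /andP[-> s]; apply/existsP; exists k; exact: s.
apply: eq_bigr => e; rewrite inE => /andP[eE /existsP[k ek]].
rewrite (bigD1 k) /=; last by move: eE; rewrite !inE => ->.
rewrite big1 ?addn0 // => j /andP[]; rewrite !inE => /andP[/andP[_ /cards2P[a [b [_ eE']]]] ej] jk.
have ae : a \in e by rewrite eE' !inE eqxx.
have := subsetP ej _ ae; have := subsetP ek _ ae; rewrite !inE => /eqP -> /eqP kj.
by move: jk; rewrite -val_eqE /= kj eqxx.
Qed.

Lemma sum_triangles (F : {set V} -> nat) :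
  (forall T, T \in triangles K -> 0 < F T -> exists2 w, w \in T & lev w <= n) ->
  \sum_(T in triangles K) F T =
  \sum_(k < n.+2) \sum_(e in sphere_edges k) \sum_(T in [set T in triangles K | e \subset T]) F T.
Proof.
move=> hF; rewrite -sum_level_edges.
rewrite (exchange_big_dep (fun T => T \in triangles K)) /=; last by move=> e T _; rewrite inE => /andP[].
apply: eq_bigr => T Tt; rewrite sum_nat_const.
have [->|F0] := posnP (F T); first by rewrite muln0.
have [w wT wn] := hF T Tt F0; rewrite -[LHS]mul1n -(level_edge_unique Tt wT wn); congr (_ * _).
by apply: eq_card => e; rewrite inE [RHS]unfold_in /=; congr (_ && _); rewrite inE Tt.
Qed.

Lemma sum_ord_delta N k (h : nat -> nat) : k < N -> \sum_(j < N) (val j == k) * h j = h k.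
Proof.
move=> kN; rewrite (bigD1 (Ordinal kN)) //= eqxx mul1n big1 ?addn0 // => j jk.
by rewrite (_ : (val j == k) = false) // -[k]/(val (Ordinal kN)) val_eqE; exact/negbTE.
Qed.

Lemma sphere_edge_cone k e x (P : pred V) (chi : V -> nat) : e \in sphere_edges k -> lev x <> k ->
  \sum_(w in x |: e | P w) chi w = P x * chi x + \sum_(w in e | P w) chi w.
Proof.
rewrite !inE => /andP[_ /subsetP s] xk; have xe : x \notin e.
  by apply/negP => /s; rewrite inE => /eqP.
by rewrite big_mkcondr big_setU1 //= -big_mkcondr; case: (P x); rewrite ?mul1n ?mul0n.
Qed.

Lemma sphere_edge_sum k j e (chi : V -> nat) : e \in sphere_edges k ->
  \sum_(w in e | lev w == j) chi w = (k == j) * \sum_(w in e) chi w.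
Proof.
rewrite !inE => /andP[_ /subsetP s]; have [<-|kj] := eqVneq k j.
  by rewrite mul1n; apply: eq_bigl => w; apply: andb_idr => /s; rewrite inE => /eqP ->.
by rewrite big1 ?mul0n // => w /andP[/s]; rewrite inE => /eqP ->; rewrite (negbTE kj).
Qed.

(* Both sides count the triangles with a vertex on the sphere of radius [k], each listed under its
   unique edge whose end points have the same level. *)
Theorem sphere_recurrence k m (chi : V -> nat) : 0 < k -> k < n ->
  (forall T, T \in triangles K -> (forall w, w \in T -> lev w <= n) -> \sum_(w in T) chi w = m) ->
  \sum_(w in sphere k) chi w * #|nbrs K w| + \sum_(e in sphere_edges k.+1) \sum_(w in e) chi w +
    \sum_(e in sphere_edges k.-1) \sum_(w in e) chi w =
  2 * \sum_(e in sphere_edges k) \sum_(w in e) chi w + m * (#|sphere_edges k.+1| + #|sphere_edges k.-1|).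
Proof.
move=> k0 kn hm; pose F T := \sum_(w in T | lev w == k) chi w.
have -> : \sum_(w in sphere k) chi w * #|nbrs K w| = \sum_(T in triangles K) F T.
  rewrite (exchange_big_dep (fun w => w \in sphere k)) /=; last by move=> T w _; rewrite inE => /andP[].
  apply: eq_bigr => w; rewrite inE => /eqP wk; rewrite sum_nat_const mulnC; congr (_ * _).
  have wn : lev w <= n by rewrite wk ltnW.
  have := sum_edge_triangles KD w (subxx (triangles K)).
  rewrite (eq_bigr (fun=> 2)) => [|u]; last first.
    by rewrite inE => wu; apply: (card_edge_triangles wn (adj_edge wu)); rewrite !inE eqxx.
  rewrite sum_nat_const mulnC => /eqP; rewrite eqn_pmul2l // => /eqP ->.
  by apply: eq_card => T; rewrite inE [RHS]unfold_in /= wk eqxx andbT.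
rewrite sum_triangles => [|T Tt]; last first.
  rewrite lt0n => F0; have [/existsP[w /andP[wT /eqP wk]]|/existsPn h] := boolP [exists w in T, lev w == k].
    by exists w => //; rewrite wk ltnW.
  move: F0; rewrite /F big1 // => w /andP[wT wk]; by have := h w; rewrite wT wk.
pose S j := \sum_(e in sphere_edges j) \sum_(w in e) chi w.
rewrite -/(S k.+1) -/(S k.-1) -/(S k).
have lt1 : k.+1 < n.+2 by rewrite ltnS ltnW.
have lt2 : k.-1 < n.+2 by move: k0 kn; lia.
have lt3 : k < n.+2 by move: kn; lia.
(* An edge of level [k] is counted in its two triangles. One of level k + 1 contributes its lower
   apex, one of level k - 1 its upper apex, and an apex weighs [m] minus the weight of the edge. *)
have E j : j < n.+2 -> \sum_(e in sphere_edges j) \sum_(T in [set T in triangles K | e \subset T]) F T +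
    (j == k.+1) * S j + (j == k.-1) * S j =
    (j == k) * (2 * S j) + m * ((j == k.+1) * #|sphere_edges j| + (j == k.-1) * #|sphere_edges j|).
  move=> jn; have [->|j0] := posnP j.
    by rewrite /S !sphere_edges0 !big_set0 cards0 !muln0.
  have [jn'|jn'] := leqP j n; last first.
    have [-> -> ->] : [/\ (j == k.+1) = false, (j == k.-1) = false & (j == k) = false].
      by split; apply/negbTE; move: k0 kn jn'; clear; lia.
    rewrite !mul0n !muln0 !addn0 big1 // => e eS; rewrite big1 // => T; rewrite inE => /andP[Tt eT].
    have /sphere_edgeP[a [b [ab la lb eE]]] := eS.
    have aT : a \in T by apply: (subsetP eT); rewrite eE !inE eqxx.
    rewrite /F big1 // => w /andP[wT /eqP wk]; exfalso.
    have [wa|wa] := eqVneq w a; first by move: la jn' kn; rewrite -wa wk; clear; lia.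
    by have := lev_adj2 (triangle_adj KD Tt wT aT wa); rewrite la wk; move: jn' kn; clear; lia.
  have -> : m * ((j == k.+1) * #|sphere_edges j| + (j == k.-1) * #|sphere_edges j|) =
      \sum_(e in sphere_edges j) m * ((j == k.+1) + (j == k.-1)).
    by rewrite sum_nat_const; move: (#|_|) => c; clear; case: (j == _); case: (j == _); lia.
  rewrite /S !big_distrr /= -!big_split /=; apply: eq_bigr => e eS.
  have [x [y [lx ly [stE nxy]]]] := level_edge_star j0 jn' eS.
  have Tst : [set x |: e; y |: e] \subset triangles K.
    by rewrite -stE; apply/subsetP => T; rewrite inE => /andP[].
  rewrite stE.
  have xj : lev x <> j by move: lx; clear; lia.
  have yj : lev y <> j by move: ly; clear; lia.
  rewrite big_setU1 ?inE //= big_set1 /F.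
  rewrite !(sphere_edge_cone _ _ eS) //= !(sphere_edge_sum _ _ eS).
  have hx : chi x + \sum_(w in e) chi w = m.
    rewrite -(hm (x |: e)); last 2 first.
    - by apply: (subsetP Tst); rewrite !inE eqxx.
    - move=> w; rewrite !inE => /orP[/eqP ->|we]; first by move: lx jn'; clear; lia.
      by move: eS; rewrite !inE => /andP[_ /subsetP/(_ w we)]; rewrite inE => /eqP ->.
    by have := sphere_edge_cone xpredT chi eS xj; rewrite mul1n !big_mkcondr.
  (* The upper triangle is weighed only for [j = k.-1], where it stays inside the ball and [hm]
     applies. *)
  have hy : (j == k.-1) -> chi y + \sum_(w in e) chi w = m.
    move=> jk; rewrite -(hm (y |: e)); last 2 first.
    - by apply: (subsetP Tst); rewrite !inE eqxx orbT.
    - move=> w; rewrite !inE => /orP[/eqP ->|we]; first by move: ly jk k0 kn; clear; lia.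
      by move: eS; rewrite !inE => /andP[_ /subsetP/(_ w we)]; rewrite inE => /eqP ->.
    by have := sphere_edge_cone xpredT chi eS yj; rewrite mul1n !big_mkcondr.
  have -> : (lev x == k) = (j == k.+1) by move: lx; clear; lia.
  have -> : (lev y == k) = (j == k.-1) by move: ly j0 k0; clear; lia.
  move: (\sum_(w in e) chi w) (chi x) (chi y) hx hy => c cx cy.
  by move: k0; clear; case: eqP => h1; case: eqP => h2; case: eqP => h3; lia.
pose A j := \sum_(e in sphere_edges j) \sum_(T in [set T in triangles K | e \subset T]) F T.
pose L j := #|sphere_edges j|.
have : \sum_(j < n.+2) (A j + (val j == k.+1) * S j + (val j == k.-1) * S j) =
       \sum_(j < n.+2) ((val j == k) * (2 * S j) + m * ((val j == k.+1) * L j + (val j == k.-1) * L j)).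
  by apply: eq_bigr => j _; exact: E.
rewrite !big_split /= -big_distrr /= big_split /= !(sum_ord_delta _ lt1) !(sum_ord_delta _ lt2).
by rewrite (sum_ord_delta (fun j => 2 * S j) lt3).
Qed.

(** Below radius [n] both triangles on a level edge lie in the ball; on the last sphere only the
    lower one does. *)
Theorem card_ball_triangles : 0 < n ->
  #|[set T in triangles K | [forall w in T, lev w <= n]]| =
  #|sphere_edges n| + 2 * \sum_(k < n) #|sphere_edges k|.
Proof.
move=> n0; pose F T : nat := [forall w in T, lev w <= n].
have -> : #|[set T in triangles K | [forall w in T, lev w <= n]]| = \sum_(T in triangles K) F T.
  by rewrite -sum1dep_card big_mkcondr /=; apply: eq_bigr => T _; rewrite /F; case: ifP.
rewrite sum_triangles => [|T Tt]; last first.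
  rewrite /F; case: (boolP [forall w in T, lev w <= n]) => // /forallP h _.
  have [w wT] := set0Pn _ (dl_neq0 KD (triangleP Tt).1).
  by exists w => //; have := h w; rewrite wT.
have lt1 : n < n.+2 by [].
have E j : j < n.+2 -> \sum_(e in sphere_edges j) \sum_(T in [set T in triangles K | e \subset T]) F T =
    (j == n) * #|sphere_edges j| + (j < n) * (2 * #|sphere_edges j|).
  move=> jn; have [->|j0] := posnP j; first by rewrite !sphere_edges0 !big_set0 cards0 !muln0.
  have [jn'|jn'] := leqP j n; last first.
    have [-> ->] : [/\ (j == n) = false & (j < n) = false] by split; apply/negbTE; move: jn'; clear; lia.
    rewrite big1 // => e eS; rewrite big1 // => T; rewrite inE => /andP[Tt eT].
    have /sphere_edgeP[a [b [ab la lb eE]]] := eS.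
    have aT : a \in T by apply: (subsetP eT); rewrite eE !inE eqxx.
    rewrite /F; case: (boolP [forall w in T, lev w <= n]) => // /forallP/(_ a).
    by rewrite aT la leqNgt jn'.
  have -> : (j == n) * #|sphere_edges j| + (j < n) * (2 * #|sphere_edges j|) =
      \sum_(e in sphere_edges j) ((j == n) + (j < n) * 2).
    by rewrite sum_nat_const; move: (#|_|) => c; clear; case: (j == _); case: (j < _); lia.
  apply: eq_bigr => e eS.
  have [x [y [lx ly [stE nxy]]]] := level_edge_star j0 jn' eS.
  have lE w : w \in e -> lev w = j.
    by move=> we; move: eS; rewrite !inE => /andP[_ /subsetP/(_ w we)]; rewrite inE => /eqP.
  rewrite stE big_setU1 ?inE //= big_set1 /F.
  have -> : [forall w in x |: e, lev w <= n].
    apply/forallP => w; apply/implyP; rewrite !inE => /orP[/eqP ->|/lE -> //].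
    by move: lx jn'; clear; lia.
  have -> : [forall w in y |: e, lev w <= n] = (j < n).
    apply/forallP/idP => [h|jn'' w]; first by have := h y; rewrite setU11 ly.
    by apply/implyP; rewrite !inE => /orP[/eqP ->|/lE -> //]; rewrite ly.
  by rewrite /=; move: jn'; clear; rewrite leq_eqVlt; case: ltngtP => //=; lia.
pose L j := #|sphere_edges j|.
rewrite (eq_bigr (fun j : 'I_n.+2 => (val j == n) * L j + (val j < n) * (2 * L j))) => [|j _]; last exact: E.
rewrite big_split /= (sum_ord_delta _ lt1); congr (_ + _).
rewrite !big_ord_recr /= ltnn ltnNge leqnSn !mul0n !addn0 big_distrr /=.
by apply: eq_bigr => j _; rewrite ltn_ord mul1n.
Qed.

End Counting.

(** * Linear recurrences *)

Local Open Scope ring_scope.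

Section Recurrence.
Variable R : realType.
Implicit Types (mu rho lam : R) (u : nat -> R) (k n : nat).

(* Consecutive Chebyshev polynomials of the second kind at [mu / 2], shifted by one. *)
Fixpoint fund_pair mu k : R * R :=
  if k is j.+1 then ((fund_pair mu j).2, mu * (fund_pair mu j).2 - (fund_pair mu j).1) else (0, 1).

Definition fund mu k : R := (fund_pair mu k).1.

Lemma fund0 mu : fund mu 0 = 0. Proof. by []. Qed.
Lemma fund1 mu : fund mu 1 = 1. Proof. by []. Qed.
Lemma fundSS mu k : fund mu k.+2 = mu * fund mu k.+1 - fund mu k. Proof. by []. Qed.

Lemma recurrence_fund mu u n : u 0%N = 0 ->
  (forall k, (k.+1 < n)%N -> u k.+2 + u k = mu * u k.+1) ->
  forall k, (k <= n)%N -> u k = u 1%N * fund mu k.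
Proof.
move=> u0 hu k; suff : (k <= n)%N -> u k = u 1%N * fund mu k /\
    ((k < n)%N -> u k.+1 = u 1%N * fund mu k.+1) by move=> h /h[].
elim: k => [|k IH] kn; first by rewrite u0 fund0 mulr0 fund1 mulr1.
have [h1 h2] := IH (ltnW kn); split; first exact: h2.
by move=> kn'; rewrite fundSS mulrBr -h1 mulrCA -h2 // -(hu k kn'); ring.
Qed.

Lemma bernoulli (h : R) k : 0 <= h -> 1 + k%:R * h <= (1 + h) ^+ k.
Proof.
move=> h0; elim: k => [|k IH]; first by rewrite mul0r addr0 expr0.
rewrite exprS -natr1; have kh : 0 <= k%:R * h * h by rewrite !mulr_ge0.
have : (1 + h) * (1 + k%:R * h) <= (1 + h) * (1 + h) ^+ k by rewrite ler_wpM2l //; lra.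
by lra.
Qed.

Lemma pow_dominates rho lam (e : R) : 0 < rho -> rho < lam -> 0 < e ->
  exists N : nat, forall n, (N <= n)%N -> rho ^+ n <= e * lam ^+ n.
Proof.
move=> r0 rl e0; pose h := lam / rho - 1.
have h0 : 0 < h by rewrite subr_gt0 ltr_pdivlMr // mul1r.
exists (Num.truncn (1 / (e * h))).+1 => n Nn.
have hn : 1 / (e * h) < n%:R.
  apply: lt_le_trans (Num.Theory.truncnS_gt _) _; by rewrite ler_nat.
have B := bernoulli n (ltW h0).
have E : lam ^+ n = (1 + h) ^+ n * rho ^+ n.
  by rewrite -exprMn; congr (_ ^+ _); rewrite /h; field; rewrite gt_eqF.
have rn : 0 < rho ^+ n by rewrite exprn_gt0.
rewrite E mulrA -[leLHS]mul1r ler_pM2r //.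
rewrite ltr_pdivrMr ?mulr_gt0 // in hn.
have : e * (1 + n%:R * h) <= e * (1 + h) ^+ n by rewrite ler_pM2l.
have : n%:R * (e * h) = e * (n%:R * h) by ring.
by lra.
Qed.

(* [V] is a quadratic Lyapunov function: [rho ^+ 2 * V k - V k.+1] is a nonnegative square. *)
Lemma fund_bound mu rho : 1 <= rho -> `|mu| < rho + rho^-1 ->
  exists2 C, 0 <= C & forall k, `|fund mu k| <= C * rho ^+ k.
Proof.
move=> r1 hmu; have r0 : 0 < rho by lra.
pose V k := (rho ^+ 2 + 1) * (fund mu k.+1 ^+ 2 + rho ^+ 2 * fund mu k ^+ 2)
   - 2 * mu * rho ^+ 2 * fund mu k.+1 * fund mu k.
have Vstep k : V k.+1 <= rho ^+ 2 * V k.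
  rewrite -subr_ge0; rewrite (_ : _ - _ =
    (rho ^+ 2 - 1) * (mu * fund mu k.+1 - (rho ^+ 2 + 1) * fund mu k) ^+ 2).
    by rewrite mulr_ge0 ?sqr_ge0 // subr_ge0 exprn_ege1.
  by rewrite /V fundSS; ring.
have Vk k : V k <= rho ^+ (2 * k) * (rho ^+ 2 + 1).
  elim: k => [|k IH]; first by rewrite /V fund0 fund1 muln0 expr0; lra.
  apply: le_trans (Vstep k) _; rewrite mulnS exprD -mulrA ler_wpM2l // exprn_ge0 //; lra.
(* The hypothesis on [mu] says that [c] is positive, which makes the quadratic form [V] definite. *)
pose c := rho ^+ 2 + 1 - `|mu| * rho.
have c0 : 0 < c.
  rewrite /c subr_gt0; have : `|mu| * rho < (rho + rho^-1) * rho by rewrite ltr_pM2r.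
  by rewrite mulrDl mulVf ?gt_eqF // expr2.
have lower k : c * (rho ^+ 2 * fund mu k ^+ 2) <= V k.
  set x := fund mu k.+1; set y := fund mu k.
  have h1 : mu * (x * (rho * y)) <= `|mu| * (`|x| * `|rho * y|).
    by rewrite -!normrM; exact: ler_norm.
  have h2 : 2 * (`|x| * `|rho * y|) <= x ^+ 2 + (rho * y) ^+ 2.
    have := sqr_ge0 (`|x| - `|rho * y|); rewrite sqrrB !real_normK ?num_real //; lra.
  have h3 : `|mu| * rho * (2 * (`|x| * `|rho * y|)) <= `|mu| * rho * (x ^+ 2 + (rho * y) ^+ 2).
    by rewrite ler_wpM2l // mulr_ge0 // ltW.
  have h4 : rho * (mu * (x * (rho * y))) <= rho * (`|mu| * (`|x| * `|rho * y|)) by rewrite ler_wpM2l // ltW.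
  have h5 : 0 <= c * x ^+ 2 by rewrite mulr_ge0 ?sqr_ge0 // ltW.
  have -> : V k = c * x ^+ 2 + c * (rho ^+ 2 * y ^+ 2) +
     (`|mu| * rho * (x ^+ 2 + (rho * y) ^+ 2) - 2 * (rho * (mu * (x * (rho * y))))).
    by rewrite /V /c -/x -/y; ring.
  by lra.
pose D := (rho ^+ 2 + 1) / (c * rho ^+ 2).
have D0 : 0 <= D by rewrite divr_ge0 ?(mulr_ge0 (ltW c0)) ?sqr_ge0 // addr_ge0 ?sqr_ge0.
exists (1 + D); first by rewrite addr_ge0.
move=> k; rewrite -(@ler_pXn2r _ 2) ?nnegrE ?mulr_ge0 ?exprn_ge0 ?addr_ge0 ?(ltW r0) //.
rewrite exprMn -exprM mulnC -normrX ger0_norm ?sqr_ge0 //.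
have f1 : fund mu k ^+ 2 <= D * rho ^+ (2 * k).
  rewrite /D mulrAC ler_pdivlMr ?mulr_gt0 ?exprn_gt0 //.
  have := le_trans (lower k) (Vk k); set A := fund mu k ^+ 2; lra.
apply: le_trans f1 _; rewrite ler_wpM2r ?exprn_ge0 ?(ltW r0) //; nra.
Qed.

Lemma sum_fund mu n : (mu - 2) * \sum_(k < n.+1) fund mu k = fund mu n.+1 - fund mu n - 1.
Proof.
elim: n => [|n IH]; first by rewrite big_ord1 fund0 fund1; ring.
by rewrite big_ord_recr /= mulrDr IH fundSS; ring.
Qed.

End Recurrence.

(** * The limit of the ratio *)

Section Limit.
Variable R : realType.
Implicit Types S T : R.

Lemma root_disc_gt S T : 0 < S -> 0 < T -> T < Num.sqrt (T ^+ 2 + 8 * S * T).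
Proof.
move=> S0 T0; have ST1 : 0 < S * T by rewrite mulr_gt0.
have T2 : 0 <= T ^+ 2 by exact: sqr_ge0.
rewrite -(@ltr_pXn2r _ 2) ?nnegrE ?sqrtr_ge0 ?(ltW T0) // sqr_sqrtr; lra.
Qed.

(** For T at most 8, squaring turns the claim into T (S + 2) > 8, which under the two lower bounds
    fails only in the flat case S = T = 2. *)
Lemma root_gt2 S T : 2 <= S -> 2 <= T -> 4 < S + T ->
  2 < (T + Num.sqrt (T ^+ 2 + 8 * S * T)) / 4.
Proof.
move=> S2 T2 ST; have S0 : 0 < S by lra.
have T0 : 0 < T by lra.
have qT := root_disc_gt S0 T0.
have T20 : 0 <= T ^+ 2 by exact: sqr_ge0.
have ST4 : 0 <= (T - 2) * (S - 2) by rewrite mulr_ge0 // subr_ge0.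
suff : 8 - T < Num.sqrt (T ^+ 2 + 8 * S * T) by lra.
have [T8|T8] := ltP 8 T; first by lra.
have ST1 : 0 < S * T by rewrite mulr_gt0.
rewrite -(@ltr_pXn2r _ 2) ?nnegrE ?sqrtr_ge0 ?subr_ge0 // sqr_sqrtr ?sqrrB; lra.
Qed.

Lemma root_exists (p : R) : 2 < p -> exists2 l, 1 < l & l + l^-1 = p.
Proof.
move=> p2; pose d := Num.sqrt (p ^+ 2 - 4).
have p4 : 0 <= p ^+ 2 - 4.
  by rewrite (_ : _ - 4 = (p - 2) * (p + 2)); [rewrite mulr_ge0 //; lra | ring].
have dE : d ^+ 2 = p ^+ 2 - 4 by rewrite sqr_sqrtr.
have d0 : 0 <= d by exact: sqrtr_ge0.
exists ((p + d) / 2); first by lra.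
have l0 : p + d != 0 by rewrite gt_eqF //; lra.
have -> : ((p + d) / 2)^-1 = (p - d) / 2; last by field.
have E : (p + d) * (p - d) = 4 by rewrite mulrC -subr_sqr dE; ring.
by apply: (mulfI l0); rewrite mulrA E; field.
Qed.

(** [N] is quantified before the sequences because it has to serve all discs. They enter through a
    common factor [a], which cancels, and a coefficient [r] bounded by [c]. *)
Theorem ratio_limit S T (e : R) : 2 <= S -> 2 <= T -> 4 < S + T ->
  let P := (T + Num.sqrt (T ^+ 2 + 8 * S * T)) / 4 in 0 < e -> exists N : nat, forall n, (N <= n)%N ->
  forall sg ta : nat -> R, sg 0%N = 0 -> ta 0%N = 0 -> 0 <= sg 1%N -> 0 <= ta 1%N ->
  0 < sg 1%N + ta 1%N ->
  (forall k, (k.+1 < n)%N -> sg k.+2 + sg k = T / 2 * ta k.+1 /\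
     ta k.+2 + ta k = S * sg k.+1 + T / 2 * ta k.+1) ->
  `| ((sg n + ta n) + 2 * \sum_(k < n) (sg k + ta k)) / (sg n + ta n) -
     Num.sqrt ((P + 2) / (P - 2)) | < e.
Proof.
move=> S2 T2 ST P e0; have P2 : 2 < P := root_gt2 S2 T2 ST.
have S0 : 0 < S by lra.
have T0 : 0 < T by lra.
have ST0 : 0 < S * T by rewrite mulr_gt0.
have T20 : 0 <= T ^+ 2 by exact: sqr_ge0.
have := root_disc_gt S0 T0; rewrite {}/P in P2 *.
have : Num.sqrt (T ^+ 2 + 8 * S * T) ^+ 2 = T ^+ 2 + 8 * S * T by rewrite sqr_sqrtr; lra.
move: (Num.sqrt (T ^+ 2 + 8 * S * T)) P2 => q P2 qE' qT.
set P := (T + q) / 4 in P2 *; pose mu := (T - q) / 4.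
have mu0 : mu < 0.
  by rewrite /mu; lra.
have muP : `|mu| < P by rewrite ltr0_norm // /mu /P; lra.
have [lam lam1 lamE] := root_exists P2.
(* A value strictly between: above 2 it is rho + 1 / rho with rho > 1, above |mu| it lets
   [fund_bound] apply, and below P it gives rho < lam. *)
pose P' := (Num.max `|mu| 2 + P) / 2.
have mx : Num.max `|mu| 2 < P by rewrite gt_max muP.
have mx1 : `|mu| <= Num.max `|mu| 2 by rewrite le_max lexx.
have mx2 : 2 <= Num.max `|mu| 2 by rewrite le_max lexx orbT.
have P'2 : 2 < P' by rewrite /P'; lra.
have [rho rho1 rhoE] := root_exists P'2.
have rholam : rho < lam.
  rewrite ltNge; apply/negP => h.
  have : P <= P'; last by rewrite /P'; lra.
  rewrite -lamE -rhoE; rewrite -subr_ge0.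
  rewrite (_ : _ - _ = (rho - lam) * (1 - (rho * lam)^-1)); last by field; rewrite !gt_eqF //; lra.
  by rewrite mulr_ge0 ?subr_ge0 // invf_le1 ?mulr_gt0 //; nra.
have [C C0 hC] : exists2 C, 0 <= C & forall k, `|fund mu k| <= C * rho ^+ k.
  by apply: fund_bound; rewrite ?(ltW rho1) // rhoE /P'; lra.
pose L := (lam + 1) / (lam - 1).
have LE : Num.sqrt ((P + 2) / (P - 2)) = L.
  have -> : (P + 2) / (P - 2) = L ^+ 2.
    have l0 : lam != 0 by rewrite gt_eqF //; lra.
    have l1 : lam - 1 != 0 by rewrite gt_eqF //; lra.
    have -> : P + 2 = (lam + 1) ^+ 2 / lam by rewrite -lamE; field.
    have -> : P - 2 = (lam - 1) ^+ 2 / lam by rewrite -lamE; field.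
    by rewrite /L; field; rewrite l0 l1.
  by rewrite sqrtr_sqr ger0_norm // divr_ge0 //; lra.
rewrite LE.
have fstep k : fund P k.+1 - lam * fund P k = lam^-1 ^+ k.
  elim: k => [|k IH]; first by rewrite fund0 fund1 mulr0 subr0 expr0.
  rewrite exprS -IH fundSS -lamE; field; rewrite gt_eqF //; lra.
have li1 k : 0 <= lam^-1 ^+ k <= 1.
  by rewrite exprn_ge0 ?invr_ge0 ?exprn_ile1 ?invr_ge0 ?invf_le1 //; lra.
have flow k : lam ^+ k <= fund P k.+1.
  elim: k => [|k IH]; first by rewrite expr0 fund1.
  have := fstep k.+1; have /andP[h1 _] := li1 k.+1.
  have : lam * lam ^+ k <= lam * fund P k.+1 by rewrite ler_pM2l //; lra.
  by rewrite (exprS lam); lra.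
(* The area that corresponds to the lengths [fund m]. *)
pose A (m : R) n := fund m n + 2 * \sum_(k < n) fund m k.
pose B := 2 * (1 + lam) / (lam - 1) ^+ 2.
have B0 : 0 <= B by rewrite divr_ge0 ?sqr_ge0 //; lra.
have AP n : `|A P n.+1 - L * fund P n.+1| <= B.
  have l0 : lam != 0 by rewrite gt_eqF //; lra.
  have l1 : lam - 1 != 0 by rewrite gt_eqF //; lra.
  have Pm2 : P - 2 = (lam - 1) ^+ 2 / lam by rewrite -lamE; field.
  have -> : A P n.+1 - L * fund P n.+1 = 2 * (lam^-1 ^+ n - lam) / (lam - 1) ^+ 2.
    have := sum_fund P n; rewrite Pm2 -(fstep n) /A /L.
    set s := \sum_(k < n.+1) _; set x := fund P n.+1; set y := fund P n => h.
    have -> : s = (x - y - 1) * lam / (lam - 1) ^+ 2.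
      by rewrite -h; field; rewrite l0 l1.
    by field.
  have /andP[h1 h2] := li1 n.
  rewrite normrM [X in _ * X]gtr0_norm ?invr_gt0 ?exprn_gt0 //; last by lra.
  rewrite ler_wpM2r ?invr_ge0 ?sqr_ge0 // normrM gtr0_norm // ler_wpM2l // ler_norml.
  by apply/andP; split; lra.
pose D := C * (1 + 2 / (rho - 1) + L).
have L0 : 0 <= L by rewrite divr_ge0 //; lra.
have rr : 0 < rho - 1 by lra.
have D0 : 0 <= D by rewrite mulr_ge0 // addr_ge0 // addr_ge0 // divr_ge0 // ltW.
have Amu n : `|A mu n - L * fund mu n| <= D * rho ^+ n.
  have hs : `|\sum_(k < n) fund mu k| <= C * (rho ^+ n / (rho - 1)).
    apply: le_trans (ler_norm_sum _ _ _) _.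
    apply: (@le_trans _ _ (\sum_(k < n) C * rho ^+ k)); first by apply: ler_sum => k _; exact: hC.
    rewrite -mulr_sumr ler_wpM2l // ler_pdivlMr //.
    elim: n => [|n IH]; first by rewrite big_ord0 mul0r expr0.
    by rewrite big_ord_recr /= mulrDl exprS; lra.
  have h1 := hC n; have h2 : `|L * fund mu n| <= L * (C * rho ^+ n) by rewrite normrM ger0_norm // ler_wpM2l.
  have h3 : `|2 * \sum_(k < n) fund mu k| <= 2 * (C * (rho ^+ n / (rho - 1))).
    by rewrite normrM gtr0_norm // ler_wpM2l.
  apply: le_trans (ler_normB _ _) _; apply: le_trans (lerD (ler_normD _ _) (lexx _)) _.
  rewrite (_ : D * rho ^+ n = C * rho ^+ n + 2 * (C * (rho ^+ n / (rho - 1))) + L * (C * rho ^+ n)).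
    by lra.
  by rewrite /D; field; rewrite gt_eqF.
pose c := `|S - P| / (S - mu).
have Smu : 0 < S - mu by lra.
have c0 : 0 <= c by rewrite divr_ge0 // ltW.
(* With z = rho^(n + 1), the condition lam^n >= F z leaves a denominator of at least (4 G / e + 1)
   z, against a numerator of at most G z, where G = B + c D. *)
pose F := 2 * c * C + 4 * (B + c * D) / e + 1.
have G0 : 0 <= B + c * D by rewrite addr_ge0 // mulr_ge0.
have F0 : 0 < F.
  have h1 : 0 <= 2 * c * C by rewrite mulr_ge0 // mulr_ge0.
  have h2 : 0 <= 4 * (B + c * D) / e by rewrite divr_ge0 ?(ltW e0) // mulr_ge0.
  by rewrite /F; lra.
have l0 : 0 < lam by lra.
have [N hN] := pow_dominates (e := (F * lam)^-1) (lt_trans ltr01 rho1) rholam (ltac:(by rewrite invr_gt0 mulr_gt0)).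
exists N.+1 => -[|n] // Nn sg ta sg0 ta0 sg1 ta1 st1 rec.
have hn : F * rho ^+ n.+1 <= lam ^+ n.
  have := hN n.+1 (leqW Nn); rewrite (exprSr lam).
  have -> : (F * lam)^-1 * (lam ^+ n * lam) = lam ^+ n / F by field; rewrite !gt_eqF.
  by rewrite ler_pdivlMr // mulrC.
(* Coordinates along the left eigenvectors of the recurrence matrix for P and [mu]; each satisfies a
   scalar recurrence. *)
pose yp k := S * sg k + P * ta k; pose ym k := S * sg k + mu * ta k.
have ypE k : (k <= n.+1)%N -> yp k = yp 1%N * fund P k.
  apply: recurrence_fund => [|j jn]; first by rewrite /yp sg0 ta0 !mulr0 addr0.
  have [E1 E2] := rec j jn; rewrite /yp.
  have -> : S * sg j.+2 + P * ta j.+2 + (S * sg j + P * ta j) =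
    S * (sg j.+2 + sg j) + P * (ta j.+2 + ta j) by ring.
  have PP : P ^+ 2 = S * T / 2 + P * T / 2 by rewrite /P expr2; lra.
  rewrite E1 E2 (_ : P * (S * sg j.+1 + P * ta j.+1) = P * S * sg j.+1 + P ^+ 2 * ta j.+1); last by ring.
  by rewrite PP; ring.
have ymE k : (k <= n.+1)%N -> ym k = ym 1%N * fund mu k.
  apply: recurrence_fund => [|j jn]; first by rewrite /ym sg0 ta0 !mulr0 addr0.
  have [E1 E2] := rec j jn; rewrite /ym.
  have -> : S * sg j.+2 + mu * ta j.+2 + (S * sg j + mu * ta j) =
    S * (sg j.+2 + sg j) + mu * (ta j.+2 + ta j) by ring.
  have PP : mu ^+ 2 = S * T / 2 + mu * T / 2 by rewrite /mu expr2; lra.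
  rewrite E1 E2 (_ : mu * (S * sg j.+1 + mu * ta j.+1) = mu * S * sg j.+1 + mu ^+ 2 * ta j.+1); last by ring.
  by rewrite PP; ring.
have a0 : 0 < yp 1%N by rewrite /yp; nra.
(* Nonnegative initial values and |mu| < P bound the [mu] component by the P component, uniformly in
   the disc. *)
have ba : `|ym 1%N| <= yp 1%N.
  apply: le_trans (ler_normD _ _) _.
  rewrite [ `|S * _|]normrM [ `|mu * _|]normrM (gtr0_norm S0) (ger0_norm sg1) (ger0_norm ta1) lerD2l.
  by rewrite ler_wpM2r // ltW.
pose a := (S - mu) * yp 1%N / (S * (P - mu)).
pose r := - ((S - P) / (S - mu)) * (ym 1%N / yp 1%N).
have nz : [/\ S != 0, P - mu != 0, S - mu != 0 & yp 1%N != 0] by split; rewrite gt_eqF //; lra.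
have [nz1 nz2 nz3 nz4] := nz.
have rc : `|r| <= c.
  rewrite /r mulNr normrN normrM normrM normfV (gtr0_norm Smu) -[leRHS]mulr1.
  rewrite ler_wpM2l // normrM normfV (gtr0_norm a0) ler_pdivrMr // mul1r //.
have ellE k : (k <= n.+1)%N -> sg k + ta k = a * (fund P k + r * fund mu k).
  move=> kn; have -> : sg k + ta k = ((S - mu) * yp k - (S - P) * ym k) / (S * (P - mu)).
    by rewrite /yp /ym; field; rewrite nz1 nz2.
  by rewrite (ypE k kn) (ymE k kn) /a /r; field; rewrite nz1 nz2 nz3 nz4.
have a1 : 0 < a by rewrite /a divr_gt0 // mulr_gt0 //; lra.
have sumE : \sum_(k < n.+1) (sg k + ta k) =
    a * (\sum_(k < n.+1) fund P k + r * \sum_(k < n.+1) fund mu k).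
  rewrite mulr_sumr -big_split mulr_sumr; apply: eq_bigr => k _.
  by rewrite ellE // ltnW.
rewrite sumE ellE //.
set u := fund P n.+1; set w := fund mu n.+1.
set U := \sum_(k < n.+1) fund P k; set Wm := \sum_(k < n.+1) fund mu k.
have hA : `|(u + 2 * U) - L * u| <= B := AP n.
have hM : `|(w + 2 * Wm) - L * w| <= D * rho ^+ n.+1 := Amu n.+1.
have hw : `|w| <= C * rho ^+ n.+1 := hC n.+1.
have hu : lam ^+ n <= u := flow n.
have rn1 : 1 <= rho ^+ n.+1 by rewrite exprn_ege1 // ltW.
set z := rho ^+ n.+1 in hn hM hw rn1 *.
have hrw : `|r * w| <= c * (C * z) by rewrite normrM ler_pM.
have hrM : `|r * ((w + 2 * Wm) - L * w)| <= c * (D * z) by rewrite normrM ler_pM.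
set G := B + c * D in G0.
have Fz : F * z = 2 * (c * (C * z)) + 4 * G / e * z + z by rewrite /F /G; ring.
have z0 : 0 <= z by lra.
have cCz : 0 <= c * (C * z) by rewrite mulr_ge0 // mulr_ge0.
have den : 4 * G / e * z + z <= u + r * w.
  have := ler_norm (- (r * w)); rewrite normrN; lra.
have Gz : 0 <= 4 * G / e * z by rewrite mulr_ge0 // divr_ge0 ?(ltW e0) // mulr_ge0.
have den0 : 0 < u + r * w.
  by apply: lt_le_trans den; lra.
rewrite (_ : _ - L = ((u + 2 * U - L * u) + r * (w + 2 * Wm - L * w)) / (u + r * w)); last first.
  by field; rewrite !gt_eqF.
rewrite normrM normfV (gtr0_norm den0) ltr_pdivrMr //.
apply: le_lt_trans (ler_normD _ _) _.
have BG : `|u + 2 * U - L * u| + `|r * (w + 2 * Wm - L * w)| <= G * z.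
  have : B * 1 <= B * z by rewrite ler_wpM2l.
  have GE : G * z = B * z + c * (D * z) by rewrite /G; ring.
  by lra.
have eden : e * (4 * G / e * z + z) <= e * (u + r * w) by rewrite ler_pM2l.
have eE : e * (4 * G / e * z + z) = 4 * (G * z) + e * z by field; rewrite gt_eqF.
have Gz0 : 0 <= G * z by rewrite mulr_ge0 //; lra.
have ez : 0 < e * z by rewrite mulr_gt0 //; lra.
by lra.
Qed.

End Limit.

(** * Spheres of uniform discs *)

Local Close Scope ring_scope.

Section FsetSets.
Variable V : finType.
Implicit Types (A B : {set V}) (P : {fset V} -> Prop).

Lemma fset_set_inj : injective (fun A => [fset x in A]%fset).
Proof. by move=> A B /fsetP E; apply/setP => x; have := E x; rewrite !finmap.inE. Qed.

Lemma fset_setK (A : {fset V}) : [fset x in [set x | x \in A]]%fset = A.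
Proof. by apply/fsetP => x; rewrite finmap.inE /= inE. Qed.

(** Lengths and areas are defined with [{fset V}], the counting was done with [{set V}]. *)
Lemma card_fset_sets P (Z : {set {set V}}) :
  (forall A, P [fset x in A]%fset <-> A \in Z) -> #|[pred A : {fset V} | `[< P A >]]| = #|Z|.
Proof.
move=> PZ; rewrite -(card_imset _ fset_set_inj); apply: eq_card => A; rewrite inE.
apply/asboolP/imsetP => [PA|[B /PZ PB ->]] //.
by exists [set x | x \in A]; [apply/PZ|]; rewrite fset_setK.
Qed.

End FsetSets.

Section DiscCombinatorics.
Variables (R : realType) (V : finType) (D : complex V).
Hypothesis discD : triangulated_disc R D.

Definition interior_set : {set V} := [set w | `[< interior_vertex R D w >]].

Lemma disc_disc_like : disc_like (simplices D) interior_set.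
Proof.
split.
- exact: simplices_neq0.
- exact: simplices_face.
- exact: (@disc_card_le3 _ _ _ discD _ erefl).
- exact: (@disc_even_boundary _ _ _ discD _ erefl).
- exact: (@disc_edge_le2 _ _ _ discD _ erefl).
- move=> Z w T0 sZ ZT0 wT0 h; rewrite inE asboolE.
  exact: (@disc_even_star _ _ _ discD _ erefl _ _ _ sZ ZT0 wT0 h).
- by move=> w e; rewrite inE asboolE; exact: (@disc_interior_edge _ _ _ discD _ erefl).
Qed.

Lemma adjacentE u w : adjacent D u w = adj (simplices D) u w.
Proof.
have E : [fset x in [set u; w]]%fset = [fset u; w]%fset.
  by apply/fsetP => x; rewrite !finmap.inE /= ?inE.
by rewrite /adjacent /adj -E; congr (_ && _); apply/asboolP/simplicesP.
Qed.

Lemma k_vertexE k w : k_vertex R k D w <-> w \in interior_set /\ #|nbrs (simplices D) w| = k.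
Proof.
rewrite inE asboolE /k_vertex; suff -> : #|[pred x | adjacent D w x]| = #|nbrs (simplices D) w| by [].
by apply: eq_card => x; rewrite [RHS]inE -adjacentE.
Qed.

End DiscCombinatorics.

Section Levels.
Variables (V : finType) (D : complex V) (v : V) (n : nat).
Let K := simplices D.
Implicit Types (u w : V) (m : nat).

Lemma walk_rcons u w m : walk D v u m -> adjacent D u w -> walk D v w m.+1.
Proof.
move=> [p [hp lp <-]] uw; exists (rcons p w).
by rewrite rcons_path hp lp last_rcons size_rcons.
Qed.

Lemma walk_last w m : walk D v w m.+1 -> exists2 u, walk D v u m & adjacent D u w.
Proof.
move=> [p [hp lp sp]]; case/lastP: p hp lp sp => [|p x] //.
rewrite rcons_path last_rcons size_rcons => /andP[hp xw] <- [sp].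
by exists (last v p) => //; exists p.
Qed.

Let walkb w := fun m => `[< walk D v w m >].

(* Vertices that are not reachable from [v] are put at level [n.+1]. *)
Definition level w : nat :=
  if pselect (exists m, walkb w m) is left e then ex_minn e else n.+1.

Lemma level_walk w m : walk D v w m -> walk D v w (level w) /\ level w <= m.
Proof.
move=> wm; rewrite /level; case: pselect => [e|]; last by case; exists m; exact/asboolP.
by case: ex_minnP => k /asboolP hk mn; split=> //; apply: mn; exact/asboolP.
Qed.

Lemma level_unreachable w : (forall m, ~ walk D v w m) -> level w = n.+1.
Proof. by move=> nw; rewrite /level; case: pselect => // e; exfalso; case: e => m /asboolP; exact: nw. Qed.

Lemma level_at w m : m <= n -> at_distance D v w m <-> level w = m.
Proof.
move=> mn; split=> [[wm hm]|lm].
  have [h1 h2] := level_walk wm; apply/eqP; rewrite eqn_leq h2; exact: hm.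
have [[k wk]|/forallNP/level_unreachable] := pselect (exists k, walk D v w k); last by lia.
split=> [|j wj]; first by rewrite -lm; case: (level_walk wk).
by rewrite -lm; case: (level_walk wj).
Qed.

Lemma level_le w m : m <= n -> (exists2 j, j <= m & at_distance D v w j) <-> level w <= m.
Proof.
move=> mn; split=> [[j jm h]|lm].
  by have /level_at := leq_trans jm mn => /(_ w) [/(_ h) ->].
by exists (level w) => //; apply/level_at => //; lia.
Qed.

Lemma level_adj u w : adj K u w -> level u <= (level w).+1.
Proof.
rewrite adj_sym -adjacentE => uw.
have [[k wk]|/forallNP nw] := pselect (exists k, walk D v w k).
  have [h _] := level_walk wk; have [_ //] := level_walk (walk_rcons h uw).
have nu m : ~ walk D v u m.
  move=> h; apply: (nw m.+1); apply: walk_rcons h _; by move: uw; rewrite !adjacentE adj_sym.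
by rewrite !level_unreachable.
Qed.

Lemma level_eq0 u : level u = 0 -> u = v.
Proof.
have [_ h] := level_at u (leq0n n) => u0.
by have [[p [_ <- /size0nil ->]] _] := h u0.
Qed.

Lemma level_root u w : level u = 0 -> level w = 0 -> u = w.
Proof. by move=> /level_eq0 -> /level_eq0 ->. Qed.

Lemma level_center : level v = 0.
Proof. by apply/level_at => //; split=> //; exists [::]. Qed.

Lemma level_parent w : 0 < level w -> level w <= n ->
  exists2 u, adj K w u & level w = (level u).+1.
Proof.
move=> w0 wn; have [+ _] : at_distance D v w (level w) by exact/level_at.
case E : (level w) w0 => [//|k] _ /walk_last[u uk uw].
have wu : adj K w u by rewrite adj_sym -adjacentE.
exists u => //; have := level_adj wu; have [_] := level_walk uk; rewrite E; lia.
Qed.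

Lemma sphere_lengthE m : m <= n -> sphere_length D v m = #|sphere_edges K level m|.
Proof.
move=> mn; apply: card_fset_sets => A; rewrite !inE /sphere_edge /mkset /= card_finset; split=> [[DA cA h]|/andP[/andP[/asboolP DA /eqP cA] /subsetP h]].
  rewrite cA eqxx andbT; apply/andP; split; first exact/asboolP.
  by apply/subsetP => w wA; rewrite inE; apply/eqP; apply: (proj1 (level_at w mn)); apply: h; rewrite finmap.inE.
split=> // w; rewrite finmap.inE /= => /h; rewrite inE => /eqP; exact: (proj2 (level_at w mn)).
Qed.

Lemma sphere_areaE : sphere_area D v n = #|[set T in triangles K | [forall w in T, level w <= n]]|.
Proof.
apply: card_fset_sets => A; rewrite !inE /mkset /= card_finset; split=> [[DA cA h]|/andP[/andP[/asboolP DA /eqP cA] /forall_inP h]].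
  rewrite cA eqxx andbT; apply/andP; split; first exact/asboolP.
  by apply/forall_inP => w wA; apply: (proj1 (level_le w (leqnn n))); apply: h; rewrite finmap.inE.
by split=> // w; rewrite finmap.inE /= => /h; exact: (proj2 (level_le w (leqnn n))).
Qed.

End Levels.

(** The successor moves the index by one, and the jump from the last position to 0 also changes the
    parity because the size is even. *)
Lemma next_index_parity (T : eqType) (c : seq T) (x : T) : uniq c -> ~~ odd (size c) -> x \in c ->
  odd (index (next c x) c) = ~~ odd (index x c).
Proof.
move=> uc ec xc; have ix : index x c < size c by rewrite index_mem.
rewrite next_nth xc; case: c uc ec xc ix => [//|y p] uc ec xc ix.
have [lt|ge] := ltnP (index x (y :: p)).+1 (size (y :: p)).
  by rewrite -[nth y p _]/(nth y (y :: p) _.+1) index_uniq.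
rewrite nth_default ?index_head; last by move: ge => /=; lia.
have E : (index x (y :: p)).+1 = size (y :: p) by lia.
by move: ec; rewrite -E /= negbK => ->.
Qed.

(** * Marked vertices in uniform discs *)

Section Uniform.
Variables (R : realType) (V : finType) (D : complex V) (s t : nat).
Hypothesis discD : triangulated_disc R D.
Hypothesis unifD : forall u, interior_vertex R D u -> uniform_at R s t D u.
Hypotheses (st : s != t) (t_even : ~~ odd t).
Let K := simplices D.
Let I := interior_set R D.
Let KD : disc_like K I := disc_disc_like discD.

Lemma uniform_adj u w : u \in I -> w \in I -> adj K u w -> #|nbrs K u| = s -> #|nbrs K w| = t.
Proof.
move=> uI wI uw us; have /asboolP/unifD[_ h _] : `[< interior_vertex R D u >] by move: uI; rewrite inE.
have ks : k_vertex R s D u by apply/k_vertexE.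
have [/k_vertexE[]//|wb] := h ks w (ltac:(by rewrite adjacentE)).
by move: wI; rewrite inE asboolE => -[_ /(_ wb)].
Qed.

Lemma uniform_triangle T : T \in triangles K -> T \subset I ->
  \sum_(w in T) (#|nbrs K w| == s) = 1.
Proof.
move=> TT /subsetP TI; have [KT cT] := triangleP TT.
have ex : exists2 a, a \in T & #|nbrs K a| = s.
  apply: contrapT => nex.
  have alls a : a \in T -> #|nbrs K a| = t /\ ~ k_vertex R s D a.
    move=> aT; have ns : #|nbrs K a| <> s by move=> h; apply: nex; exists a.
    have /asboolP aI : `[< interior_vertex R D a >] by have := TI a aT; rewrite inE.
    split; last by move=> /k_vertexE[].
    by have [[/k_vertexE[_ h] | /k_vertexE[_ h]] _ _] := unifD aI; [case: (ns h) | exact: h].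
  have nb a : a \in T -> ~ boundary_vertex R D a.
    by move=> /TI; rewrite inE asboolE => -[].
  have /card_gt0P[a aT] : 0 < #|T| by rewrite cT.
  have /cards2P[b [x [bx Tbx]]] : #|T :\ a| == 2 by have := cardsD1 a T; rewrite aT cT; lia.
  have Tm y : y \in [set b; x] -> y \in T /\ adj K a y.
    rewrite -Tbx !inE => /andP[ya yT]; split=> //.
    by apply: triangle_adj KD _ _ _ TT aT yT _; rewrite eq_sym.
  have [bT ab] := Tm b (set21 _ _); have [xT ax] := Tm x (set22 _ _).
  have kt : k_vertex R t D a by apply/k_vertexE; split; [exact: TI | case: (alls a aT)].
  have aI : interior_vertex R D a by case: kt.
  have [_ _ /(_ kt)[c [uc sc cE [_ full] par]]] := unifD aI.
  have inc y : adj K a y -> y \in c by move=> ay; rewrite cE adjacentE.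
  have vc y : y \in c -> vertex (cycle_complex c) y.
    move=> yc; split; first by apply/fset0Pn; exists y; rewrite finmap.inE.
    by exists y => //; apply/fsubsetP => z; rewrite !finmap.inE => /eqP ->; rewrite eqxx.
  have Dbx : D [fset y in [set b; x]]%fset.
    apply/simplicesP; apply: (dl_face KD KT); first by apply/set0Pn; exists b; rewrite set21.
    by apply/subsetP => y /Tm[].
  (* Fullness makes the edge from [b] to [x] an edge of the cycle around [a], so these two vertices
     are cyclically consecutive. *)
  have [_ [z zc /fsubsetP sub]] : cycle_complex c [fset y in [set b; x]]%fset.
    by apply: full Dbx _ => y; rewrite finmap.inE /= => /Tm[_ /inc /vc].
  have zm y : y \in [set b; x] -> y = z \/ y = next c z.
    move=> yS; have : y \in [fset y in [set b; x]]%fset by rewrite finmap.inE.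
    by move=> /sub; rewrite !finmap.inE => /orP[] /eqP; [left | right].
  (* Counted from 0, odd positions carry s-vertices or boundary vertices, of which [T] is assumed to
     have none. *)
  have szT y : y \in c -> y \in T -> ~~ odd (index y c).
    move=> yc yT; apply/negP => oy; have := par (index y c); rewrite -sc index_mem yc => /(_ isT).
    rewrite /= oy /= nth_index // => -[ky|yb]; last exact: (nb y yT yb).
    by have [_] := alls y yT.
  have pz := next_index_parity uc (ltac:(by rewrite sc)) zc.
  have zT : z \in T /\ next c z \in T.
    have [eb|eb] := zm b (set21 _ _); have [ex|ex] := zm x (set22 _ _);
      by move: bx bT xT; rewrite ?eb ?ex ?eqxx.
  have [/(szT z zc) e1 zT2] := zT; have := szT (next c z).
  by rewrite mem_next pz => /(_ zc zT2); rewrite e1.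
have [a aT sa] := ex.
rewrite (bigD1 a) //= sa eqxx big1 // => w /andP[wT wa]; apply/eqP; rewrite eqb0.
rewrite (@uniform_adj a w) //; first by rewrite eq_sym.
- exact: TI.
- exact: TI.
- by apply: triangle_adj KD _ _ _ TT aT wT _; rewrite eq_sym.
Qed.

End Uniform.

(** * Recurrences for lengths and marked vertices *)

Section Recurrences.
Variables (V : finType) (K : {set {set V}}) (I : {set V}) (lev : V -> nat) (n : nat).
Hypothesis KD : disc_like K I.
Hypothesis deg6 : forall w, w \in I -> 6 <= #|nbrs K w|.
Hypothesis lev_adj : forall u w, adj K u w -> lev u <= (lev w).+1.
Hypothesis lev_root : forall u w, lev u = 0 -> lev w = 0 -> u = w.
Hypothesis lev_parent : forall w, 0 < lev w -> lev w <= n -> exists2 u, adj K w u & lev w = (lev u).+1.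
Hypothesis lev_interior : forall w, lev w <= n -> w \in I.
Implicit Types (j k s t : nat) (chi : V -> nat).

Let rec := sphere_recurrence KD deg6 lev_adj lev_root lev_parent lev_interior.
Let cardSE := card_sphere_edges KD deg6 lev_adj lev_root lev_parent lev_interior.

Local Notation ell k := #|sphere_edges K lev k|.

(** The value at 0 is 0 and not the weight of the center: the sphere of radius 0 has no edges, and
    the recurrences sum over edges. *)
Definition mass chi k := if k is 0 then 0 else \sum_(w in sphere lev k) chi w.

Lemma sum_edges_mass chi k : k <= n ->
  \sum_(e in sphere_edges K lev k) \sum_(w in e) chi w = 2 * mass chi k.
Proof.
case: k => [|k] kn; first by rewrite (sphere_edges0 K lev_root) big_set0.
by apply: (sum_sphere_edges KD deg6 lev_adj lev_root lev_parent lev_interior).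
Qed.

Lemma mass1 k : k <= n -> mass (fun=> 1) k = ell k.
Proof.
case: k => [|k] kn; first by rewrite (sphere_edges0 K lev_root) cards0.
by rewrite /mass sum1_card cardSE.
Qed.

(** [sphere_recurrence] for the constant weight 1, whose total on a triangle is 3. *)
Lemma degree_recurrence j : 0 < j -> j < n ->
  \sum_(w in sphere lev j) #|nbrs K w| = 4 * ell j + ell j.+1 + ell j.-1.
Proof.
move=> j0 jn; have := @rec j 3 (fun=> 1) j0 jn.
rewrite !sum_edges_mass ?mass1; try lia.
under eq_bigr do rewrite mul1n; move=> h.
suff /h : forall T, T \in triangles K -> (forall w, w \in T -> lev w <= n) -> \sum_(w in T) 1 = 3 by lia.
by move=> T /triangleP[_ cT] _; rewrite sum1_card.
Qed.

Lemma marked_recurrence chi j : 0 < j -> j < n ->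
  (forall T, T \in triangles K -> (forall w, w \in T -> lev w <= n) -> \sum_(w in T) chi w = 1) ->
  \sum_(w in sphere lev j) chi w * #|nbrs K w| + 2 * mass chi j.+1 + 2 * mass chi j.-1 =
  4 * mass chi j + ell j.+1 + ell j.-1.
Proof.
move=> j0 jn h; have := @rec j 1 chi j0 jn h.
by rewrite !sum_edges_mass; lia.
Qed.

Lemma two_degrees s t j : 0 < j -> j < n ->
  (forall w, lev w <= n -> #|nbrs K w| = s \/ #|nbrs K w| = t) ->
  let chi w : nat := #|nbrs K w| == s in
  \sum_(w in sphere lev j) #|nbrs K w| + t * mass chi j = s * mass chi j + t * ell j /\
  \sum_(w in sphere lev j) chi w * #|nbrs K w| = s * mass chi j.
Proof.
move=> j0 jn st chi; rewrite -(mass1 (ltnW jn)) /mass; case: j j0 jn => // j _ jn.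
rewrite !big_distrr -!big_split /=.
have h w : w \in sphere lev j.+1 -> #|nbrs K w| = s \/ #|nbrs K w| = t.
  by rewrite inE => /eqP E; apply: st; lia.
by split; apply: eq_bigr => w /h; rewrite /chi; case: eqP => [-> _|ns [/ns//|->]] /=;
  rewrite ?muln1 ?muln0 ?mul1n ?mul0n ?addn0 ?add0n.
Qed.

End Recurrences.

Local Open Scope ring_scope.

(** * From discs to real sequences *)

Section DiscSpheres.
Variables (R : realType) (V : finType) (D : complex V) (s t : nat) (v : V) (n : nat).
Hypothesis discD : triangulated_disc R D.
Hypotheses (s6 : (6 <= s)%N) (t6 : (6 <= t)%N) (t_even : ~~ odd t).
Hypothesis unifD : forall u, interior_vertex R D u ->
  if s == t then k_vertex R t D u else uniform_at R s t D u.
Hypothesis completeD : sphere_complete R D v n.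
Hypothesis n_gt0 : (0 < n)%N.

Let K := simplices D.
Let I := interior_set R D.
Local Notation lev := (level D v n).
Let KD : disc_like K I := disc_disc_like discD.
Local Notation ell k := #|sphere_edges K lev k|.

Lemma disc_degree w : w \in I -> #|nbrs K w| = s \/ #|nbrs K w| = t.
Proof.
rewrite inE asboolE => /unifD; case: eqP => [_ /k_vertexE[_ h]|_ [[/k_vertexE[_ h]|/k_vertexE[_ h]] _ _]];
  by [left | right].
Qed.

Let deg6 w : w \in I -> (6 <= #|nbrs K w|)%N.
Proof. by move=> /disc_degree[->|->]. Qed.

Let lev_interior w : (lev w <= n)%N -> w \in I.
Proof.
move=> wn; rewrite inE; apply/asboolP; apply: (completeD wn).
exact: (proj2 (@level_at V D v n w _ wn)) erefl.
Qed.

Let lev_adj := @level_adj V D v n.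
Let lev_root := @level_root V D v n.
Let lev_parent := @level_parent V D v n.

Lemma sphere_area_ball : sphere_area D v n = (ell n + 2 * \sum_(k < n) ell k)%N.
Proof.
by rewrite sphere_areaE (card_ball_triangles KD deg6 lev_adj lev_root lev_parent lev_interior).
Qed.

Lemma sphere1_gt0 : (0 < ell 1)%N.
Proof.
rewrite (card_sphere_edges KD deg6 lev_adj lev_root lev_parent lev_interior) //.
have v0 := level_center D v n.
have vI : v \in I by apply: lev_interior; rewrite v0.
have /card_gt0P[w] : (0 < #|nbrs K v|)%N by apply: leq_trans (deg6 vI).
rewrite inE => vw; apply/card_gt0P; exists w; rewrite inE.
have wv : adj K w v by rewrite adj_sym.
have h1 : (lev w <= 1)%N by rewrite -[X in (_ <= X.+1)%N]v0; exact: lev_adj.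
have h2 : lev w != 0%N.
  by apply/eqP => /lev_root/(_ v0) E; move: (adj_neq vw); rewrite E eqxx.
by move: h1; rewrite leq_eqVlt ltnS leqn0 (negbTE h2) orbF.
Qed.

Lemma sphere_sequences : exists sg ta : nat -> R,
  [/\ sg 0%N = 0 /\ ta 0%N = 0, 0 <= sg 1%N /\ 0 <= ta 1%N,
   forall k, (k <= n)%N -> sg k + ta k = (ell k)%:R &
   forall k, (k.+1 < n)%N -> sg k.+2 + sg k = (t%:R - 4) / 2 * ta k.+1 /\
     ta k.+2 + ta k = (s%:R - 4) * sg k.+1 + (t%:R - 4) / 2 * ta k.+1].
Proof.
have st w : (lev w <= n)%N -> #|nbrs K w| = s \/ #|nbrs K w| = t by move/lev_interior/disc_degree.
have e0 : ell 0 = 0%N by rewrite (sphere_edges0 K lev_root) cards0.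
have degs k : (k.+1 < n)%N -> _ :=
  @degree_recurrence _ _ _ _ _ KD deg6 lev_adj lev_root lev_parent lev_interior k.+1 isT.
have twos k : (k.+1 < n)%N -> _ := fun kn =>
  @two_degrees _ _ _ _ _ KD deg6 lev_adj lev_root lev_parent lev_interior s t k.+1 isT kn st.
have [E|nst] := eqVneq s t.
  (* As if every vertex carried one third of a mark, so that each triangle has total mark 1. *)
  exists (fun k => (ell k)%:R / 3), (fun k => 2 * (ell k)%:R / 3).
  split; [by rewrite e0; split; field | by split; rewrite ?divr_ge0 ?mulr_ge0 | by move=> k _; field |].
  move=> k kn; have [+ _] := twos k kn; rewrite (degs k kn) E => A1.
  have : (4 * ell k.+1 + ell k.+2 + ell k)%:R = (t * ell k.+1)%:R :> R by congr (_%:R); move: A1; rewrite /= [LHS]addnC => /addnI.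
  by rewrite !natrD !natrM; split; lra.
pose chi w : nat := #|nbrs K w| == s.
have tri T : T \in triangles K -> (forall w, w \in T -> (lev w <= n)%N) -> (\sum_(w in T) chi w = 1)%N.
  move=> TT Tn; apply: (uniform_triangle discD _ nst t_even TT).
    by move=> u /unifD; rewrite (negbTE nst).
  by apply/subsetP => w /Tn; exact: lev_interior.
have marks k : (k.+1 < n)%N -> _ := fun kn =>
  @marked_recurrence _ _ _ _ _ KD deg6 lev_adj lev_root lev_parent lev_interior chi k.+1 isT kn tri.
exists (fun k => (mass lev chi k)%:R), (fun k => (ell k)%:R - (mass lev chi k)%:R).
have le1 : (mass lev chi 1 <= ell 1)%N.
  rewrite -(mass1 KD deg6 lev_adj lev_root lev_parent lev_interior n_gt0) leq_sum // => w _.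
  exact: leq_b1.
split.
- by rewrite e0 subr0.
- by rewrite ler0n subr_ge0 ler_nat.
- by move=> k _; rewrite addrC subrK.
move=> k kn; have [A1 A2] := twos k kn; have := marks k kn; rewrite A2 => A3.
move: A1 A3; rewrite (degs k kn) => /(congr1 (fun m => m%:R : R)) + /(congr1 (fun m => m%:R : R)).
by rewrite !natrD !natrM; split; lra.
Qed.

End DiscSpheres.

Theorem theorem3p3 (R : realType) (s t : nat) (hs : (6 <= s)%N) (ht : (6 <= t)%N)
    (t_even : ~~ odd t) (hst : (s, t) <> (6%N, 6%N))
    (W : choiceType) (X : complex W) (hX : st_uniform R s t X) :
  let S : R := s%:R - 4 in
  let T : R := t%:R - 4 in
  let P : R := (T + Num.sqrt (T ^+ 2 + 8 * S * T)) / 4 in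
  let L : R := Num.sqrt ((T + 8 + Num.sqrt (T ^+ 2 + 8 * S * T)) /
                         (T - 8 + Num.sqrt (T ^+ 2 + 8 * S * T))) in
  L = Num.sqrt ((P + 2) / (P - 2)) /\
  forall eps : R, 0 < eps ->
  exists2 N : nat, (1 <= N)%N &
    forall C : complex W, loop R X C ->
    forall (V : finType) (D : complex V) (f : V -> W),
      minimal_filling R X C D f ->
    forall v : V, interior_vertex R D v ->
    forall n : nat, (N <= n)%N -> sphere_complete R D v n ->
      `| (sphere_area D v n)%:R / (sphere_length D v n)%:R - L | < eps.
Proof.
have [_ _ unif] := hX; move=> S T P L.
have ST : [/\ 2 <= S, 2 <= T & 4 < S + T].
  have [s4 t4] : 2 <= S /\ 2 <= T by rewrite !lerBrDr -!natrD !ler_nat.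
  split=> //; rewrite /S /T addrACA -opprD ltrBrDr -!natrD ltr_nat.
  by have [s6|s6] := eqVneq s 6%N; have [t6|t6] := eqVneq t 6%N; move: hst; rewrite ?s6 ?t6 //; lia.
have [S2 T2 ST4] := ST; have P2 : 2 < P := root_gt2 S2 T2 ST4.
have LE : L = Num.sqrt ((P + 2) / (P - 2)).
  rewrite /L; congr Num.sqrt; move: P2; rewrite /P; set q := Num.sqrt _ => P2.
  have -> : T + 8 + q = 4 * ((T + q) / 4 + 2) by field.
  have -> : T - 8 + q = 4 * ((T + q) / 4 - 2) by field.
  by rewrite -mulf_div divff ?mul1r // pnatr_eq0.
split=> // eps eps0; have [N hN] := ratio_limit S2 T2 ST4 eps0.
(* The successor gives both the lower bound 1 on the threshold and the positivity of the radius. *)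
exists N.+1 => // C loopC V D f fillD v vI n Nn completeD.
have [[discD _ _ _] _] := fillD.
have unifD u : interior_vertex R D u -> if s == t then k_vertex R t D u else uniform_at R s t D u.
  exact: (unif C loopC V D f fillD u).
have n0 : (0 < n)%N by apply: leq_ltn_trans Nn.
have [sg [ta [[sg0 ta0] [sg1 ta1] ell rec]]] :=
  sphere_sequences discD hs ht t_even unifD completeD n0.
have pos : 0 < sg 1%N + ta 1%N.
  by rewrite ell // ltr0n; exact: sphere1_gt0 discD hs ht unifD completeD n0.
have := hN n (ltnW Nn) sg ta sg0 ta0 sg1 ta1 pos rec; rewrite -/P -LE.
rewrite (sphere_area_ball discD hs ht unifD completeD n0) (@sphere_lengthE V D v n n) //.
rewrite natrD natrM natr_sum ell // (eq_bigr (fun k : 'I_n => #|sphere_edges (simplices D) (level D v n) k|%:R)) //.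
by move=> k _; rewrite ell // ltnW.
Qed.
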